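(* Let $G$ be a group acting by homeomorphisms on the (nonempty) compact Hausdorff space $X$. The following are equivalent. \begin{enumerate} \item The $G$-action on $X$ is topologically amenable. \item $\mathrm{H}_\mathrm{b}^n(G, C(X, V)^{**})=0$ for every Banach $G$-module $V$ and every $n\geq 1$. \item $\mathrm{H}_\mathrm{b}^n(G, \mathscr{I}(C(X), W)^* )=0$ for every Banach $G$-module $W$ and every $n\geq 1$. \item $\mathrm{H}_\mathrm{b}^n(G, E^* )=0$ for every $(G,X)$-module $E$ of type M and every $n\geq 1$. \item Any of the three conditions (2), (3), (4) holds for $n=1$; that is, at least one of the following holds: $\mathrm{H}_\mathrm{b}^1(G, C(X, V)^{**})=0$ for every Banach $G$-module $V$; or $\mathrm{H}_\mathrm{b}^1(G, \mathscr{I}(C(X), W)^* )=0$ for every Banach $G$-module $W$; or $\mathrm{H}_\mathrm{b}^1(G, E^* )=0$ for every $(G,X)$-module $E$ of type M. (Each of these three conditions is, individually, equivalent to all the other items of this list.) \item $C(X, V)^{**}$ is a relatively injective Banach $G$-module for every Banach $G$-module $V$. \item $\mathscr{I}(C(X), W)^*$ is a relatively injective Banach $G$-module for every Banach $G$-module $W$. \item Every dual $(G,X)$-module of type C is a relatively injective Banach $G$-module. \item There is a $G$-invariant element in $C(X, \ell^1 G)^{**}$ summing to $1_X$. \item There is a norm one positive $G$-invariant element in $C(X, \ell^1 G)^{**}$ summing to $1_X$. \end{enumerate}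
   Context: Banach spaces and algebras are real. $G$ is an abstract (discrete) group. $X$ is a compact Hausdorff space (nonempty) on which $G$ acts by homeomorphisms. $C(X)$ is the algebra of continuous real functions with the sup norm, with $G$-action $(g\varphi)(x)=\varphi(g^{-1}x)$; $1_X$ is the constant function $1$. **Banach $G$-modules.** A Banach $G$-module is a Banach space with an isometric linear $G$-representation. $G$-morphisms are bounded linear $G$-equivariant maps. Duals $E^*$ carry the contragredient action $(g\lambda)(u)=\lambda(g^{-1}u)$, and biduals $E^{**}$ the resulting one. **Bounded cohomology.** For a Banach $G$-module $E$ and $n\ge 0$, $\mathrm{H}_\mathrm{b}^n(G,E)$ is the $n$-th cohomology of the complex $\ell^\infty(G,E)^G\to \ell^\infty(G^2,E)^G\to \ell^\infty(G^3,E)^G\to\cdots$ (with $\ell^\infty(G^{n+1},E)^G$ in degree $n$) of bounded $G$-equivariant maps $G^{n+1}\to E$ with the homogeneous differential $(df)(g_0,\dots,g_{n+1})=\sum_{i=0}^{n+1}(-1)^i f(g_0,\dots,\widehat{g_i},\dots,g_{n+1})$. **Relative injectivity.** A Banach $G$-module $E$ is relatively injective if, for every Banach $G$-module $B$ and every Banach $G$-submodule $A\subseteq B$ for which there is a norm one linear projection $B\to A$ (not required to be equivariant), every $G$-morphism $\alpha:A\to E$ extends to a $G$-morphism $\beta:B\to E$ with $\|\beta\|=\|\alpha\|$. **$C(X)$- and $(G,X)$-modules.** A (Banach) $C(X)$-module is a Banach space $E$ which is a (unital) module over the algebra $C(X)$ with $\|\varphi u\|\le\|\varphi\|\,\|u\|$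 for all $\varphi\in C(X)$, $u\in E$. A $(G,X)$-module is a Banach space that is both a Banach $G$-module and a $C(X)$-module such that $g(\varphi (g^{-1}u))=(g\varphi)u$ for all $g\in G$, $\varphi\in C(X)$, $u\in E$. The dual $E^*$ of a $(G,X)$-module $E$ is a $(G,X)$-module with the contragredient $G$-action and $(\varphi\lambda)(u)=\lambda(\varphi u)$; a dual $(G,X)$-module is one of the form $E^*$ for a $(G,X)$-module $E$. **Types M and C.** A $C(X)$-module $E$ is of type M if for all $n$, all $u\in E$ and all $\varphi_1,\dots,\varphi_n\in C(X)$ with $\varphi_i\ge 0$, $$\|\varphi_1u\|+\cdots+\|\varphi_nu\|\le\|\varphi_1+\cdots+\varphi_n\|\cdot\|u\|.$$ It is of type C if for all $n$, all $u_1,\dots,u_n\in E$ and all $\varphi_1,\dots,\varphi_n\in C(X)$ with $\varphi_i\ge0$, $$\|\varphi_1u_1+\cdots+\varphi_nu_n\|\le\|\varphi_1+\cdots+\varphi_n\|\cdot\max_i\|u_i\|.$$ **$C(X,V)$.** For a Banach $G$-module $V$, $C(X,V)$ is the space of norm-continuous maps $\eta:X\to V$ with norm $\sup_{x}\|\eta(x)\|_V$, with $G$-action $(g\eta)(x)=g\,\eta(g^{-1}x)$ and pointwise multiplication by $C(X)$. In particular this defines $C(X,\ell^1G)$, where $G$ acts on $\ell^1G$ by left translation. **Integral operators.** For a Banach space $W$, $\mathscr{I}(C(X),W)$ is the space of integral operators (in Grothendieck's sense): bounded linear $T:C(X)\to W$ such that the bilinear form $(\varphi,w^* )\mapsto w^*(T\varphi)$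 on $C(X)\times W^*$ extends to a bounded linear functional on the injective tensor product of $C(X)$ and $W^*$, which is identified with $C(X,W^* )$; the norm of $T$ is the norm of that functional. It is a $C(X)$-module via $(\psi T)(\varphi)=T(\psi\varphi)$ and, if $W$ is a Banach $G$-module, a $(G,X)$-module via $(gT)(\varphi)=g\,T(g^{-1}\varphi)$. **Topological amenability.** The $G$-action on $X$ is topologically amenable if there is a net $\{\mu^j\}_{j\in J}$ in $C(X,\ell^1G)$ such that every $\mu^j(x)$ ($x\in X$) is a probability on $G$ (a nonnegative element of $\ell^1 G$ with sum one) and $\lim_{j}\|g\mu^j-\mu^j\|_{C(X,\ell^1G)}=0$ for every $g\in G$. **Summation and positivity.** Let $\Sigma:C(X,\ell^1G)\to C(X)$ be the map $(\Sigma\mu)(x)=\sum_{g\in G}\mu(x)(g)$. An element $m\in C(X,\ell^1G)^{**}$ sums to $1_X$ if $\Sigma^{**}(m)\in C(X)^{**}$ is the canonical image of $1_X$. $C(X,\ell^1G)$ is a Banach lattice for the pointwise (and coordinatewise) order; positivity in $C(X,\ell^1G)^{**}$ is with respect to the bidual order ($m\ge 0$ iff $m(\lambda)\ge0$ for every positive functional $\lambda\in C(X,\ell^1G)^*$). *)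

(* Defs.v *)
From HB Require Import structures.
From mathcomp Require Import all_boot all_order all_algebra.
From mathcomp Require Import lra finmap.
From mathcomp Require Import all_classical all_reals all_analysis.
Set Implicit Arguments.
Unset Strict Implicit.
Unset Printing Implicit Defensive.
Import Order.TTheory GRing.Theory Num.Theory.
Import numFieldNormedType.Exports.
Local Open Scope classical_set_scope.
Local Open Scope ring_scope.

Section completeness.
Context {R : realType}.

Lemma cauchy_near (E : normedModType R) (F : set_system E) :
  ProperFilter F -> cauchy F ->
  forall e : R, 0 < e -> exists a, \forall b \near F, `|a - b| < e.
Proof.
move=> FF /cauchyP Fc e e0; have [a Fa] := Fc _ e0; exists a.
by move: Fa; rewrite -ball_normE.
Qed.

Lemma eval_complete (E : normedModType R) (V : completeNormedModType R)
    (T : Type) (ev : E -> T -> V) (c : T -> R) :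
  (forall a b t, `|ev a t - ev b t| <= c t * `|a - b|) ->
  (forall (F : set_system E) (h : T -> V), ProperFilter F ->
    (forall e : R, 0 < e -> exists a, \forall b \near F, `|a - b| < e) ->
    (forall t, ev ^~ t @ F --> h t) ->
    exists f, forall (e : R) a, 0 < e -> (\forall b \near F, `|a - b| < e) ->
      `|a - f| <= e) ->
  forall F : set_system E, ProperFilter F -> cauchy F -> cvg F.
Proof.
move=> lip H F FF Fc; have Fe := cauchy_near FF Fc.
have evc t : exists l : V, ev ^~ t @ F --> l.
  exists (lim (ev ^~ t @ F)); apply: cauchy_cvg; apply/cauchyP => e e0.
  have c0 : 0 < `|c t| + 1 by rewrite ltr_wpDl.
  have [a Fa] := Fe (e / (`|c t| + 1)) (divr_gt0 e0 c0).
  exists (ev a t); rewrite /fmapE /= -ball_normE /=.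
  apply: filterS Fa => b /= ab; apply: le_lt_trans (lip _ _ _) _.
  have : (`|c t| + 1) * `|a - b| < e by rewrite mulrC -ltr_pdivlMr.
  apply: le_lt_trans; apply: ler_wpM2r => //.
  by rewrite (le_trans (ler_norm _)) // lerDl.
have [h hP] := choice evc.
have [f fP] := H F h FF Fe hP.
apply/cvg_ex; exists f; apply/cvgrPdist_le => e e0.
have e20 : 0 < e / 2 by rewrite divr_gt0.
have [a Fa] := Fe _ e20.
have af := fP _ _ e20 Fa.
apply: filterS Fa => b ab.
have -> : f - b = (a - b) - (a - f) by rewrite opprB [RHS]addrC addrA subrK.
rewrite (le_trans (ler_normB _ _)) // (splitr e) lerD // ltW //.
Qed.

Lemma limit_dist (E : normedModType R) (V : normedModType R) (F : set_system E)
   (u : E -> V) (l v : V) (e : R) :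
  ProperFilter F -> u @ F --> l -> (\forall b \near F, `|v - u b| <= e) ->
  `|v - l| <= e.
Proof.
move=> FF ul H; apply/ler_addgt0Pr => d d0.
near F => b.
have -> : v - l = (v - u b) - (l - u b) by rewrite opprB addrA subrK.
rewrite (le_trans (ler_normB _ _)) // lerD //; first by near: b.
by near: b; move/cvgrPdist_le : ul => /(_ _ d0).
Unshelve. all: by end_near. Qed.

End completeness.

Section blin.
Context {R : realType}.

(* The operator norm of f restricted to the subspace A. *)
Definition opnorm (E F : normedModType R) (A : set E) (f : E -> F) : R :=
  sup [set `|f u| | u in [set u | A u /\ `|u| <= 1]].

(* Bounded linear maps E -> F, with the operator norm; the dual E^* is the case
   F = R^o. *)
Definition blin_pred (E F : normedModType R) : {pred E -> F} :=
  mem [set f : E -> F | linear f /\ exists M, forall u, `|f u| <= M * `|u|].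

Record blin (E F : normedModType R) := Blin {
  blin_fun :> E -> F;
  blin_funP : blin_fun \in @blin_pred E F }.

Section instances.
Context (E F : normedModType R).

HB.instance Definition _ := [isSub for @blin_fun E F].
HB.instance Definition _ := [Choice of blin E F by <:].

Lemma blin_submod : submod_closed (@blin_pred E F).
Proof.
split.
  rewrite inE; split; first by move=> a u v /=; rewrite scaler0 addr0.
  by exists 0 => u; rewrite normr0 mul0r.
move=> a f g; rewrite !inE => -[fl [M fM]] [gl [N gN]]; split.
  move=> b u v; rewrite -[LHS]/(a *: f (b *: u + v) + g (b *: u + v)).
  rewrite -[RHS]/(b *: (a *: f u + g u) + (a *: f v + g v)) fl gl.
  by rewrite !scalerDr !scalerA (mulrC a) addrACA.
exists (`|a| * M + N) => u; rewrite /= mulrDl (le_trans (ler_normD _ _)) //.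
by rewrite lerD ?gN// normrZ -mulrA ler_wpM2l.
Qed.
HB.instance Definition _ :=
  GRing.isSubmodClosed.Build R (E -> F) (@blin_pred E F) blin_submod.
HB.instance Definition _ := [SubChoice_isSubLmodule of blin E F by <:].

Lemma blinD (f g : blin E F) u : (f + g) u = f u + g u. Proof. by []. Qed.
Lemma blinZ a (f : blin E F) u : (a *: f) u = a *: f u. Proof. by []. Qed.
Lemma blin0 u : (0 : blin E F) u = 0. Proof. by []. Qed.
Lemma blinN (f : blin E F) u : (- f) u = - f u. Proof. by []. Qed.
Lemma blinB (f g : blin E F) u : (f - g) u = f u - g u. Proof. by []. Qed.

Lemma blin_linear (f : blin E F) : linear f.
Proof. by have := blin_funP f; rewrite inE => -[]. Qed.
HB.instance Definition _ (f : blin E F) :=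
  GRing.isLinear.Build R E F *:%R f (blin_linear f).

Lemma blinP (f g : blin E F) : f =1 g -> f = g.
Proof. by move=> /funext fg; exact: val_inj. Qed.

Definition blin_norm (f : blin E F) : R := opnorm setT f.

Lemma blin_norm_has_sup (f : blin E F) :
  has_sup [set `|f u| | u in [set u | setT u /\ `|u| <= 1]].
Proof.
split; first by exists `|f 0|, 0 => //=; rewrite normr0.
have := blin_funP f; rewrite inE => -[_ [M fM]].
exists `|M| => _ [u [_ u1] <-]; rewrite (le_trans (fM _)) //.
rewrite (@le_trans _ _ (`|M| * `|u|)) //; last by rewrite ler_piMr.
by rewrite ler_wpM2r // ler_norm.
Qed.

Lemma ler_blin_norm0 (f : blin E F) u : `|f u| <= blin_norm f * `|u|.
Proof.
have [->|u0] := eqVneq u 0; first by rewrite linear0 !normr0 mulr0.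
have nu : 0 < `|u| by rewrite normr_gt0.
rewrite -ler_pdivrMr //.
have -> : `|f u| / `|u| = `|f (`|u|^-1 *: u)|.
  by rewrite linearZ normrZ normfV normr_id mulrC.
apply: sup_ubound; first by case: (blin_norm_has_sup f).
exists (`|u|^-1 *: u) => //; split => //=.
by rewrite normrZ normfV normr_id mulVf ?normr_eq0.
Qed.

Lemma blin_norm_le0 (f : blin E F) M :
  0 <= M -> (forall u, `|f u| <= M * `|u|) -> blin_norm f <= M.
Proof.
move=> M0 fM; apply: ge_sup; first by case: (blin_norm_has_sup f).
move=> _ [u [_ u1] <-]; rewrite (le_trans (fM _)) //.
by rewrite ler_piMr.
Qed.

Lemma blin_norm_ge0 (f : blin E F) : 0 <= blin_norm f.
Proof.
rewrite (@le_trans _ _ `|f 0|) //; apply: sup_ubound.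
  by case: (blin_norm_has_sup f).
by exists 0 => //=; rewrite normr0.
Qed.

Lemma blin_normD f g : blin_norm (f + g) <= blin_norm f + blin_norm g.
Proof.
apply: blin_norm_le0 => [|u]; first by rewrite addr_ge0 ?blin_norm_ge0.
rewrite blinD (le_trans (ler_normD _ _)) // mulrDl.
by rewrite lerD ?ler_blin_norm0.
Qed.

Lemma blin_normZ_le a f : blin_norm (a *: f) <= `|a| * blin_norm f.
Proof.
apply: blin_norm_le0 => [|u]; first by rewrite mulr_ge0 ?blin_norm_ge0.
by rewrite blinZ normrZ -mulrA ler_wpM2l ?ler_blin_norm0.
Qed.

Lemma blin_normZ a f : blin_norm (a *: f) = `|a| * blin_norm f.
Proof.
apply/eqP; rewrite eq_le blin_normZ_le /=.
have [->|a0] := eqVneq a 0; first by rewrite normr0 mul0r blin_norm_ge0.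
rewrite -ler_pdivlMl ?normr_gt0 //.
by rewrite -{1}(scalerK a0 f) -normfV; exact: blin_normZ_le.
Qed.

Lemma blin_norm0_eq0 f : blin_norm f = 0 -> f = 0.
Proof.
move=> f0; apply: blinP => u; apply/eqP; rewrite -normr_le0.
by rewrite (le_trans (ler_blin_norm0 _ _)) // f0 mul0r.
Qed.

HB.instance Definition _ := Lmodule_isNormed.Build R (blin E F)
  blin_normD blin_normZ blin_norm0_eq0.

Lemma ler_blin_norm (f : blin E F) u : `|f u| <= `|f| * `|u|.
Proof. exact: ler_blin_norm0. Qed.

Lemma blin_norm_le (f : blin E F) M :
  0 <= M -> (forall u, `|f u| <= M * `|u|) -> `|f| <= M.
Proof. exact: blin_norm_le0. Qed.

End instances.

Lemma blin_complete (E : normedModType R) (F : completeNormedModType R)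
  (Fi : set_system (blin E F)) : ProperFilter Fi -> cauchy Fi -> cvg Fi.
Proof.
move: Fi; apply: (@eval_complete R (blin E F) F E (fun f u => f u) (fun u : E => `|u|)).
  by move=> a b u; rewrite mulrC -blinB; exact: ler_blin_norm.
move=> Fi h FF Fc hP.
have hl : linear h.
  move=> k u v; apply: (cvg_unique _ (hP _)) => //.
  have -> : (fun f : blin E F => f (k *: u + v)) = (fun f => k *: f u + f v).
    by apply/funext => f; rewrite linearP.
  apply: cvgD; last exact: hP.
  by apply: cvgZr; exact: hP.
have key (e : R) a : 0 < e -> (\forall b \near Fi, `|a - b| < e) ->
    forall u, `|a u - h u| <= e * `|u|.
  move=> e0 ae u; apply: (limit_dist _ (hP u)).
  apply: filterS ae => b /ltW ab.
  by rewrite -blinB (le_trans (ler_blin_norm _ _)) // ler_wpM2r.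
have hb : h \in @blin_pred E F.
  rewrite inE; split => //.
  have [a Fa] := Fc 1 ltr01; exists (`|a| + 1) => u.
  have -> : h u = a u - (a u - h u) by rewrite opprB addrC subrK.
  rewrite (le_trans (ler_normB _ _)) // mulrDl.
  by rewrite lerD ?ler_blin_norm// key.
exists (Blin hb) => e a e0 ae; apply: blin_norm_le; first exact: ltW.
by move=> u; rewrite blinB; exact: key.
Qed.

HB.instance Definition _ (E : normedModType R) (F : completeNormedModType R) :=
  Uniform_isComplete.Build (blin E F) (@blin_complete E F).
End blin.


Notation dual E := (blin E (GRing.regular _)).

HB.mixin Record isCompactHausdorff X & Topological X := {
  compactT : compact [set: X];
  hausdorffT : hausdorff_space X;
  inhabitedT : [set: X] !=set0 }.

#[short(type="compactHausdorffType")]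
HB.structure Definition CompactHausdorff :=
  { X of isCompactHausdorff X & Topological X }.

Section cfun.
Context {R : realType}.

Definition cfun_pred (X : topologicalType) (V : normedModType R) :
  {pred X -> V} := mem [set f : X -> V | continuous f].

(* With the sup norm below, for X compact; C(X) itself is cfun X R^o. *)
Record cfun (X : topologicalType) (V : normedModType R) := CFun {
  cfun_fun :> X -> V;
  cfun_funP : cfun_fun \in @cfun_pred X V }.

Section lmod.
Context (X : topologicalType) (V : normedModType R).

HB.instance Definition _ := [isSub for @cfun_fun X V].
HB.instance Definition _ := [Choice of cfun X V by <:].

Lemma cfun_submod : submod_closed (@cfun_pred X V).
Proof.
split; first by rewrite inE => x; exact: cvg_cst.
move=> a f g; rewrite !inE => fc gc x.
by apply: cvgD; [apply: cvgZr; exact: fc | exact: gc].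
Qed.
HB.instance Definition _ :=
  GRing.isSubmodClosed.Build R (X -> V) (@cfun_pred X V) cfun_submod.
HB.instance Definition _ := [SubChoice_isSubLmodule of cfun X V by <:].

Lemma cfunD (f g : cfun X V) x : (f + g) x = f x + g x. Proof. by []. Qed.
Lemma cfunZ a (f : cfun X V) x : (a *: f) x = a *: f x. Proof. by []. Qed.
Lemma cfun0 x : (0 : cfun X V) x = 0. Proof. by []. Qed.
Lemma cfunN (f : cfun X V) x : (- f) x = - f x. Proof. by []. Qed.
Lemma cfunB (f g : cfun X V) x : (f - g) x = f x - g x. Proof. by []. Qed.

Lemma cfun_continuous (f : cfun X V) : continuous f.
Proof. by have := cfun_funP f; rewrite inE. Qed.

Lemma cfunP (f g : cfun X V) : f =1 g -> f = g.
Proof. by move=> /funext fg; exact: val_inj. Qed.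

Lemma mem_cfun (f : X -> V) : continuous f -> f \in @cfun_pred X V.
Proof. by rewrite inE. Qed.

Definition mk_cfun (f : X -> V) (fc : continuous f) : cfun X V :=
  CFun (mem_cfun fc).
End lmod.

Section norm.
Context (X : compactHausdorffType) (V : normedModType R).

Definition cfun_norm (f : cfun X V) : R := sup [set `|f x| | x in [set: X]].

Lemma cfun_norm_has_sup (f : cfun X V) :
  has_sup [set `|f x| | x in [set: X]].
Proof.
split; first by have [x _] := @inhabitedT X; exists `|f x|, x.
have nc : continuous (fun x => `|f x|).
  by move=> x; apply: cvg_norm; exact: cfun_continuous.
have := continuous_compact (continuous_subspaceT nc) (@compactT X).
move=> /compact_bounded [M [_ HM]].
exists (M + 1) => y yX.
by rewrite (le_trans (ler_norm _)) // (HM (M + 1)) // ltrDl.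
Qed.

Lemma ler_cfun_norm0 (f : cfun X V) x : `|f x| <= cfun_norm f.
Proof.
by apply: sup_ubound; [case: (cfun_norm_has_sup f) | exists x].
Qed.

Lemma cfun_norm_le0 (f : cfun X V) M :
  (forall x, `|f x| <= M) -> cfun_norm f <= M.
Proof.
move=> fM; apply: ge_sup; first by case: (cfun_norm_has_sup f).
by move=> _ [x _ <-].
Qed.

Lemma cfun_norm_ge0 (f : cfun X V) : 0 <= cfun_norm f.
Proof.
have [x _] := @inhabitedT X.
exact: (le_trans (normr_ge0 (f x)) (ler_cfun_norm0 f x)).
Qed.

Lemma cfun_normD f g : cfun_norm (f + g) <= cfun_norm f + cfun_norm g.
Proof.
apply: cfun_norm_le0 => x.
by rewrite cfunD (le_trans (ler_normD _ _)) // lerD ?ler_cfun_norm0.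
Qed.

Lemma cfun_normZ_le a f : cfun_norm (a *: f) <= `|a| * cfun_norm f.
Proof.
apply: cfun_norm_le0 => x.
by rewrite cfunZ normrZ ler_wpM2l ?ler_cfun_norm0.
Qed.

Lemma cfun_normZ a f : cfun_norm (a *: f) = `|a| * cfun_norm f.
Proof.
apply/eqP; rewrite eq_le cfun_normZ_le /=.
have [->|a0] := eqVneq a 0; first by rewrite normr0 mul0r cfun_norm_ge0.
rewrite -ler_pdivlMl ?normr_gt0 //.
by rewrite -{1}(scalerK a0 f) -normfV; exact: cfun_normZ_le.
Qed.

Lemma cfun_norm0_eq0 f : cfun_norm f = 0 -> f = 0.
Proof.
move=> f0; apply: cfunP => x; apply/eqP; rewrite -normr_le0 -f0.
exact: ler_cfun_norm0.
Qed.

HB.instance Definition _ := Lmodule_isNormed.Build R (cfun X V)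
  cfun_normD cfun_normZ cfun_norm0_eq0.

Lemma ler_cfun_norm (f : cfun X V) x : `|f x| <= `|f|.
Proof. exact: ler_cfun_norm0. Qed.

Lemma cfun_norm_le (f : cfun X V) M :
  (forall x, `|f x| <= M) -> `|f| <= M.
Proof. exact: cfun_norm_le0. Qed.
End norm.

Lemma cfun_complete (X : compactHausdorffType) (V : completeNormedModType R)
  (F : set_system (cfun X V)) : ProperFilter F -> cauchy F -> cvg F.
Proof.
move: F; apply: (@eval_complete R (cfun X V) V X (fun f x => f x) (fun=> 1)).
  by move=> a b x; rewrite mul1r -cfunB; exact: ler_cfun_norm.
move=> F h FF Fc hP.
have key (e : R) a : 0 < e -> (\forall b \near F, `|a - b| < e) ->
    forall x, `|a x - h x| <= e.
  move=> e0 ae x; apply: (limit_dist _ (hP x)).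
  apply: filterS ae => b /ltW ab.
  by rewrite -cfunB (le_trans (ler_cfun_norm _ _)).
have hc : continuous h.
  move=> x; apply/cvgrPdist_le => e e0.
  have e40 : 0 < e / 4 by rewrite divr_gt0.
  have [a Fa] := Fc _ e40; have ah := key _ _ e40 Fa.
  have /cvgrPdist_le /(_ _ e40) := @cfun_continuous _ _ a x.
  apply: filterS => y axy.
  have -> : h x - h y = - (a x - h x) + (a x - a y) + (a y - h y).
    by rewrite opprB !addrA !subrK.
  rewrite (le_trans (ler_normD _ _)) //.
  rewrite (@le_trans _ _ (e / 4 + e / 4 + e / 4)) //; last first.
    by lra.
  rewrite lerD // (le_trans (ler_normD _ _)) // lerD //.
  by rewrite normrN.
exists (mk_cfun hc) => e a e0 ae; apply: cfun_norm_le => x.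
by rewrite cfunB; exact: key.
Qed.

HB.instance Definition _ (X : compactHausdorffType)
    (V : completeNormedModType R) :=
  Uniform_isComplete.Build (cfun X V) (@cfun_complete X V).

End cfun.

Section ell1.
Context (R : realType).

Definition ell1_pred (T : choiceType) : {pred T -> R^o} :=
  mem [set f : T -> R^o | summable [set: T] (EFin \o f)].

Record ell1 (T : choiceType) := Ell1 {
  ell1_fun :> T -> R^o;
  ell1_funP : ell1_fun \in @ell1_pred T }.

Context (T : choiceType).

Definition ell1_norm (f : T -> R^o) : R :=
  fine (\esum_(t in [set: T]) `|(f t)%:E|)%E.

Lemma ell1_bound (f : T -> R^o) (M : R) :
  (forall A : {fset T}, \sum_(t <- A) `|f t| <= M) ->
  summable [set: T] (EFin \o f) /\ ell1_norm f <= M.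
Proof.
move=> H.
have fM : (\esum_(t in [set: T]) `|(f t)%:E| <= M%:E)%E.
  apply: ge_ereal_sup => _ [A [Afin _] <-].
  rewrite fsbig_finite //= sumEFin lee_fin.
  exact: H.
split; first by apply: le_lt_trans fM _; rewrite ltry.
have f0 : (0 <= \esum_(t in [set: T]) `|(f t)%:E|)%E by exact: esum_ge0.
rewrite /ell1_norm -lee_fin fineK // ge0_fin_numE //.
by apply: le_lt_trans fM _; rewrite ltry.
Qed.

Lemma ler_ell1_sum (f : T -> R^o) (A : {fset T}) :
  summable [set: T] (EFin \o f) -> \sum_(t <- A) `|f t| <= ell1_norm f.
Proof.
move=> fs; have f0 : (0 <= \esum_(t in [set: T]) `|(f t)%:E|)%E.
  exact: esum_ge0.
rewrite /ell1_norm -lee_fin fineK ?ge0_fin_numE //.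
apply: ereal_sup_ubound; exists [set` A]; first by split.
by rewrite fsbig_finite //= set_fsetK sumEFin.
Qed.

HB.instance Definition _ := [isSub for @ell1_fun T].
HB.instance Definition _ := [Choice of ell1 T by <:].

Lemma ell1_closed (f g : T -> R^o) a : summable [set: T] (EFin \o f) ->
  summable [set: T] (EFin \o g) ->
  summable [set: T] (EFin \o (a *: f + g)) /\
  ell1_norm (a *: f + g) <= `|a| * ell1_norm f + ell1_norm g.
Proof.
move=> fs gs; apply: ell1_bound => A.
apply: (@le_trans _ _ (`|a| * (\sum_(t <- A) `|f t|) + \sum_(t <- A) `|g t|)).
  rewrite mulr_sumr -big_split /=; apply: ler_sum => t _.
  by rewrite (le_trans (ler_normD _ _)) // normrM.
by rewrite lerD ?ler_wpM2l ?ler_ell1_sum.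
Qed.

Lemma ell1_submod : submod_closed (@ell1_pred T).
Proof.
split.
  rewrite inE; apply: (ell1_bound (M := 0) _).1 => A.
  by rewrite big1 // => t _; rewrite normr0.
move=> a f g; rewrite !inE => fs gs; exact: (ell1_closed a fs gs).1.
Qed.
HB.instance Definition _ :=
  GRing.isSubmodClosed.Build R (T -> R^o) (@ell1_pred T) ell1_submod.
HB.instance Definition _ := [SubChoice_isSubLmodule of ell1 T by <:].

Lemma ell1D (f g : ell1 T) x : (f + g) x = f x + g x. Proof. by []. Qed.
Lemma ell1Z a (f : ell1 T) x : (a *: f) x = a *: f x. Proof. by []. Qed.
Lemma ell1_0 x : (0 : ell1 T) x = 0. Proof. by []. Qed.
Lemma ell1N (f : ell1 T) x : (- f) x = - f x. Proof. by []. Qed.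
Lemma ell1B (f g : ell1 T) x : (f - g) x = f x - g x. Proof. by []. Qed.

Lemma ell1P (f g : ell1 T) : f =1 g -> f = g.
Proof. by move=> /funext fg; exact: val_inj. Qed.

Lemma ell1_summable (f : ell1 T) : summable [set: T] (EFin \o f).
Proof. by have := ell1_funP f; rewrite inE. Qed.

Lemma ell1_norm_ge0 (f : T -> R^o) : 0 <= ell1_norm f.
Proof. by apply: fine_ge0; exact: esum_ge0. Qed.

Lemma ell1_normD (f g : ell1 T) :
  ell1_norm (f + g) <= ell1_norm f + ell1_norm g.
Proof.
have := (ell1_closed 1 (ell1_summable f) (ell1_summable g)).2.
by rewrite scale1r normr1 mul1r.
Qed.

Lemma ell1_normZ_le a (f : ell1 T) :
  ell1_norm (a *: f) <= `|a| * ell1_norm f.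
Proof.
apply: (ell1_bound _).2 => A.
under eq_bigr do rewrite ell1Z normrZ.
by rewrite -mulr_sumr ler_wpM2l // ler_ell1_sum //; exact: ell1_summable.
Qed.

Lemma ell1_normZ a (f : ell1 T) : ell1_norm (a *: f) = `|a| * ell1_norm f.
Proof.
apply/eqP; rewrite eq_le ell1_normZ_le /=.
have [->|a0] := eqVneq a 0; first by rewrite normr0 mul0r ell1_norm_ge0.
rewrite -ler_pdivlMl ?normr_gt0 //.
by rewrite -{1}(scalerK a0 f) -normfV; exact: ell1_normZ_le.
Qed.

Lemma ler_ell1_eval (f : ell1 T) t : `|f t| <= ell1_norm f.
Proof.
have := ler_ell1_sum [fset t]%fset (ell1_summable f).
by rewrite big_seq_fset1.
Qed.

Lemma ell1_norm0_eq0 (f : ell1 T) : ell1_norm f = 0 -> f = 0.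
Proof.
move=> f0; apply: ell1P => x; apply/eqP; rewrite -normr_le0 -f0.
exact: ler_ell1_eval.
Qed.

HB.instance Definition _ := Lmodule_isNormed.Build R (ell1 T)
  ell1_normD ell1_normZ ell1_norm0_eq0.

Lemma ell1_normE (f : ell1 T) : `|f| = ell1_norm f. Proof. by []. Qed.

Lemma ell1_complete (F : set_system (ell1 T)) :
  ProperFilter F -> cauchy F -> cvg F.
Proof.
move: F; apply: (@eval_complete R (ell1 T) R^o T (fun f x => f x) (fun=> 1)).
  by move=> a b x; rewrite mul1r -ell1B; exact: ler_ell1_eval.
move=> F h FF Fc hP.
have key (e : R) a : 0 < e -> (\forall b \near F, `|a - b| < e) ->
    forall A : {fset T}, \sum_(t <- A) `|a t - h t| <= e.
  move=> e0 ae A.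
  have cv : (fun b : ell1 T => \sum_(t <- A) `|a t - b t|) @ F -->
      \sum_(t <- A) `|a t - h t|.
    elim: (enum_fset A) => [|t s IH].
      rewrite big_nil; under eq_fun do rewrite big_nil; exact: cvg_cst.
    rewrite big_cons; under eq_fun do rewrite big_cons.
    apply: cvgD => //; apply: cvg_norm; apply: cvgB; first exact: cvg_cst.
    exact: hP.
  rewrite -(cvg_lim _ cv) //; apply: limr_le; first by apply/cvg_ex; eexists; exact: cv.
  apply: filterS ae => b /ltW ab; apply: le_trans ab.
  by have := ler_ell1_sum A (ell1_summable (a - b)).
have hs : h \in @ell1_pred T.
  have [a Fa] := Fc 1 ltr01.
  have -> : h = (-1) *: ((a : T -> R^o) - h) + (a : T -> R^o).
    by rewrite scaleN1r opprB subrK.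
  rewrite inE; apply: (ell1_closed _ _ (ell1_summable a)).1.
  by apply: (ell1_bound (M := 1) _).1 => A; exact: key.
exists (Ell1 hs) => e a e0 ae; rewrite ell1_normE.
by apply: (ell1_bound _).2 => A; exact: key.
Qed.

HB.instance Definition _ :=
  Uniform_isComplete.Build (ell1 T) (@ell1_complete).

(* The sum of an absolutely summable family over an arbitrary index type, as the
   sum of the positive parts minus the sum of the negative parts. *)
Definition ell1_sum (f : ell1 T) : R :=
  fine (\esum_(t in [set: T]) ((EFin \o f)^\+ t)%E -
        \esum_(t in [set: T]) ((EFin \o f)^\- t)%E)%E.

End ell1.

Section hahn_banach.
Context {R : realType} (V : normedModType R).

Let domlin (M : set (V * R)) :=
  (forall a p q, M p -> M q -> M (a *: p.1 + q.1, a * p.2 + q.2)) /\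
  (forall p, M p -> p.2 <= `|p.1|).

Let domlin_ext (M : set (V * R)) (x0 : V) : M (0, 0) -> domlin M ->
  exists c : R,
    domlin [set q | exists p t, M p /\ q = (p.1 + t *: x0, p.2 + t * c)].
Proof.
move=> M0 [Mlin Mdom].
have MZ a p : M p -> M (a *: p.1, a * p.2).
  by move=> Mp; have := Mlin a _ _ Mp M0; rewrite /= !addr0.
have cut p q : M p -> M q -> p.2 - `|p.1 - x0| <= `|q.1 + x0| - q.2.
  move=> Mp Mq; rewrite lerBlDr addrAC lerBrDr.
  have := Mdom _ (Mlin 1 _ _ Mp Mq); rewrite /= scale1r mul1r.
  move=> /le_trans; apply.
  have -> : p.1 + q.1 = (p.1 - x0) + (q.1 + x0) by rewrite [RHS]addrACA addNr addr0.
  by rewrite [leRHS]addrC; exact: ler_normD.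
pose S := [set p.2 - `|p.1 - x0| | p in M].
have supS : has_sup S.
  split; first by exists (0 - `|0 - x0|), (0, 0).
  by exists (`|0 + x0| - 0) => _ [p Mp <-]; exact: (cut p (0, 0)).
have cge p : M p -> p.2 - `|p.1 - x0| <= sup S.
  by move=> Mp; apply: sup_ubound; [case: supS|exists p].
have cle q : M q -> sup S <= `|q.1 + x0| - q.2.
  by move=> Mq; apply: ge_sup; [case: supS|move=> _ [p Mp <-]; exact: cut].
exists (sup S); split.
  move=> a _ _ [p [t [Mp ->]]] [q [s [Mq ->]]] /=.
  exists (a *: p.1 + q.1, a * p.2 + q.2), (a * t + s); split; first exact: Mlin.
  rewrite /= scalerDr scalerDl scalerA mulrDr mulrDl -mulrA.
  by rewrite addrACA [X in (_, X)]addrACA.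
move=> _ [p [t [Mp ->]]] /=.
have [t0|t0|<-] := ltrgtP 0 t.
- have := cle _ (MZ t^-1 _ Mp); rewrite /= lerBrDr => H.
  have : t * (sup S + t^-1 * p.2) <= t * `|t^-1 *: p.1 + x0|.
    by rewrite ler_wpM2l // ltW.
  rewrite mulrDr mulVKf ?gt_eqF // addrC => /le_trans; apply.
  by rewrite -{1}(gtr0_norm t0) -normrZ scalerDr scalerA divff ?gt_eqF // scale1r.
- have nt : 0 < - t by rewrite oppr_gt0.
  have := cge _ (MZ (- t)^-1 _ Mp); rewrite /= lerBlDr => H.
  have : (- t) * ((- t)^-1 * p.2) <= (- t) * (sup S + `|(- t)^-1 *: p.1 - x0|).
    by rewrite ler_wpM2l // ltW.
  rewrite mulVKf ?gt_eqF // mulrDr mulNr -lerBlDl opprK => /le_trans; apply.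
  rewrite -{1}(gtr0_norm nt) -normrZ scalerBr scalerA divff ?gt_eqF // scale1r.
  by rewrite scaleNr opprK.
- by rewrite scale0r mul0r !addr0; exact: Mdom.
Qed.

Lemma hahn_banach_norming (v : V) :
  exists w : dual V, (forall u, `|w u| <= `|u|) /\ w v = `|v|.
Proof.
pose G0 : set (V * R) := [set (t *: v, t * `|v|) | t in [set: R]].
have dG0 : domlin G0.
  split.
    move=> a _ _ [t _ <-] [s _ <-]; exists (a * t + s) => //=.
    by rewrite scalerDl mulrDl scalerA mulrA.
  by move=> _ [t _ <-] /=; rewrite normrZ ler_wpM2r // ler_norm.
pose P (A : set (V * R)) := domlin (G0 `|` A).
have [A [PA Amax]] : exists A, P A /\ forall B, A `<` B -> ~ P B.
  apply: Zorn_bigcup => F FP Ftot.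
  have pick p q : (G0 `|` \bigcup_(X in F) X) p ->
      (G0 `|` \bigcup_(X in F) X) q ->
      (G0 p /\ G0 q) \/ exists2 B, F B & (G0 `|` B) p /\ (G0 `|` B) q.
    move=> [Gp|[B FB Bp]] [Gq|[C FC Cq]].
    - by left.
    - by right; exists C => //; split; [left|right].
    - by right; exists B => //; split; [right|left].
    - right; have [BC|CB] := Ftot _ _ FB FC.
        by exists C => //; split; right => //; exact: BC.
      by exists B => //; split; right => //; exact: CB.
  split.
    move=> a p q Up Uq; have [[Gp Gq]|[B FB [Bp Bq]]] := pick _ _ Up Uq.
      by left; exact: dG0.1.
    have [G|BB] := (FP _ FB).1 a _ _ Bp Bq; first by left.
    by right; exists B.
  move=> p Up; have [[Gp _]|[B FB [Bp _]]] := pick _ _ Up Up.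
    exact: dG0.2.
  exact: (FP _ FB).2 p Bp.
pose M := G0 `|` A; have [Mlin Mdom] : domlin M by exact: PA.
have M0 : M (0, 0) by left; exists 0 => //; rewrite scale0r mul0r.
have tot x : exists r, M (x, r).
  apply: contrapT => nx.
  have [c dN] := domlin_ext x M0 PA.
  set N := [set q | _] in dN.
  have MN : M `<=` N.
    move=> p Mp; exists p, 0; split => //.
    by rewrite scale0r mul0r !addr0; case: p {Mp}.
  have Nx : N (x, c).
    by exists (0, 0), 1; rewrite /= scale1r mul1r !add0r.
  apply: (Amax N).
    split; first by move=> p Ap; apply: MN; right.
    by move=> /(_ _ Nx) Ax; apply: nx; exists c; right.
  rewrite /P (_ : G0 `|` N = N) //; apply/setUidPr => p Gp.
  by apply: MN; left.
have Mfun x r s : M (x, r) -> M (x, s) -> r = s.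
  have H r' s' : M (x, r') -> M (x, s') -> r' <= s'.
    move=> Mr Ms; have := Mdom _ (Mlin (-1) _ _ Ms Mr).
    by rewrite /= scaleN1r addNr normr0 mulN1r addrC subr_le0.
  by move=> Mr Ms; apply/eqP; rewrite eq_le !H.
have [f fM] := choice tot.
have flin : linear (f : V -> R^o).
  move=> a x y; apply: (Mfun (a *: x + y)) => //.
  exact: (Mlin a (x, f x) (y, f y)).
have fN x : f (- x) = - f x.
  have := flin (-1) x 0; rewrite scaleN1r addr0 => ->.
  have := flin 0 0 0; rewrite !scale0r addr0 add0r.
  move=> f0; rewrite [f 0](Mfun 0 _ 0) //.
  by rewrite addr0 scaleN1r.
have fle x : `|f x| <= `|x|.
  rewrite ler_norml lerNl -fN (Mdom (x, f x)) // andbT.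
  by rewrite -[leRHS]normrN (Mdom (- x, f (- x))).
have fP : f \in @blin_pred R V R^o.
  by rewrite inE; split => //; exists 1 => u; rewrite mul1r.
exists (Blin fP); split => //=.
apply: (Mfun v) => //; left; exists 1 => //; by rewrite scale1r mul1r.
Qed.

End hahn_banach.

Section density.
Context {R : realType} (X : compactHausdorffType) (V : normedModType R).

Lemma cfun_tensor_subproof (phi : cfun X R^o) (v : V) :
  continuous (fun x => phi x *: v).
Proof. by move=> x; apply: cvgZl; exact: cfun_continuous. Qed.

Definition cfun_tensor (phi : cfun X R^o) (v : V) : cfun X V :=
  mk_cfun (@cfun_tensor_subproof phi v).

Lemma cfun_tensor_dense (eta : cfun X V) (e : R) : 0 < e ->
  exists (D : {fset X}) (psi : X -> cfun X R^o),
    `|eta - \sum_(i <- D) cfun_tensor (psi i) (eta i)| <= e.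
Proof.
move=> e0.
pose U x := [set y | `|eta x - eta y| < e].
have Uop x : open (U x).
  apply: (@open_comp _ _ (fun y => `|eta x - eta y|) [set r | r < e]).
    move=> y _; apply: cvg_norm; apply: cvgB; first exact: cvg_cst.
    exact: cfun_continuous.
  exact: open_lt.
have xU x : U x x by rewrite /U /= subrr normr0.
have norX : normal_space X := compact_normal hausdorffT compactT.
have sep x : uniform_separator (~` U x) [set x].
  have /normal_separatorP := norX; apply.
  - exact: R.
  - exact: open_closedC.
  - exact/accessible_closed_set1/hausdorff_accessible/hausdorffT.
  - by apply/disjoints_subset => y /= nU yx; apply: nU; rewrite yx.
pose phi x : X -> R^o := @Urysohn X R (~` U x) [set x].
have phic x : continuous (phi x) by exact: Urysohn_continuous.
have phi0 x y : ~ U x y -> phi x y = 0.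
  by move=> nU; apply: (@Urysohn_sub0 X R _ _ (sep x) (phi x y)); exists y.
have phi1 x : phi x x = 1.
  by apply: (@Urysohn_sub1 X R _ _ (sep x) (phi x x)); exists x.
have phi_ge0 x y : 0 <= phi x y.
  have : range (phi x) (phi x y) by exists y.
  by move=> /Urysohn_range /=; rewrite in_itv /= => /andP[].
have [x0 _] := @inhabitedT X.
pose X' : ptopologicalType := HB.pack (X : Type) X (isPointed.Build X x0).
have : @cover_compact X' setT by rewrite -compact_cover; exact: (@compactT X).
move=> /(_ X setT (fun x => [set y | 0 < phi x y])) [].
- move=> x _; apply: (@open_comp _ _ (phi x) [set r | 0 < r]).
    by move=> y _; exact: phic.
  exact: open_gt.
- by move=> x _; exists x => //=; rewrite phi1.
move=> D _ DX.
pose s y := \sum_(i <- D) phi i y.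
have s0 y : 0 < s y.
  have [i /= iD iy] := DX y I.
  rewrite /s (big_fsetD1 i) //= ltr_pwDl // sumr_ge0 // => j _; exact: phi_ge0.
have sc : continuous (s : X -> R^o).
  rewrite /s; elim: (enum_fset D) => [|t l IH].
    rewrite [X in continuous X](_ : _ = fun=> 0); first by move=> y; exact: cvg_cst.
    by apply/funext => y; rewrite big_nil.
  rewrite [X in continuous X](_ : _ =
    fun y => phi t y + \sum_(i <- l) phi i y); last first.
    by apply/funext => y; rewrite big_cons.
  by move=> y; apply: cvgD; [exact: phic|exact: IH].
have psic i : continuous ((fun y => phi i y / s y) : X -> R^o).
  move=> y; apply: cvgM; first exact: phic.
  by apply: cvgV; [rewrite gt_eqF|exact: sc].
exists D, (fun i => mk_cfun (psic i)).
apply: cfun_norm_le => y.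
have sumE (u : X -> cfun X V) (l : seq X) :
    (\sum_(i <- l) u i) y = \sum_(i <- l) u i y.
  by elim: l => [|i l IH]; rewrite ?big_nil // !big_cons cfunD IH.
rewrite cfunB sumE.
have -> : eta y = \sum_(i <- D) (phi i y / s y) *: eta y.
  by rewrite -scaler_suml -mulr_suml -/(s y) divff ?scale1r // gt_eqF.
rewrite -sumrB (le_trans (ler_norm_sum _ _ _)) //.
have -> : e = \sum_(i <- D) (phi i y / s y) * e.
  by rewrite -mulr_suml -mulr_suml -/(s y) divff ?mul1r // gt_eqF.
apply: ler_sum => i _; rewrite /= -scalerBr normrZ ger0_norm; last first.
  by rewrite divr_ge0 // ltW.
have [Uiy|nU] := pselect (U i y).
  by rewrite ler_wpM2l // ?divr_ge0 ?(ltW (s0 y))// distrC ltW.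
by rewrite phi0 // !mul0r.
Qed.

Lemma cfun_dual_ext (F : normedModType R) (P Q : blin (cfun X V) F) :
  (forall phi v, P (cfun_tensor phi v) = Q (cfun_tensor phi v)) -> P = Q.
Proof.
move=> PQ; apply: blinP => eta; apply/eqP; rewrite -subr_eq0 -normr_le0.
apply/ler_addgt0Pr => e e0; rewrite add0r -blinB.
have c0 : 0 < `|P - Q| + 1 by rewrite ltr_wpDl.
have [D [psi H]] := cfun_tensor_dense eta (divr_gt0 e0 c0).
have -> : (P - Q) eta =
    (P - Q) (eta - \sum_(i <- D) cfun_tensor (psi i) (eta i)).
  have E0 i : (P - Q) (cfun_tensor (psi i) (eta i)) = 0.
    by rewrite blinB PQ subrr.
  by rewrite linearB linear_sum big1 => [|i _]; [rewrite subr0|exact: E0].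
rewrite (le_trans (ler_blin_norm _ _)) //.
rewrite (@le_trans _ _ ((`|P - Q| + 1) * (e / (`|P - Q| + 1)))) //.
  by rewrite ler_pM // lerDl.
by rewrite mulrC divfK // gt_eqF.
Qed.

End density.

Section intop.
Context {R : realType}.

(* Phi extends the bilinear form (phi, w) |-> w (T phi) to C(X, W^* ), the
   injective tensor product of C(X) and W^*, in which cfun_tensor phi w is the
   elementary tensor of phi and w. Such a Phi is unique by
   integral_extension_uniq, so the integral norm `|intop_ext T| of T does not
   depend on the choice made by xget. *)
Definition integral_extension (X : compactHausdorffType) (W : normedModType R)
    (T : blin (cfun X R^o) W) (Phi : dual (cfun X (dual W))) : Prop :=
  forall (phi : cfun X R^o) (w : dual W), Phi (cfun_tensor phi w) = w (T phi).

Definition intop_pred (X : compactHausdorffType) (W : normedModType R) :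
    {pred blin (cfun X R^o) W} :=
  mem [set T : blin (cfun X R^o) W | exists Phi, integral_extension T Phi].

Record intop (X : compactHausdorffType) (W : normedModType R) := IntOp {
  intop_fun :> blin (cfun X R^o) W;
  intop_funP : intop_fun \in @intop_pred X W }.

Section norm.
Context (X : compactHausdorffType) (W : normedModType R).

HB.instance Definition _ := [isSub for @intop_fun X W].
HB.instance Definition _ := [Choice of intop X W by <:].

Lemma integral_extensionD a (S T : blin (cfun X R^o) W) P Q :
  integral_extension S P -> integral_extension T Q ->
  integral_extension (a *: S + T) (a *: P + Q).
Proof.
move=> SP TQ phi w.
by rewrite !blinD !blinZ SP TQ linearD linearZ.
Qed.

Lemma intop_submod : submod_closed (@intop_pred X W).
Proof.
split; first by rewrite inE; exists 0 => phi w; rewrite !blin0 linear0.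
move=> a f g; rewrite !inE => -[P fP] [Q gQ]; exists (a *: P + Q).
exact: integral_extensionD.
Qed.
HB.instance Definition _ := GRing.isSubmodClosed.Build R
  (blin (cfun X R^o) W) (@intop_pred X W) intop_submod.
HB.instance Definition _ := [SubChoice_isSubLmodule of intop X W by <:].

Lemma integral_extension_uniq (T : blin (cfun X R^o) W) P Q :
  integral_extension T P -> integral_extension T Q -> P = Q.
Proof.
by move=> TP TQ; apply: cfun_dual_ext => phi w; rewrite TP TQ.
Qed.

Definition intop_ext (T : intop X W) : dual (cfun X (dual W)) :=
  xget 0 (integral_extension T).

Lemma intop_extP (T : intop X W) : integral_extension T (intop_ext T).
Proof. by have := intop_funP T; rewrite inE => ex; exact: (xgetPex 0 ex). Qed.

Lemma intop_extE (T : intop X W) P : integral_extension T P -> intop_ext T = P.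
Proof. exact/integral_extension_uniq/intop_extP. Qed.

Lemma intop_ext_linear : linear intop_ext.
Proof.
move=> a S T; apply: intop_extE.
exact: integral_extensionD (intop_extP S) (intop_extP T).
Qed.
HB.instance Definition _ := GRing.isLinear.Build R (intop X W)
  (dual (cfun X (dual W))) *:%R intop_ext intop_ext_linear.

Definition intop_norm (T : intop X W) : R := `|intop_ext T|.

Lemma cfun_tensor_norm_le (V : normedModType R) (phi : cfun X R^o) (v : V) :
  `|cfun_tensor phi v| <= `|phi| * `|v|.
Proof.
by apply: cfun_norm_le => x; rewrite normrZ ler_wpM2r // ler_cfun_norm.
Qed.

Lemma ler_intop_norm0 (T : intop X W) phi : `|T phi| <= intop_norm T * `|phi|.
Proof.
have [w [w1 <-]] := hahn_banach_norming (T phi).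
rewrite (le_trans (ler_norm _)) // -(intop_extP T).
rewrite (le_trans (ler_blin_norm _ _)) // ler_wpM2l //.
rewrite (le_trans (cfun_tensor_norm_le _ _)) // ler_piMr //.
by apply: blin_norm_le => // u; rewrite mul1r.
Qed.

Lemma intop_normD S T : intop_norm (S + T) <= intop_norm S + intop_norm T.
Proof. by rewrite /intop_norm linearD ler_normD. Qed.

Lemma intop_normZ a T : intop_norm (a *: T) = `|a| * intop_norm T.
Proof. by rewrite /intop_norm linearZ normrZ. Qed.

Lemma intop_norm0_eq0 T : intop_norm T = 0 -> T = 0.
Proof.
move=> T0; apply: val_inj; apply: blinP => phi; apply/eqP.
by rewrite -normr_le0 (le_trans (ler_intop_norm0 _ _)) // T0 mul0r.
Qed.

HB.instance Definition _ := Lmodule_isNormed.Build R (intop X W)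
  intop_normD intop_normZ intop_norm0_eq0.

Lemma intop_normE (T : intop X W) : `|T| = `|intop_ext T|. Proof. by []. Qed.

Lemma intop_op_norm (T : intop X W) : `|T : blin (cfun X R^o) W| <= `|T|.
Proof. by apply: blin_norm_le => // u; exact: ler_intop_norm0. Qed.

End norm.

Lemma intop_complete (X : compactHausdorffType) (W : completeNormedModType R)
  (F : set_system (intop X W)) : ProperFilter F -> cauchy F -> cvg F.
Proof.
pose V : completeNormedModType R := dual (cfun X (dual W)).
move: F; apply: (@eval_complete R (intop X W) V unit (fun T _ => intop_ext T)
  (fun=> 1)).
  by move=> S T _; rewrite mul1r -linearB.
move=> F h FF Fc /(_ tt); set P := h tt => TP.
have [S TS] : exists S : blin (cfun X R^o) W,
    (fun T : intop X W => T : blin (cfun X R^o) W) @ F --> S.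
  exists (lim ((fun T : intop X W => T : blin (cfun X R^o) W) @ F)).
  apply: cauchy_cvg; apply/cauchyP => e e0; have [a Fa] := Fc e e0.
  exists (a : blin _ _); rewrite /fmapE /= -ball_normE /=.
  apply: filterS Fa => b /=; apply: le_lt_trans.
  exact: (intop_op_norm (a - b)).
have ev (E G : normedModType R) (u : intop X W -> blin E G) (l : blin E G) x :
    u @ F --> l -> (fun T => u T x) @ F --> l x.
  move=> /cvgrPdist_le ul; apply/cvgrPdist_le => e e0.
  have x0 : 0 < `|x| + 1 by rewrite ltr_wpDl.
  have := ul _ (divr_gt0 e0 x0); apply: filterS => T lT.
  rewrite -blinB (le_trans (ler_blin_norm _ _)) //.
  rewrite (@le_trans _ _ (e / (`|x| + 1) * (`|x| + 1))) //.
    by rewrite ler_pM // lerDl.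
  by rewrite divfK // gt_eqF.
have SP : integral_extension S P.
  move=> phi w.
  have c1 := ev _ _ (@intop_ext X W) _ (cfun_tensor phi w) TP.
  have c2 : (fun T : intop X W => w (T phi)) @ F --> w (S phi).
    have := ev _ _ (fun T : intop X W => T : blin (cfun X R^o) W) _ phi TS.
    move=> c3; apply: (cvg_comp _ _ c3).
    apply: (@linear_bounded_continuous R W R^o w).1.
    apply/linear_boundedP; exists `|w|; split; first exact: num_real.
    by move=> r wr x; rewrite (le_trans (ler_blin_norm _ _)) // ler_wpM2r // ltW.
  have E : (fun T : intop X W => intop_ext T (cfun_tensor phi w)) =
    (fun T : intop X W => w (T phi)).
    by apply/funext => T; rewrite intop_extP.
  by rewrite E in c1; exact: (cvg_unique _ c1 c2).
have SI : S \in @intop_pred X W by rewrite inE; exists P.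
exists (IntOp SI) => e a e0 ae; rewrite intop_normE linearB /=.
rewrite (@intop_extE _ _ (IntOp SI) P SP).
apply: (limit_dist _ TP).
by apply: filterS ae => b /ltW; rewrite intop_normE linearB.
Qed.

HB.instance Definition _ (X : compactHausdorffType)
    (W : completeNormedModType R) :=
  Uniform_isComplete.Build (intop X W) (@intop_complete X W).

End intop.

HB.mixin Record isBanachGModule (R : realType) (G : groupType) E
    & CompleteNormedModule R E := {
  gact : G -> E -> E;
  gact_linear : forall g, linear (gact g);
  gact1 : forall u, gact 1%g u = u;
  gactM : forall g h u, gact (g * h)%g u = gact g (gact h u);
  gact_norm : forall g u, `|gact g u| = `|u| }.

#[short(type="banachGModType")]
HB.structure Definition BanachGModule (R : realType) (G : groupType) :=
  { E of isBanachGModule R G E & CompleteNormedModule R E }.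

HB.mixin Record isGSpace (G : groupType) X & Topological X := {
  xact : G -> X -> X;
  xact_continuous : forall g, continuous (xact g);
  xact1 : forall x, xact 1%g x = x;
  xactM : forall g h x, xact (g * h)%g x = xact g (xact h x) }.

#[short(type="compactGSpaceType")]
HB.structure Definition CompactGSpace (G : groupType) :=
  { X of isGSpace G X & CompactHausdorff X }.

Section gact_theory.
Context {R : realType} {G : groupType} (E : banachGModType R G).

HB.instance Definition _ (g : G) :=
  GRing.isLinear.Build R E E *:%R (gact g) (gact_linear g).

Lemma gactK (g : G) : cancel (gact g : E -> E) (gact g^-1%g).
Proof. by move=> u; rewrite -gactM mulVg gact1. Qed.
Lemma gactVK (g : G) : cancel (gact g^-1%g : E -> E) (gact g).
Proof. by move=> u; rewrite -gactM mulgV gact1. Qed.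
End gact_theory.

(* With G acting trivially on R^o, the action (g T)(u) = g (T (g^-1 u)) on blin E F
   specializes to the contragredient action on duals, see dual_gactE. *)
Section trivial_action.
Context {R : realType} {G : groupType}.
Let triv (g : G) (u : R^o) : R^o := u.
Let triv_linear g : linear (triv g). Proof. by []. Qed.
HB.instance Definition _ := isBanachGModule.Build R G R^o
  triv_linear (fun=> erefl) (fun _ _ => fun=> erefl) (fun _ => fun=> erefl).
End trivial_action.

Section blin_action.
Context {R : realType} {G : groupType} (E F : banachGModType R G).

Lemma blin_gact_subproof (g : G) (T : blin E F) :
  (fun u => gact g (T (gact g^-1%g u))) \in @blin_pred R E F.
Proof.
rewrite inE; split=> [a u v|]; first by rewrite !linearP.
by exists `|T| => u; rewrite gact_norm (le_trans (ler_blin_norm _ _)) // gact_norm.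
Qed.
Definition blin_gact (g : G) (T : blin E F) : blin E F :=
  Blin (blin_gact_subproof g T).

Let blin_gact_linear g : linear (blin_gact g).
Proof. by move=> a S T; apply: blinP => u /=; rewrite linearP. Qed.
Let blin_gact1 T : blin_gact 1%g T = T.
Proof. by apply: blinP => u /=; rewrite invg1 !gact1. Qed.
Let blin_gactM g h T : blin_gact (g * h)%g T = blin_gact g (blin_gact h T).
Proof. by apply: blinP => u /=; rewrite invgM !gactM. Qed.
Let blin_gact_norm_le g T : `|blin_gact g T| <= `|T|.
Proof.
apply: blin_norm_le => // u.
by rewrite gact_norm (le_trans (ler_blin_norm _ _)) // gact_norm.
Qed.
Let blin_gact_norm g T : `|blin_gact g T| = `|T|.
Proof.
apply/eqP; rewrite eq_le blin_gact_norm_le /=.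
rewrite -{1}[T]blin_gact1 -(mulVg g) blin_gactM.
exact: blin_gact_norm_le.
Qed.
HB.instance Definition _ := isBanachGModule.Build R G (blin E F)
  blin_gact_linear blin_gact1 blin_gactM blin_gact_norm.

Lemma blin_gactE (g : G) (T : blin E F) u :
  gact g T u = gact g (T (gact g^-1%g u)).
Proof. by []. Qed.
End blin_action.

Lemma dual_gactE (R : realType) (G : groupType) (E : banachGModType R G) (g : G)
  (lam : dual E) u : gact g lam u = lam (gact g^-1%g u).
Proof. by []. Qed.

Section cfun_action.
Context {R : realType} {G : groupType}.
Context (X : compactGSpaceType G) (V : banachGModType R G).

Lemma gact_continuous (g : G) : continuous (gact g : V -> V).
Proof.
apply: (@linear_bounded_continuous R V V (gact g)).1.
apply/linear_boundedP; exists 1; split; first exact: num_real.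
by move=> r r1 u; rewrite /= gact_norm ler_peMl // ltW.
Qed.

Lemma cfun_gact_subproof (g : G) (eta : cfun X V) :
  continuous (fun x => gact g (eta (xact g^-1%g x))).
Proof.
move=> x; apply: (@continuous_comp _ _ _ (fun x => eta (xact g^-1%g x))).
  apply: continuous_comp; first exact: xact_continuous.
  exact: cfun_continuous.
exact: gact_continuous.
Qed.
Definition cfun_gact (g : G) (eta : cfun X V) : cfun X V :=
  mk_cfun (@cfun_gact_subproof g eta).

Let cfun_gact_linear g : linear (cfun_gact g).
Proof. by move=> a S T; apply: cfunP => x /=; rewrite linearP. Qed.
Let cfun_gact1 eta : cfun_gact 1%g eta = eta.
Proof. by apply: cfunP => x /=; rewrite invg1 gact1 xact1. Qed.
Let cfun_gactM g h eta : cfun_gact (g * h)%g eta = cfun_gact g (cfun_gact h eta).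
Proof. by apply: cfunP => x /=; rewrite invgM gactM xactM. Qed.
Let cfun_gact_norm_le g eta : `|cfun_gact g eta| <= `|eta|.
Proof. by apply: cfun_norm_le => x /=; rewrite gact_norm ler_cfun_norm. Qed.
Let cfun_gact_norm g eta : `|cfun_gact g eta| = `|eta|.
Proof.
apply/eqP; rewrite eq_le cfun_gact_norm_le /=.
rewrite -{1}[eta]cfun_gact1 -(mulVg g) cfun_gactM.
exact: cfun_gact_norm_le.
Qed.
HB.instance Definition _ := isBanachGModule.Build R G (cfun X V)
  cfun_gact_linear cfun_gact1 cfun_gactM cfun_gact_norm.

Lemma cfun_gactE (g : G) (eta : cfun X V) x :
  gact g eta x = gact g (eta (xact g^-1%g x)).
Proof. by []. Qed.
End cfun_action.

Section ell1_action.
Context {R : realType} {G : groupType}.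

Lemma ell1_gact_bound (g : G) (f : ell1 R G) (A : {fset G}) :
  \sum_(h <- A) `|f (g^-1 * h)%g| <= `|f|.
Proof.
rewrite -(big_map (fun h => g^-1 * h)%g predT (fun h => `|f h|)).
rewrite ell1_normE.
have -> : \sum_(i <- [seq (g^-1 * h)%g | h <- A]) `|f i| =
  \sum_(i <- [fset (g^-1 * h)%g | h in A]%fset) `|f i|.
  apply: perm_big; apply: uniq_perm; [|exact: fset_uniq|].
    by rewrite map_inj_uniq ?fset_uniq //; exact: mulgI.
  by move=> h; apply/mapP/imfsetP => -[k ? ->]; exists k.
by apply: ler_ell1_sum; exact: ell1_summable.
Qed.

Lemma ell1_gact_subproof (g : G) (f : ell1 R G) :
  (fun h => f (g^-1 * h)%g) \in @ell1_pred R G.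
Proof. by rewrite inE; exact: (ell1_bound (ell1_gact_bound g f)).1. Qed.
Definition ell1_gact (g : G) (f : ell1 R G) : ell1 R G :=
  Ell1 (ell1_gact_subproof g f).

Let ell1_gact_linear g : linear (ell1_gact g).
Proof. by move=> a S T; apply: ell1P. Qed.
Let ell1_gact1 f : ell1_gact 1%g f = f.
Proof. by apply: ell1P => x /=; rewrite invg1 mul1g. Qed.
Let ell1_gactM g h f : ell1_gact (g * h)%g f = ell1_gact g (ell1_gact h f).
Proof. by apply: ell1P => x /=; rewrite invgM mulgA. Qed.
Let ell1_gact_norm_le g f : `|ell1_gact g f| <= `|f|.
Proof. exact: (ell1_bound (ell1_gact_bound g f)).2. Qed.
Let ell1_gact_norm g f : `|ell1_gact g f| = `|f|.
Proof.
apply/eqP; rewrite eq_le ell1_gact_norm_le /=.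
rewrite -{1}[f]ell1_gact1 -(mulVg g) ell1_gactM.
exact: ell1_gact_norm_le.
Qed.
HB.instance Definition _ := isBanachGModule.Build R G (ell1 R G)
  ell1_gact_linear ell1_gact1 ell1_gactM ell1_gact_norm.
Lemma ell1_gactE (g : G) (f : ell1 R G) h :
  gact g f h = f (g^-1 * h)%g.
Proof. by []. Qed.
End ell1_action.

Section intop_action.
Context {R : realType} {G : groupType}.
Context (X : compactGSpaceType G) (W : banachGModType R G).

Lemma integral_extension_gact (g : G) (T : blin (cfun X R^o) W) P :
  integral_extension T P -> integral_extension (gact g T) (gact g P).
Proof.
move=> TP phi w.
rewrite !blin_gactE; have -> : gact g^-1%g (cfun_tensor phi w) =
  cfun_tensor (gact g^-1%g phi) (gact g^-1%g w).
  by apply: cfunP => x; rewrite /= linearZ.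
rewrite TP blin_gactE invgK.
by [].
Qed.

Lemma intop_gact_subproof (g : G) (T : intop X W) :
  gact g (T : blin (cfun X R^o) W) \in @intop_pred R X W.
Proof.
rewrite inE; exists (gact g (intop_ext T)).
exact/integral_extension_gact/intop_extP.
Qed.
Definition intop_gact (g : G) (T : intop X W) : intop X W :=
  IntOp (intop_gact_subproof g T).

Let intop_gact_linear g : linear (intop_gact g).
Proof. by move=> a S T; apply: val_inj; rewrite /= linearP. Qed.
Let intop_gact1 f : intop_gact 1%g f = f.
Proof. by apply: val_inj; rewrite /= gact1. Qed.
Let intop_gactM g h f : intop_gact (g * h)%g f = intop_gact g (intop_gact h f).
Proof. by apply: val_inj; rewrite /= gactM. Qed.
Let intop_gact_norm g f : `|intop_gact g f| = `|f|.
Proof.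
rewrite !intop_normE (@intop_extE _ _ _ _ (gact g (intop_ext f))) ?gact_norm //.
exact/integral_extension_gact/intop_extP.
Qed.
HB.instance Definition _ := isBanachGModule.Build R G (intop X W)
  intop_gact_linear intop_gact1 intop_gactM intop_gact_norm.

Lemma intop_gactE (g : G) (T : intop X W) phi :
  gact g T phi = gact g (T (gact g^-1%g phi)).
Proof. by []. Qed.
End intop_action.

Section cfun_mul.
Context {R : realType} (X : compactHausdorffType) (V : normedModType R).

Lemma cfun_mul_subproof (phi : cfun X R^o) (eta : cfun X V) :
  continuous (fun x => phi x *: eta x).
Proof. by move=> x; apply: cvgZ; exact: cfun_continuous. Qed.
(* For V = R^o this is the product of the algebra C(X). *)
Definition cfun_mul (phi : cfun X R^o) (eta : cfun X V) : cfun X V :=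
  mk_cfun (@cfun_mul_subproof phi eta).

Lemma cfun_mul_norm phi eta : `|cfun_mul phi eta| <= `|phi| * `|eta|.
Proof.
by apply: cfun_norm_le => x; rewrite normrZ ler_pM // ler_cfun_norm.
Qed.
End cfun_mul.

Lemma cfun_one_subproof (R : realType) (X : topologicalType) :
  continuous (fun _ : X => 1 : R^o).
Proof. by move=> x; exact: cvg_cst. Qed.
Definition cfun_one (R : realType) (X : topologicalType) : cfun X R^o :=
  mk_cfun (@cfun_one_subproof R X).

HB.mixin Record isCXModule (R : realType) (X : compactHausdorffType) E
    & CompleteNormedModule R E := {
  cact : cfun X R^o -> E -> E;
  cact_linear : forall phi, linear (cact phi);
  cact_linearl : forall u, linear (fun phi => cact phi u);
  cact1 : forall u, cact (cfun_one R X) u = u;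
  cactM : forall phi psi u, cact (cfun_mul phi psi) u = cact phi (cact psi u);
  cact_norm : forall phi u, `|cact phi u| <= `|phi| * `|u| }.

#[short(type="cxModType")]
HB.structure Definition CXModule (R : realType) (X : compactHausdorffType) :=
  { E of isCXModule R X E & CompleteNormedModule R E }.

HB.mixin Record isGXModule (R : realType) (G : groupType)
    (X : compactGSpaceType G) E
    & BanachGModule R G E & CXModule R X E := {
  gact_cact : forall (g : G) (phi : cfun X R^o) (u : E),
    gact g (cact phi (gact g^-1%g u)) = cact (gact g phi) u }.

#[short(type="gxModType")]
HB.structure Definition GXModule (R : realType) (G : groupType)
    (X : compactGSpaceType G) :=
  { E of isGXModule R G X E & BanachGModule R G E & CXModule R X E }.

Section cact_linear.
Context {R : realType} {X : compactHausdorffType} (E : cxModType R X).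
HB.instance Definition _ (phi : cfun X R^o) :=
  GRing.isLinear.Build R E E *:%R (cact phi) (cact_linear phi).
End cact_linear.

Section cfun_CXModule.
Context {R : realType} (X : compactHausdorffType) (V : completeNormedModType R).
Let E := cfun X V.
Let mul_linear phi : linear (@cfun_mul R X V phi).
Proof.
move=> a u v; apply: cfunP => x.
rewrite -[RHS]/(a *: (phi x *: u x) + phi x *: v x) /=.
by rewrite scalerDr !scalerA mulrC.
Qed.
Let mul_linearl (u : E) : linear (fun phi => cfun_mul phi u).
Proof.
move=> a p q; apply: cfunP => x.
rewrite -[RHS]/(a *: (p x *: u x) + q x *: u x) /=.
by rewrite scalerDl scalerA.
Qed.
Let mul1 (u : E) : cfun_mul (cfun_one R X) u = u.
Proof. by apply: cfunP => x; rewrite /= scale1r. Qed.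
Let mulM phi psi (u : E) :
  cfun_mul (cfun_mul phi psi) u = cfun_mul phi (cfun_mul psi u).
Proof. by apply: cfunP => x; rewrite /= scalerA. Qed.
HB.instance Definition _ := isCXModule.Build R X (cfun X V)
  mul_linear mul_linearl mul1 mulM (@cfun_mul_norm R X V).
Lemma cfun_cactE (phi : cfun X R^o) (eta : cfun X V) x :
  cact phi eta x = phi x *: eta x.
Proof. by []. Qed.
End cfun_CXModule.

Section cfun_GXModule.
Context {R : realType} {G : groupType} (X : compactGSpaceType G).
Context (V : banachGModType R G).
Let gact_mul (g : G) (phi : cfun X R^o) (u : cfun X V) :
  gact g (cact phi (gact g^-1%g u)) = cact (gact g phi) u.
Proof.
by apply: cfunP => x /=; rewrite linearZ /= invgK -!gactM -!xactM mulgV gact1 xact1.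
Qed.
HB.instance Definition _ := isGXModule.Build R G X (cfun X V) gact_mul.
End cfun_GXModule.

Section blin_CXModule.
Context {R : realType} {X : compactHausdorffType}.
Context (E : cxModType R X) (F : completeNormedModType R).

Lemma blin_cact_subproof (phi : cfun X R^o) (T : blin E F) :
  (fun u => T (cact phi u)) \in @blin_pred R E F.
Proof.
rewrite inE; split=> [a u v|]; first by rewrite !linearP.
exists (`|T| * `|phi|) => u; rewrite (le_trans (ler_blin_norm _ _)) //.
by rewrite -mulrA ler_wpM2l // cact_norm.
Qed.
Definition blin_cact (phi : cfun X R^o) (T : blin E F) : blin E F :=
  Blin (blin_cact_subproof phi T).

Let c_linear phi : linear (blin_cact phi).
Proof. by move=> a u v; apply: blinP. Qed.
Let c_linearl T : linear (fun phi => blin_cact phi T).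
Proof. by move=> a p q; apply: blinP => u; rewrite /= cact_linearl linearP. Qed.
Let c1 T : blin_cact (cfun_one R X) T = T.
Proof. by apply: blinP => u; rewrite /= cact1. Qed.
Let cM phi psi T :
  blin_cact (cfun_mul phi psi) T = blin_cact phi (blin_cact psi T).
Proof.
apply: blinP => u; rewrite /= -cactM; congr (T (cact _ u)).
by apply: cfunP => x; rewrite /= [LHS]mulrC.
Qed.
Let c_norm phi T : `|blin_cact phi T| <= `|phi| * `|T|.
Proof.
apply: blin_norm_le => [|u]; first by rewrite mulr_ge0.
rewrite (le_trans (ler_blin_norm T _)) // -mulrA mulrCA ler_wpM2l //.
exact: cact_norm.
Qed.
HB.instance Definition _ := isCXModule.Build R X (blin E F)
  c_linear c_linearl c1 cM c_norm.
Lemma blin_cactE (phi : cfun X R^o) (T : blin E F) u :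
  cact phi T u = T (cact phi u).
Proof. by []. Qed.
End blin_CXModule.

Section blin_GXModule.
Context {R : realType} {G : groupType} {X : compactGSpaceType G}.
Context (E : gxModType R X) (F : banachGModType R G).
Let gact_mul (g : G) (phi : cfun X R^o) (T : blin E F) :
  gact g (cact phi (gact g^-1%g T)) = cact (gact g phi) T.
Proof.
apply: blinP => u.
rewrite blin_gactE !blin_cactE blin_gactE gactVK invgK.
by rewrite gact_cact.
Qed.
HB.instance Definition _ := isGXModule.Build R G X (blin E F) gact_mul.
End blin_GXModule.

Section intop_CXModule.
Context {R : realType} {X : compactHausdorffType}.
Context (W : completeNormedModType R).

Lemma integral_extension_cact phi (T : blin (cfun X R^o) W) P :
  integral_extension T P -> integral_extension (cact phi T) (cact phi P).
Proof.
move=> TP psi w; rewrite !blin_cactE -TP; congr (P _).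
by apply: cfunP => x; rewrite /= scalerA.
Qed.

Lemma intop_cact_subproof (phi : cfun X R^o) (T : intop X W) :
  cact phi (T : blin (cfun X R^o) W) \in @intop_pred R X W.
Proof.
rewrite inE; exists (cact phi (intop_ext T)).
exact/integral_extension_cact/intop_extP.
Qed.
Definition intop_cact (phi : cfun X R^o) (T : intop X W) : intop X W :=
  IntOp (intop_cact_subproof phi T).

Let c_linear phi : linear (intop_cact phi).
Proof. by move=> a u v; apply: val_inj; rewrite /= linearP. Qed.
Let c_linearl T : linear (fun phi => intop_cact phi T).
Proof. by move=> a p q; apply: val_inj; rewrite /= cact_linearl. Qed.
Let c1 T : intop_cact (cfun_one R X) T = T.
Proof. by apply: val_inj; rewrite /= cact1. Qed.
Let cM phi psi T :
  intop_cact (cfun_mul phi psi) T = intop_cact phi (intop_cact psi T).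
Proof. by apply: val_inj; rewrite /= cactM. Qed.
Let c_norm phi T : `|intop_cact phi T| <= `|phi| * `|T|.
Proof.
rewrite !intop_normE.
rewrite (@intop_extE _ _ _ _ (cact phi (intop_ext T))) ?cact_norm //.
exact/integral_extension_cact/intop_extP.
Qed.
HB.instance Definition _ := isCXModule.Build R X (intop X W)
  c_linear c_linearl c1 cM c_norm.
Lemma intop_cactE (psi : cfun X R^o) (T : intop X W) phi :
  cact psi T phi = T (cact psi phi).
Proof. by []. Qed.
End intop_CXModule.

Section intop_GXModule.
Context {R : realType} {G : groupType} {X : compactGSpaceType G}.
Context (W : banachGModType R G).
Let gact_mul (g : G) (phi : cfun X R^o) (T : intop X W) :
  gact g (cact phi (gact g^-1%g T)) = cact (gact g phi) T.
Proof. by apply: val_inj; rewrite /= gact_cact. Qed.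
HB.instance Definition _ := isGXModule.Build R G X (intop X W) gact_mul.
End intop_GXModule.



Section ell1_sum.
Context {R : realType} {T : choiceType}.
Implicit Types f p q : T -> R^o.

Let smb f := summable [set: T] (EFin \o f).

Let norm_ge0 p : smb p -> (forall t, 0 <= p t) ->
  (\esum_(t in [set: T]) (p t)%:E)%E = (ell1_norm p)%:E.
Proof.
move=> ps p0; rewrite /ell1_norm fineK; first last.
  by rewrite ge0_fin_numE //; exact: esum_ge0.
by apply: eq_esum => t _; rewrite gee0_abs // lee_fin.
Qed.

Let normD_ge0 p q : smb p -> smb q -> (forall t, 0 <= p t) ->
  (forall t, 0 <= q t) -> ell1_norm (p + q) = ell1_norm p + ell1_norm q.
Proof.
move=> ps qs p0 q0.
have pqs : smb (p + q).
  by have := (ell1_closed 1 ps qs).1; rewrite scale1r.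
have pq0 t : 0 <= (p + q) t by rewrite addr_ge0.
apply/eqP; rewrite -eqe EFinD -!norm_ge0 // -esumD //.
  by move=> t _; rewrite lee_fin.
by move=> t _; rewrite lee_fin.
Qed.

Let sum_split (f : ell1 R T) p q : smb p -> smb q -> (forall t, 0 <= p t) ->
  (forall t, 0 <= q t) -> (forall t, f t = p t - q t) ->
  ell1_sum f = ell1_norm p - ell1_norm q.
Proof.
move=> ps qs p0 q0 fpq.
have E : EFin \o f = ((EFin \o p) \- (EFin \o q))%E.
  by apply/funext => t; rewrite /= fpq EFinB.
rewrite /ell1_sum E esumB //; last 2 first.
  by move=> t _; rewrite lee_fin.
  by move=> t _; rewrite lee_fin.
by rewrite !norm_ge0 // -EFinB.
Qed.

Let posp f t : R^o := Num.max (f t) 0.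
Let negp f t : R^o := Num.max (- f t) 0.

Let pos_le f t : `|posp f t| <= `|f t|.
Proof. by rewrite ger0_norm ?le_max ?lexx ?orbT // ge_max ler_norm normr_ge0. Qed.
Let neg_le f t : `|negp f t| <= `|f t|.
Proof.
by rewrite ger0_norm ?le_max ?lexx ?orbT // ge_max -normrN ler_norm normr_ge0.
Qed.

Let sub_bound f p : smb f -> (forall t, `|p t| <= `|f t|) ->
  smb p /\ ell1_norm p <= ell1_norm f.
Proof.
move=> fs pf; apply: ell1_bound => A.
by rewrite (le_trans _ (ler_ell1_sum A fs)) // ler_sum.
Qed.

Let posp0 f t : 0 <= posp f t. Proof. by rewrite le_max lexx orbT. Qed.
Let negp0 f t : 0 <= negp f t. Proof. by rewrite le_max lexx orbT. Qed.
Let fpn f t : f t = posp f t - negp f t.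
Proof.
rewrite /posp /negp; have [f0|f0] := leP (f t) 0.
  by rewrite max_l ?oppr_ge0 // opprK add0r.
by rewrite max_r ?subr0 // oppr_le0 ltW.
Qed.

Lemma ell1_sum_additive (f g : ell1 R T) :
  ell1_sum (f + g) = ell1_sum f + ell1_sum g.
Proof.
have fs := ell1_summable f; have gs := ell1_summable g.
have [fp _] := sub_bound fs (pos_le f); have [fn _] := sub_bound fs (neg_le f).
have [gp _] := sub_bound gs (pos_le g); have [gn _] := sub_bound gs (neg_le g).
have smbD p q : smb p -> smb q -> smb (p + q).
  by move=> ps qs; have := (ell1_closed 1 ps qs).1; rewrite scale1r.
rewrite (@sum_split (f + g) (posp f + posp g) (negp f + negp g)); last first.
- by move=> t; rewrite ell1D (fpn f) (fpn g) /= opprD addrACA.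
- by move=> t; rewrite addr_ge0.
- by move=> t; rewrite addr_ge0.
- exact: smbD.
- exact: smbD.
rewrite (@sum_split f (posp f) (negp f)) // (@sum_split g (posp g) (negp g)) //.
by rewrite !normD_ge0 // opprD addrACA.
Qed.

Lemma ell1_sum_scale (a : R) (f : ell1 R T) :
  ell1_sum (a *: f) = a * ell1_sum f.
Proof.
have fs := ell1_summable f.
have [fp _] := sub_bound fs (pos_le f); have [fn _] := sub_bound fs (neg_le f).
have z p : smb p -> {b : ell1 R T | b = p :> (T -> R^o)}.
  move=> ps; have h : p \in @ell1_pred R T by rewrite inE.
  by exists (Ell1 h).
have [P PE] := z _ fp; have [N NE] := z _ fn.
have sE : ell1_sum f = ell1_norm P - ell1_norm N.
  by rewrite PE NE; apply: sum_split.
have P0 t : 0 <= P t by rewrite PE.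
have N0 t : 0 <= N t by rewrite NE.
have fE t : f t = P t - N t by rewrite PE NE.
have [a0|a0] := leP 0 a.
  rewrite (@sum_split _ (a *: P : ell1 R T) (a *: N : ell1 R T)).
  - by rewrite !ell1_normZ ger0_norm // -mulrBr sE.
  - exact: ell1_summable.
  - exact: ell1_summable.
  - by move=> t; exact: (mulr_ge0 a0 (P0 t)).
  - by move=> t; exact: (mulr_ge0 a0 (N0 t)).
  - by move=> t; rewrite !ell1Z fE scalerBr.
have na : 0 <= - a by rewrite oppr_ge0 ltW.
rewrite (@sum_split _ (- a *: N : ell1 R T) (- a *: P : ell1 R T)).
- rewrite !ell1_normZ ger0_norm // -mulrBr sE.
  by rewrite mulNr -mulrN opprB.
- exact: ell1_summable.
- exact: ell1_summable.
- by move=> t; exact: (mulr_ge0 na (N0 t)).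
- by move=> t; exact: (mulr_ge0 na (P0 t)).
- by move=> t; rewrite !ell1Z fE !scaleNr opprK scalerBr addrC.
Qed.

Lemma ell1_sum_linear : linear (@ell1_sum R T : ell1 R T -> R^o).
Proof. by move=> a f g; rewrite ell1_sum_additive ell1_sum_scale. Qed.

Lemma ell1_sum_norm (f : ell1 R T) : `|ell1_sum f| <= `|f|.
Proof.
have fs := ell1_summable f.
have [fp fpl] := sub_bound fs (pos_le f).
have [fn fnl] := sub_bound fs (neg_le f).
rewrite (@sum_split f (posp f) (negp f)) // ell1_normE.
have := ell1_norm_ge0 (posp f); have := ell1_norm_ge0 (negp f).
by rewrite ler_norml => ? ?; apply/andP; split; lra.
Qed.

HB.instance Definition _ :=
  GRing.isLinear.Build R (ell1 R T) R^o *:%R (@ell1_sum R T) ell1_sum_linear.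

Lemma ell1_sum_continuous : continuous (@ell1_sum R T : ell1 R T -> R^o).
Proof.
apply: (@linear_bounded_continuous R (ell1 R T) R^o (@ell1_sum R T)).1.
apply/linear_boundedP; exists 1; split; first exact: num_real.
by move=> r r1 f; rewrite (le_trans (ell1_sum_norm _)) // ler_peMl // ltW.
Qed.
End ell1_sum.

Section summation.
Context {R : realType} (X : compactHausdorffType) (T : choiceType).

Lemma cfun_sum_subproof (mu : cfun X (ell1 R T)) :
  continuous ((fun x => ell1_sum (mu x)) : X -> R^o).
Proof.
move=> x; apply: (@continuous_comp _ _ _ mu (@ell1_sum R T : _ -> R^o)).
  exact: cfun_continuous.
exact: ell1_sum_continuous.
Qed.

Lemma sigma_subproof :
  (fun mu => mk_cfun (@cfun_sum_subproof mu)) \in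
    @blin_pred R (cfun X (ell1 R T)) (cfun X R^o).
Proof.
rewrite inE; split.
  move=> a u v; apply: cfunP => x.
  exact: (ell1_sum_linear a (u x) (v x)).
exists 1 => u; rewrite mul1r; apply: cfun_norm_le => x /=.
exact: le_trans (ell1_sum_norm _) (ler_cfun_norm u x).
Qed.
Definition sigma : blin (cfun X (ell1 R T)) (cfun X R^o) := Blin sigma_subproof.

Lemma sigmaE (mu : cfun X (ell1 R T)) x : sigma mu x = ell1_sum (mu x).
Proof. by []. Qed.
End summation.

Section bidual.
Context {R : realType}.

Lemma blin_comp_subproof (E F H : normedModType R) (T : blin E F) (S : blin F H) :
  (fun u => S (T u)) \in @blin_pred R E H.
Proof.
rewrite inE; split=> [a u v|]; first by rewrite !linearP.
exists (`|S| * `|T|) => u; rewrite (le_trans (ler_blin_norm _ _)) //.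
by rewrite -mulrA ler_wpM2l // ler_blin_norm.
Qed.
Definition blin_comp (E F H : normedModType R) (T : blin E F) (S : blin F H) :
  blin E H := Blin (blin_comp_subproof T S).

Lemma adjoint_subproof (E F : normedModType R) (T : blin E F) :
  (fun lam : dual F => blin_comp T lam : dual E) \in @blin_pred R (dual F) (dual E).
Proof.
rewrite inE; split=> [a u v|]; first exact: blinP.
exists `|T| => lam; apply: blin_norm_le => [|u]; first by rewrite mulr_ge0.
rewrite (le_trans (ler_blin_norm lam _)) // -mulrA mulrCA ler_wpM2l //.
exact: ler_blin_norm.
Qed.
Definition adjoint (E F : normedModType R) (T : blin E F) :
  blin (dual F) (dual E) := Blin (adjoint_subproof T).

Lemma to_bidual_subproof (E : normedModType R) (u : E) :
  (fun lam : dual E => lam u) \in @blin_pred R (dual E) R^o.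
Proof.
rewrite inE; split=> [a l k|]; first by rewrite blinD blinZ.
by exists `|u| => lam; rewrite mulrC ler_blin_norm.
Qed.
Definition to_bidual (E : normedModType R) (u : E) : dual (dual E) :=
  Blin (to_bidual_subproof u).
End bidual.

Section bounded_cohomology.
Context {R : realType} {G : groupType} (E : banachGModType R G).

(* A map G^(n+1) -> E is a function of type ('I_n.+1 -> G) -> E. *)
Definition bounded_cochain (n : nat) : set (('I_n.+1 -> G) -> E) :=
  [set f | (exists M, forall s, `|f s| <= M) /\
           (forall g s, f (fun i => g * s i)%g = gact g (f s))].

Definition differential (n : nat) (f : ('I_n.+1 -> G) -> E) :
    ('I_n.+2 -> G) -> E :=
  fun s => \sum_(i < n.+2) (-1) ^+ i *: f (fun j => s (lift i j)).

Definition bounded_cocycle (n : nat) : set (('I_n.+1 -> G) -> E) :=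
  [set f | bounded_cochain f /\ forall s, differential f s = 0].

Definition bounded_coboundary (n : nat) : set (('I_n.+1 -> G) -> E) :=
  match n with
  | 0 => [set fun=> 0]
  | m.+1 => [set differential h | h in @bounded_cochain m]
  end.

(* The vanishing of the quotient of cocycles by coboundaries in degree n. *)
Definition Hb_vanishes (n : nat) : Prop :=
  @bounded_cocycle n `<=` @bounded_coboundary n.

End bounded_cohomology.

Section relative_injectivity.
Context {R : realType} {G : groupType}.

Definition banach_submodule (B : banachGModType R G) (A : set B) : Prop :=
  [/\ closed A, A 0,
      forall (a : R) u v, A u -> A v -> A (a *: u + v) &
      forall g u, A u -> A (gact g u)].

(* G-morphisms A -> E, encoded as functions on B whose values outside of A are
   irrelevant. *)
Definition gmorphism_on (B E : banachGModType R G) (A : set B) (f : B -> E) :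
    Prop :=
  [/\ forall (a : R) u v, A u -> A v -> f (a *: u + v) = a *: f u + f v,
      exists M, forall u, A u -> `|f u| <= M * `|u| &
      forall g u, A u -> f (gact g u) = gact g (f u)].

Definition relatively_injective (E : banachGModType R G) : Prop :=
  forall (B : banachGModType R G) (A : set B), banach_submodule A ->
  (exists p : blin B B,
    [/\ `|p| = 1, forall u, A (p u) & forall u, A u -> p u = u]) ->
  forall alpha : B -> E, gmorphism_on A alpha ->
  exists beta : blin B E,
    [/\ forall g u, beta (gact g u) = gact g (beta u),
        forall u, A u -> beta u = alpha u &
        `|beta| = opnorm A alpha].

End relative_injectivity.

Section types.
Context {R : realType} {X : compactHausdorffType} (E : cxModType R X).

Definition type_M : Prop :=
  forall (n : nat) (u : E) (phi : 'I_n -> cfun X R^o),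
    (forall i x, 0 <= phi i x) ->
    \sum_(i < n) `|cact (phi i) u| <= `|\sum_(i < n) phi i| * `|u|.

Definition type_C : Prop :=
  forall (n : nat) (u : 'I_n -> E) (phi : 'I_n -> cfun X R^o),
    (forall i x, 0 <= phi i x) ->
    `|\sum_(i < n) cact (phi i) (u i)| <=
      `|\sum_(i < n) phi i| * \big[Num.max/0]_(i < n) `|u i|.

End types.

Definition directed (J : Type) (le : J -> J -> Prop) : Prop :=
  [/\ inhabited J, forall i, le i i,
      forall i j k, le i j -> le j k -> le i k &
      forall i j, exists k, le i k /\ le j k].

(* The filter along which a net indexed by a directed preorder converges. *)
Definition net_filter (J : Type) (le : J -> J -> Prop) : set_system J :=
  filter_from [set: J] (fun j0 => [set j | le j0 j]).

Section amenability.
Context (R : realType) {G : groupType} (X : compactGSpaceType G).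

Definition is_probability (f : ell1 R G) : Prop :=
  (forall h, 0 <= f h) /\ ell1_sum f = 1.

Definition topologically_amenable : Prop :=
  exists (J : Type) (le : J -> J -> Prop) (mu : J -> cfun X (ell1 R G)),
    [/\ directed le,
        forall j x, is_probability (mu j x) &
        forall g : G,
          `|gact g (mu j) - mu j| @[j --> net_filter le] --> (0 : R)].

End amenability.

Section bidual_elements.
Context {R : realType} {G : groupType} (X : compactGSpaceType G).
Implicit Type m : dual (dual (cfun X (ell1 R G))).

Definition sums_to_one m : Prop :=
  adjoint (adjoint (sigma X G)) m = to_bidual (cfun_one R X).

Definition positive_functional (lam : dual (cfun X (ell1 R G))) : Prop :=
  forall mu : cfun X (ell1 R G), (forall x h, 0 <= mu x h) -> 0 <= lam mu.

Definition positive_bidual m : Prop :=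
  forall lam, positive_functional lam -> 0 <= m lam.

End bidual_elements.

Definition G_invariant {R : realType} {G : groupType} {E : banachGModType R G}
  (u : E) : Prop := forall g : G, gact g u = u.

(* Main.v *)
From HB Require Import structures.
Require Import Defs.
From mathcomp Require Import all_boot all_order all_algebra.
From mathcomp Require Import ring lra finmap.
From mathcomp Require Import all_classical all_reals all_analysis.
Set Implicit Arguments.
Unset Strict Implicit.
Unset Printing Implicit Defensive.
Import Order.TTheory GRing.Theory Num.Theory.
Import numFieldNormedType.Exports.
Local Open Scope classical_set_scope.
Local Open Scope ring_scope.

(** Everything is compared with amenability.

    If the action is amenable, compactness of [X] replaces the almost invariant
    [mu : X -> ell^1 G] by finitely supported ones. For a linear map [T] from a
    Banach [G]-module to a dual [(G,X)]-module of type C, the averages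
    [\sum_g mu_g . (g T)] are bounded by the norm of [T], almost equivariant, and
    do not move values on which [T] is already equivariant; a weak-* limit along
    an ultrafilter is equivariant. With [T = alpha \o p], [p] a norm one
    projection, this gives relative injectivity. Relative injectivity of [E^*]
    provides a [G]-equivariant retraction of the bounded functions [G -> E^*] onto
    the constants, hence a contracting homotopy in positive degrees. Types M and C
    are exchanged by duality, which covers all the modules of the theorem.

    Conversely, let [V] be the kernel of the sum on [ell^1 G]. A primitive of the
    cocycle [(g, h) |-> delta_h - delta_g] in [C(X, V)^**] corrects [delta_1] to an
    invariant element of [C(X, ell^1 G)^**] summing to one. For integral operators
    one takes [W = V^*] and maps [C(X, V)^*] to the integral operators from [C(X)]
    to [V^*]. Finally, by Hahn-Banach, an invariant element of the bidual yields
    [eta] in [C(X, ell^1 G)] which is almost invariant in norm and whose sum is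
    close to one; normalizing [|eta(x)|] gives probabilities, so no positivity of
    the bidual element is needed. *)

(** * Weak-* limits and norm approximation of bidual elements *)

Section ultralimits.
Context {R : realType} {I : Type}.

(** If the preimage of [A] were not in [U], its complement would be, and the larger filter would
    contain both [A] and its complement. *)
Lemma ultra_fmap (T : Type) (c : I -> T) (U : set_system I) :
  UltraFilter U -> UltraFilter (fmap c U).
Proof.
move=> UU; split=> [|G GP cG]; first exact: fmap_proper_filter.
apply/seteqP; split=> // A GA.
have [//|] := in_ultra_setVsetC (c @^-1` A) UU.
move=> UnA; have GnA : G (~` A) by apply: cG.
by have [x [Ax /(_ Ax)]] := filter_ex (filterI GA GnA).
Qed.

Lemma ultra_bounded_cvg (U : set_system I) (c : I -> R^o) (M : R) :
  UltraFilter U -> (\forall i \near U, `|c i| <= M) -> exists l : R^o, c @ U --> l.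
Proof.
move=> UU cM; have := @segment_compact R (- M) M.
rewrite compact_ultra => /(_ (fmap c U) (ultra_fmap c UU)) [|l [_ cl]].
  by apply: filterS cM => i; rewrite /= in_itv /= -ler_norml.
by exists l.
Qed.

Lemma cvg_norm_le_bound (V : normedModType R) (F : set_system I) (c : I -> V)
    (l : V) (M : R) :
  ProperFilter F -> c @ F --> l -> (\forall i \near F, `|c i| <= M) -> `|l| <= M.
Proof.
move=> FF cl cM; apply/ler_addgt0Pr => e e0.
have /cvgrPdist_le /(_ _ e0) lc := cl.
have [i [ci li]] := filter_ex (filterI cM lc).
rewrite -(subrK (c i) l) (le_trans (ler_normD _ _)) // addrC lerD //.
Qed.

(** This is how relations that hold up to every [e] along a filter, such as equivariance, become
    exact in the limit. *)
Lemma cvg_eq_of_close (V : normedModType R) (F : set_system I) (c d : I -> V)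
    (l k : V) :
  ProperFilter F -> c @ F --> l -> d @ F --> k ->
  (forall e : R, 0 < e -> \forall i \near F, `|c i - d i| <= e) -> l = k.
Proof.
move=> FF cl dk cd; apply/eqP; rewrite -subr_eq0 -normr_le0.
apply/ler_addgt0Pr => e e0; rewrite add0r.
exact: (cvg_norm_le_bound FF (cvgB cl dk) (cd e e0)).
Qed.

(** The Banach-Alaoglu theorem along an ultrafilter: the values at each [u] lie in a compact
    interval, and linearity and the bound pass to pointwise limits. *)
Lemma ultra_dual_limit (E : normedModType R) (U : set_system I)
    (T : I -> dual E) (M : R) :
  UltraFilter U -> 0 <= M -> (\forall i \near U, `|T i| <= M) ->
  exists S : dual E, (forall u, (fun i => T i u) @ U --> S u) /\ `|S| <= M.
Proof.
move=> UU M0 TM.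
have TMu u : \forall i \near U, `|T i u| <= M * `|u|.
  apply: filterS TM => i TiM; rewrite (le_trans (ler_blin_norm _ _)) //.
  by rewrite ler_wpM2r.
have [s sP] := choice (fun u => ultra_bounded_cvg UU (TMu u)).
have slin : linear s.
  move=> a u v; apply: (cvg_unique _ (sP _)) => //.
  have -> : (fun i => T i (a *: u + v)) = (fun i => a *: T i u + T i v).
    by apply/funext => i; rewrite linearP.
  by apply: cvgD => //; apply: cvgZr.
have sM u : `|s u| <= M * `|u|.
  exact: (cvg_norm_le_bound _ (sP u) (TMu u)).
have sb : s \in @blin_pred R E R^o by rewrite inE; split=> //; exists M.
by exists (Blin sb); split=> //; exact: blin_norm_le.
Qed.

End ultralimits.

(** * Separation of a vector from the range of an operator *)

Section renorming.
Context {R : realType} (N Y : normedModType R) (L : blin N Y) (k : R) (k0 : 0 < k).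

(* The distance to the range of [L] is only a seminorm; adding a small multiple
   of the norm allows one to apply [hahn_banach_norming] without constructing a
   quotient space. *)
Definition tilt_norm (z : Y) : R :=
  inf [set `|z - L n| | n in [set: N]] + k * `|z|.

Let dist (z : Y) := inf [set `|z - L n| | n in [set: N]].

Let dist_inf z : has_inf [set `|z - L n| | n in [set: N]].
Proof.
split; first by exists `|z - L 0|, 0.
by exists 0 => _ [n _ <-].
Qed.

Let dist_le z n : dist z <= `|z - L n|.
Proof. by apply: ge_inf; [case: (dist_inf z)|exists n]. Qed.

Let le_dist z r : (forall n, r <= `|z - L n|) -> r <= dist z.
Proof.
by move=> H; apply: lb_le_inf; [case: (dist_inf z)|move=> _ [n _ <-]].
Qed.

Let distD y z : dist (y + z) <= dist y + dist z.
Proof.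
rewrite -lerBlDr; apply: le_dist => n; rewrite lerBlDr -lerBlDl.
apply: le_dist => p; rewrite lerBlDl (le_trans (dist_le _ (n + p))) //.
by rewrite linearD opprD addrACA ler_normD.
Qed.

Let distZ_le a z : dist (a *: z) <= `|a| * dist z.
Proof.
have [->|a0] := eqVneq a 0.
  by rewrite scale0r normr0 mul0r (le_trans (dist_le _ 0)) // linear0 subr0 normr0.
rewrite mulrC -ler_pdivrMr ?normr_gt0 //; apply: le_dist => n.
rewrite ler_pdivrMr ?normr_gt0 // (le_trans (dist_le _ (a *: n))) //.
by rewrite linearZ -scalerBr normrZ mulrC.
Qed.

Let distZ a z : dist (a *: z) = `|a| * dist z.
Proof.
apply/eqP; rewrite eq_le distZ_le /=.
have [->|a0] := eqVneq a 0.
  by rewrite normr0 mul0r le_dist.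
rewrite -ler_pdivlMl ?normr_gt0 //.
by rewrite -{1}(scalerK a0 z) -normfV; exact: distZ_le.
Qed.

Lemma tilt_normD y z : tilt_norm (y + z) <= tilt_norm y + tilt_norm z.
Proof.
rewrite /tilt_norm addrACA lerD //; first exact: distD.
by rewrite -mulrDr ler_wpM2l ?ler_normD // ltW.
Qed.

Lemma tilt_normZ a z : tilt_norm (a *: z) = `|a| * tilt_norm z.
Proof. by rewrite /tilt_norm -/(dist _) distZ normrZ mulrDr mulrCA. Qed.

Lemma tilt_norm_ge z : k * `|z| <= tilt_norm z.
Proof. by rewrite lerDr; exact: le_dist. Qed.

Lemma tilt_norm0_eq0 z : tilt_norm z = 0 -> z = 0.
Proof.
move=> z0; apply/eqP; rewrite -normr_le0 -(pmulr_rle0 _ k0) -z0.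
exact: tilt_norm_ge.
Qed.

Lemma tilt_norm_le z : tilt_norm z <= (1 + k) * `|z|.
Proof.
rewrite mulrDl mul1r lerD2r (le_trans (dist_le z 0)) //.
by rewrite linear0 subr0.
Qed.

Lemma tilt_norm_range n : tilt_norm (L n) <= k * `|L n|.
Proof. by rewrite gerDr (le_trans (dist_le _ n)) // subrr normr0. Qed.

(** An alias of [Y] that carries the new norm; the dummy [let] makes it depend on [L] and on the
    proof [k0], which the norm structure needs. *)
Definition tilt : Type := let _ := (L, k0) in Y.
HB.instance Definition _ := GRing.Lmodule.on tilt.
HB.instance Definition _ := Lmodule_isNormed.Build R tilt
  tilt_normD tilt_normZ tilt_norm0_eq0.

(** A functional norming [y] for [tilt_norm] almost vanishes on the range of [L], where that norm is
    at most [k] times the old one, and at [y] it dominates the distance to the range. *)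
Lemma tilt_dual (y : Y) : exists w : dual Y,
  (forall n, `|w (L n)| <= k * `|L n|) /\
  inf [set `|y - L n| | n in [set: N]] <= w y.
Proof.
have [w [w1 wy]] := @hahn_banach_norming R tilt y.
have wN (z : Y) : `|w z| <= tilt_norm z by exact: w1.
have wb : (w : Y -> R^o) \in @blin_pred R Y R^o.
  rewrite inE; split=> [a u v|]; first exact: (linearP w).
  by exists (1 + k) => u; rewrite (le_trans (wN u)) // tilt_norm_le.
exists (Blin wb); split=> [n|] /=.
  by rewrite (le_trans (wN _)) // tilt_norm_range.
by rewrite wy [leRHS]/Num.norm /= /tilt_norm lerDl mulr_ge0 // ltW.
Qed.

End renorming.

(** * From relations in the bidual to norm approximation *)

Section weak_to_norm.
Context {R : realType} (N : normedModType R) (m : dual (dual N)).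

(** Says that the second adjoint of [L] maps [m] to the canonical image of [y] in the bidual of
    [Y]. *)
Definition weakly_reaches (Y : normedModType R) (L : blin N Y) (y : Y) : Prop :=
  forall nu : dual Y, m (blin_comp L nu) = nu y.

(** Were [y] at distance at least [e] from the range of [L], some [w] would be at least [e] at [y]
    and tiny on the range, whereas [w y] is the value of [m] at [w] composed with [L]. *)
Lemma weakly_reaches_approx (Y : normedModType R) (L : blin N Y) (y : Y) (e : R) :
  weakly_reaches L y -> 0 < e -> exists n, `|y - L n| < e.
Proof.
move=> mLy e0; pose d := inf [set `|y - L n| | n in [set: N]].
have hi : has_inf [set `|y - L n| | n in [set: N]].
  split; first by exists `|y - L 0|, 0.
  by exists 0 => _ [n _ <-].
suff de : d < e.
  have e1 : 0 < e - d by rewrite subr_gt0.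
  have [_ [n _ <-]] := inf_adherent e1 hi; rewrite -/d [_ + (e - d)]addrC subrK => ?.
  by exists n.
rewrite ltNge; apply/negP => ed.
(* [k] is chosen so that [|m| * (k * |L|) <= k * c = e / 2]; the [+ 1] keeps [c] positive. *)
pose c := `|m| * `|L| + 1; have c0 : 0 < c by rewrite ltr_wpDl ?mulr_ge0.
have [k [k0 kc]] : exists k, 0 < k /\ e / 2 = k * c.
  by exists (e / 2 / c); rewrite !divr_gt0 // divfK // gt_eqF.
have [w [wL wy]] := tilt_dual L k0 y.
have : `|m (blin_comp L w)| <= e / 2.
  rewrite (le_trans (ler_blin_norm _ _)) //.
  rewrite (@le_trans _ _ (`|m| * (k * `|L|))) //.
    rewrite ler_wpM2l //; apply: blin_norm_le => [|u].
      by rewrite mulr_ge0 // ltW.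
    rewrite (le_trans (wL u)) // -mulrA ler_wpM2l ?(ltW k0) //.
    exact: ler_blin_norm.
  by rewrite kc mulrCA ler_wpM2l ?(ltW k0) // lerDl.
rewrite mLy => /(le_trans (ler_norm _)) /(le_trans wy) /(le_trans ed).
by lra.
Qed.

Lemma pair_blin_subproof (Y Z : normedModType R) (K : blin N Y) (L : blin N Z) :
  (fun n => (K n, L n)) \in @blin_pred R N (Y * Z)%type.
Proof.
rewrite inE; split=> [a u v|]; first by rewrite !linearP.
exists (`|K| + `|L|) => u; rewrite prod_normE /= ge_max mulrDl.
rewrite !(le_trans (ler_blin_norm _ _)) //.
  by rewrite lerDr mulr_ge0.
by rewrite lerDl mulr_ge0.
Qed.
Definition pair_blin (Y Z : normedModType R) (K : blin N Y) (L : blin N Z) :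
  blin N (Y * Z)%type := Blin (pair_blin_subproof K L).

(** A functional on a product is the sum of its restrictions to the two factors. *)
Lemma weakly_reaches_pair (Y Z : normedModType R) (K : blin N Y) (L : blin N Z)
    y z :
  weakly_reaches K y -> weakly_reaches L z -> weakly_reaches (pair_blin K L) (y, z).
Proof.
move=> mK mL nu.
have nu1P : (fun y => nu (y, 0)) \in @blin_pred R Y R^o.
  rewrite inE; split=> [a u v|].
    have -> : (a *: u + v, 0) = a *: (u, 0) + (v, 0) :> (Y * Z)%type.
      by congr pair; rewrite /= ?scaler0 ?addr0.
    by rewrite linearP.
  exists `|nu| => u; rewrite (le_trans (ler_blin_norm _ _)) //.
  by rewrite ler_wpM2l // prod_normE /= normr0 ge_max lexx normr_ge0.
have nu2P : (fun z => nu (0, z)) \in @blin_pred R Z R^o.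
  rewrite inE; split=> [a u v|].
    have -> : (0, a *: u + v) = a *: (0, u) + (0, v) :> (Y * Z)%type.
      by congr pair; rewrite /= ?scaler0 ?addr0.
    by rewrite linearP.
  exists `|nu| => u; rewrite (le_trans (ler_blin_norm _ _)) //.
  by rewrite ler_wpM2l // prod_normE /= normr0 ge_max lexx normr_ge0.
have nuE p : nu p = Blin nu1P p.1 + Blin nu2P p.2.
  rewrite /= -linearD; congr (nu _); case: p => p q.
  by congr pair; rewrite /= ?addr0 ?add0r.
rewrite nuE -mK -mL -linearD; congr (m _); apply: blinP => n.
by rewrite blinD; exact: nuE.
Qed.

(** Finitely many conditions become a single one with values in a product space, so one vector [n]
    serves all of them. *)
Lemma weakly_reaches_approx_seq (I : eqType) (s : seq I) (Y : normedModType R)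
    (L : I -> blin N Y) (y : I -> Y) (Z : normedModType R) (K : blin N Z) (z : Z)
    (e : R) : 0 < e ->
  (forall i, weakly_reaches (L i) (y i)) -> weakly_reaches K z ->
  exists n, (forall i, i \in s -> `|y i - L i n| <= e) /\ `|z - K n| <= e.
Proof.
move=> e0 mL mK.
have [W [H [w [mH HP]]]] : exists (W : normedModType R) (H : blin N W) (w : W),
    weakly_reaches H w /\ forall n, `|w - H n| < e ->
      (forall i, i \in s -> `|y i - L i n| <= e) /\ `|z - K n| <= e.
  elim: s => [|i s [W [H [w [mH HP]]]]].
    by exists Z, K, z; split=> // n /ltW.
  exists (Y * W)%type, (pair_blin (L i) H), (y i, w).
  split=> [|n]; first exact: weakly_reaches_pair.
  rewrite prod_normE gt_max /= => /andP[/ltW yi /HP [ys zK]]; split=> // j.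
  by rewrite inE => /predU1P[->|/ys].
have [n /HP ?] := weakly_reaches_approx mH e0.
by exists n.
Qed.

End weak_to_norm.

(** * The space ell^1, partitions of unity, and modules of type M and C *)

Section ell1_theory.
Context {R : realType} {T : choiceType}.

Lemma ell1_sum_ge0 (f : ell1 R T) : (forall t, 0 <= f t) -> ell1_sum f = `|f|.
Proof.
move=> f0; rewrite ell1_normE /ell1_sum /ell1_norm; congr fine.
rewrite [X in (_ - X)%E]esum1 ?sube0 => [|t _].
  apply: eq_esum => t _; by rewrite funeposE /= ger0_norm // max_l ?lee_fin.
by rewrite funenegE /= max_r // lee_fin oppr_le0.
Qed.

Lemma ell1_sumE (I : Type) (s : seq I) (P : pred I) (u : I -> ell1 R T) t :
  (\sum_(i <- s | P i) u i) t = \sum_(i <- s | P i) u i t.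
Proof. by elim/big_rec2: _ => // i x y _ <-. Qed.

Definition ell1_delta_fun (t : T) : T -> R^o := fun s => (s == t)%:R.

Lemma ell1_delta_bound (t : T) (A : {fset T}) :
  \sum_(s <- A) `|ell1_delta_fun t s| <= 1.
Proof.
have Z (B : {fset T}) : t \notin B -> \sum_(s <- B) `|ell1_delta_fun t s| = 0.
  move=> tB; rewrite big_seq big1 // => s sB.
  rewrite /ell1_delta_fun (_ : (s == t) = false) ?normr0 //.
  by apply: contraNF tB => /eqP <-.
have [tA|tA] := boolP (t \in A); last by rewrite Z.
rewrite (big_fsetD1 t) //= Z ?addr0; last by rewrite !inE eqxx.
by rewrite /ell1_delta_fun eqxx normr1.
Qed.

Lemma ell1_delta_subproof (t : T) : ell1_delta_fun t \in @ell1_pred R T.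
Proof. by rewrite inE; exact: (ell1_bound (ell1_delta_bound t)).1. Qed.
Definition ell1_delta (t : T) : ell1 R T := Ell1 (ell1_delta_subproof t).

Lemma ell1_delta_norm_le t : `|ell1_delta t| <= 1.
Proof. exact: (ell1_bound (ell1_delta_bound t)).2. Qed.

Lemma ell1_sum_delta t : ell1_sum (ell1_delta t) = 1.
Proof.
rewrite ell1_sum_ge0 => [|s]; last by rewrite ler0n.
apply/eqP; rewrite eq_le ell1_delta_norm_le /=.
have := ler_ell1_eval (ell1_delta t) t.
by rewrite /= /ell1_delta_fun eqxx normr1.
Qed.

Section weighting.
Context (c : T -> R) (M : R) (cM : forall t, `|c t| <= M).

Let wt_bound (a : ell1 R T) (A : {fset T}) :
  \sum_(t <- A) `|(a t * c t : R^o)| <= M * `|a|.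
Proof.
have := ler_ell1_sum A (ell1_summable a).
(* For empty [A] the sign of [M] matters: it is nonnegative if [T] has an element, and otherwise
   [a = 0]. *)
have [->|[t0 t0A]] := fset_0Vmem A.
  rewrite !big_nil => a0; have [t|nt] := pselect (exists t : T, True).
    by case: t => t _; rewrite mulr_ge0 // (le_trans _ (cM t)).
  suff -> : a = 0 by rewrite normr0 mulr0.
  by apply: ell1P => t; case: nt; exists t.
have M0 : 0 <= M by rewrite (le_trans _ (cM t0)).
move=> /(ler_wpM2l M0); apply: le_trans.
rewrite mulr_sumr; apply: ler_sum => t _.
by rewrite normrM mulrC ler_wpM2r.
Qed.

Lemma ell1_weight_subproof (a : ell1 R T) :
  (fun t => a t * c t : R^o) \in @ell1_pred R T.
Proof. by rewrite inE; exact: (ell1_bound (wt_bound a)).1. Qed.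
Definition ell1_weight (a : ell1 R T) : ell1 R T := Ell1 (ell1_weight_subproof a).

Lemma ell1_weight_norm_le a : `|ell1_weight a| <= M * `|a|.
Proof. exact: (ell1_bound (wt_bound a)).2. Qed.

End weighting.

Lemma ell1_abs_subproof (a : ell1 R T) :
  (fun t => `|a t| : R^o) \in @ell1_pred R T.
Proof.
rewrite inE; apply: (ell1_bound (M := `|a|) _).1 => A.
under eq_bigr do rewrite normr_id.
exact/ler_ell1_sum/ell1_summable.
Qed.
Definition ell1_abs (a : ell1 R T) : ell1 R T := Ell1 (ell1_abs_subproof a).

Lemma ell1_abs_sum (a : ell1 R T) : ell1_sum (ell1_abs a) = `|a|.
Proof.
rewrite ell1_sum_ge0 // => [|t]; last exact: normr_ge0.
rewrite !ell1_normE /ell1_norm; congr fine; apply: eq_esum => t _ /=.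
by rewrite normr_id.
Qed.

Lemma ell1_abs_dist (a b : ell1 R T) : `|ell1_abs a - ell1_abs b| <= `|a - b|.
Proof.
rewrite ell1_normE; apply: (ell1_bound _).2 => A.
apply: le_trans (ler_ell1_sum A (ell1_summable (a - b))).
by apply: ler_sum => t _; exact: ler_dist_dist.
Qed.

Lemma ell1_abs_norm (a : ell1 R T) : `|ell1_abs a| = `|a|.
Proof. by rewrite -ell1_sum_ge0 ?ell1_abs_sum // => t; exact: normr_ge0. Qed.

End ell1_theory.

Lemma ell1_sum_gact (R : realType) (G : groupType) (g : G) (a : ell1 R G) :
  ell1_sum (gact g a) = ell1_sum a.
Proof.
have bij : set_bij setT setT (fun h : G => (g^-1 * h)%g).
  split=> // [h k _ _|h _]; first exact: mulgI.
  by exists (g * h)%g => //; rewrite mulKg.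
rewrite /ell1_sum [in RHS](reindex_esum setT setT _ ((EFin \o a)^\+)%E bij).
rewrite [in RHS](reindex_esum setT setT _ ((EFin \o a)^\-)%E bij).
by congr (fine (_ - _)%E); apply: eq_esum => t _; rewrite ?funeposE ?funenegE.
Qed.

Lemma gact_ell1_delta (R : realType) (G : groupType) (g h : G) :
  gact g (ell1_delta h : ell1 R G) = ell1_delta (g * h)%g.
Proof.
apply: ell1P => k; rewrite ell1_gactE /= /ell1_delta_fun.
by rewrite -(inj_eq (mulgI g) _ h) mulVKg.
Qed.

Section cfun_theory.
Context {R : realType} (X : compactHausdorffType).

Lemma cfun_sumE (V : normedModType R) (I : Type) (s : seq I) (P : pred I)
    (u : I -> cfun X V) x :
  (\sum_(i <- s | P i) u i) x = \sum_(i <- s | P i) u i x.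
Proof.
elim: s => [|i s IH]; first by rewrite !big_nil.
by rewrite !big_cons; case: ifP => _; rewrite -IH.
Qed.

Lemma cfun_abs_subproof (phi : cfun X R^o) : continuous (fun x => `|phi x| : R^o).
Proof. by move=> x; apply: cvg_norm; exact: cfun_continuous. Qed.
Definition cfun_abs (phi : cfun X R^o) : cfun X R^o :=
  mk_cfun (@cfun_abs_subproof phi).

Lemma cfun_const_subproof (V : normedModType R) (v : V) :
  continuous (fun _ : X => v).
Proof. by move=> x; exact: cvg_cst. Qed.
Definition cfun_const (V : normedModType R) (v : V) : cfun X V :=
  mk_cfun (@cfun_const_subproof V v).

Lemma cfun_const_norm_le (V : normedModType R) (v : V) : `|cfun_const v| <= `|v|.
Proof. exact: cfun_norm_le. Qed.

(** Urysohn functions equal to 1 at [i] and to 0 outside [U i]: by compactness finitely many have a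
    positive sum, and they are divided by it. *)
Lemma partition_of_unity (U : X -> set X) :
  (forall x, open (U x)) -> (forall x, U x x) ->
  exists (D : {fset X}) (psi : X -> cfun X R^o),
    [/\ forall i y, 0 <= psi i y, forall y, \sum_(i <- D) psi i y = 1 &
        forall i y, psi i y != 0 -> U i y].
Proof.
move=> Uop xU.
have phi_ex i : exists f : cfun X R^o,
    [/\ forall y, 0 <= f y, f i = 1 & forall y, ~ U i y -> f y = 0].
  have sep : @uniform_separator X (~` U i) [set i].
    have /normal_separatorP := compact_normal (@hausdorffT X) (@compactT X).
    move=> /(_ R); apply.
    - exact: open_closedC.
    - exact/accessible_closed_set1/hausdorff_accessible/hausdorffT.
    - by apply/disjoints_subset => y /= nU yi; apply: nU; rewrite yi.
  pose f : X -> R^o := @Urysohn X R (~` U i) [set i].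
  have fc : continuous f by exact: Urysohn_continuous.
  exists (mk_cfun fc); split=> [y||y nU] /=.
  - have : range f (f y) by exists y.
    by move=> /Urysohn_range /=; rewrite in_itv /= => /andP[].
  - by apply: (@Urysohn_sub1 X R _ _ sep (f i)); exists i.
  - by apply: (@Urysohn_sub0 X R _ _ sep (f y)); exists y.
have [phi phiP] := choice phi_ex.
have [x0 _] := @inhabitedT X.
(* Nonemptiness supplies the base point with which [compact_cover] is applied. *)
pose X' : ptopologicalType := HB.pack (X : Type) X (isPointed.Build X x0).
have : @cover_compact X' setT by rewrite -compact_cover; exact: (@compactT X).
move=> /(_ X setT (fun x => [set y | 0 < phi x y])) [].
- move=> x _; apply: (@open_comp _ _ (phi x) [set r | 0 < r]).
    by move=> y _; exact: cfun_continuous.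
  exact: open_gt.
- by move=> x _; exists x => //=; case: (phiP x) => _ -> _.
move=> D _ DX; pose s := \sum_(i <- D) phi i.
have phi_ge0 i y : 0 <= phi i y by case: (phiP i).
have s0 y : 0 < s y.
  have [i /= iD iy] := DX y I; rewrite /s cfun_sumE (big_fsetD1 i) //=.
  by rewrite ltr_pwDl // sumr_ge0.
have psic i : continuous ((fun y => phi i y / s y) : X -> R^o).
  move=> y; apply: cvgM; first exact: cfun_continuous.
  by apply: cvgV; [rewrite gt_eqF|exact: cfun_continuous].
exists D, (fun i => mk_cfun (psic i)); split=> [i y|y|i y] /=.
- by rewrite divr_ge0 // ltW.
- by rewrite -mulr_suml -cfun_sumE divff // gt_eqF.
- by apply: contra_neqP => /(let: And3 _ _ h := phiP i in h) ->; rewrite mul0r.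
Qed.

End cfun_theory.

(** * Duality between types M and C *)

Section module_types.
Context {R : realType} {X : compactHausdorffType}.

Lemma cactDl (E : cxModType R X) (p q : cfun X R^o) (u : E) :
  cact (p + q) u = cact p u + cact q u.
Proof. by have := cact_linearl u 1 p q; rewrite !scale1r. Qed.

Lemma cact0l (E : cxModType R X) (u : E) : cact (0 : cfun X R^o) u = 0.
Proof. by apply: (addrI (cact 0 u)); rewrite -cactDl !addr0. Qed.

Lemma cactBl (E : cxModType R X) (p q : cfun X R^o) (u : E) :
  cact (p - q) u = cact p u - cact q u.
Proof. by apply: (addIr (cact q u)); rewrite -cactDl !subrK. Qed.

Lemma cact_suml (E : cxModType R X) (I : Type) (s : seq I) (P : pred I)
    (phi : I -> cfun X R^o) (u : E) :
  cact (\sum_(i <- s | P i) phi i) u = \sum_(i <- s | P i) cact (phi i) u.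
Proof.
elim: s => [|i s IH]; first by rewrite !big_nil cact0l.
by rewrite !big_cons; case: ifP => // _; rewrite cactDl IH.
Qed.

Lemma type_C_seq (E : cxModType R X) (I : Type) (s : seq I)
    (phi : I -> cfun X R^o) (u : I -> E) (K M : R) :
  type_C E -> (forall i x, 0 <= phi i x) ->
  (forall x, \sum_(i <- s) phi i x <= K) -> 0 <= M -> (forall i, `|u i| <= M) ->
  `|\sum_(i <- s) cact (phi i) (u i)| <= K * M.
Proof.
move=> CE phi0 phiK M0 uM.
rewrite big_tnth (le_trans (CE _ _ _ (fun i => phi0 _))) // ler_pM //.
- by rewrite bigmax_ge_id.
- apply: cfun_norm_le => x; rewrite cfun_sumE.
  by rewrite -(big_tnth _ _ s xpredT (fun i => phi i x)) ger0_norm ?phiK // sumr_ge0.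
- by apply: bigmax_le.
Qed.

(** Type C concerns nonnegative coefficients; splitting [theta i] into its positive part [tp i] and
    negative part [tm i] costs the factor 2. *)
Lemma type_C_signed (E : cxModType R X) (I : Type) (s : seq I)
    (theta : I -> cfun X R^o) (u : I -> E) (K M : R) :
  type_C E -> (forall x, \sum_(i <- s) `|theta i x| <= K) -> 0 <= M ->
  (forall i, `|u i| <= M) ->
  `|\sum_(i <- s) cact (theta i) (u i)| <= 2 * K * M.
Proof.
move=> CE thetaK M0 uM.
pose tp i : cfun X R^o := 2^-1 *: (cfun_abs (theta i) + theta i).
pose tm i : cfun X R^o := 2^-1 *: (cfun_abs (theta i) - theta i).
have tpE i x : tp i x = (`|theta i x| + theta i x) / 2 by rewrite mulrC.
have tmE i x : tm i x = (`|theta i x| - theta i x) / 2 by rewrite mulrC.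
have -> : \sum_(i <- s) cact (theta i) (u i) =
    \sum_(i <- s) cact (tp i) (u i) - \sum_(i <- s) cact (tm i) (u i).
  rewrite -sumrB; apply: eq_bigr => i _.
  rewrite -cactBl; congr (cact _ _); apply: cfunP => x.
  by rewrite cfunB tpE tmE; lra.
rewrite (le_trans (ler_normB _ _)) // -mulrA mulr_natl mulr2n lerD //.
- apply: type_C_seq => // [i x|x].
    by rewrite tpE divr_ge0 // -lerBlDl sub0r lerNl -normrN ler_norm.
  apply: le_trans (thetaK x); apply: ler_sum => i _; rewrite tpE.
  by have := ler_norm (theta i x); lra.
- apply: type_C_seq => // [i x|x].
    by rewrite tmE divr_ge0 // subr_ge0 ler_norm.
  apply: le_trans (thetaK x); apply: ler_sum => i _; rewrite tmE.
  by have := ler_norm (- theta i x); rewrite normrN; lra.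
Qed.

(** At a vector [u] the sum is at most the largest [|lam i|] times the sum of the norms of the
    [cact (phi i) u], which type M controls. *)
Lemma type_M_dual (E : cxModType R X) : type_M E -> type_C (dual E).
Proof.
move=> ME n lam phi phi0; set M := \big[Num.max/0]_(_ < _) _.
have M0 : 0 <= M by exact: bigmax_ge_id.
apply: blin_norm_le => [|u]; first by rewrite mulr_ge0.
have -> : (\sum_(i < n) cact (phi i) (lam i)) u =
    \sum_(i < n) lam i (cact (phi i) u).
  by elim/big_rec2: _ => // i a b _ <-.
rewrite (le_trans (ler_norm_sum _ _ _)) // mulrAC mulrC.
apply: (@le_trans _ _ (M * \sum_(i < n) `|cact (phi i) u|)).
  rewrite mulr_sumr; apply: ler_sum => i _.
  rewrite (le_trans (ler_blin_norm _ _)) // ler_wpM2r //.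
  exact: (le_bigmax _ (fun i => `|lam i|)).
by rewrite ler_wpM2l // ME.
Qed.

Lemma dual_norm_approx (E : normedModType R) (f : dual E) (e : R) : 0 < e ->
  exists2 u, `|u| <= 1 & `|f| <= f u + e.
Proof.
move=> e0; have [_ [u [_ u1] <-]] := sup_adherent e0 (blin_norm_has_sup f).
rewrite -[sup _]/`|f| ltrBlDr => /ltW fu.
have [fu0|fu0] := leP 0 (f u); first by exists u; rewrite // -(ger0_norm fu0).
by exists (- u); rewrite ?normrN // linearN -(ltr0_norm fu0).
Qed.

(** Choosing for each [i] an almost norming vector turns the sum of norms into one value of [lam].
    This duality argument serves both duals of type C modules and integral operators. *)
Lemma sum_dual_norm_le (E : normedModType R) (n : nat) (lam : dual E)
    (A : 'I_n -> blin E E) (K : R) :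
  (forall u : 'I_n -> E, (forall i, `|u i| <= 1) -> `|\sum_i A i (u i)| <= K) ->
  \sum_i `|blin_comp (A i) lam| <= K * `|lam|.
Proof.
move=> AK; apply/ler_addgt0Pr => e e0.
(* The error is divided by [n.+1] rather than [n], so that [n = 0] is covered. *)
have e'0 : 0 < e / n.+1%:R by rewrite divr_gt0.
have uP i := dual_norm_approx (blin_comp (A i) lam) e'0.
have [u u1 ule] : exists2 u : 'I_n -> E, forall i, `|u i| <= 1 &
    forall i, `|blin_comp (A i) lam| <= lam (A i (u i)) + e / n.+1%:R.
  have [u uH] := choice (fun i => let: ex_intro2 v h k := uP i in
    ex_intro (fun v => _ /\ _) v (conj h k)).
  by exists u => i; case: (uH i).
apply: le_trans (ler_sum _ (fun i _ => ule i)) _.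
rewrite big_split /= lerD //.
  rewrite -linear_sum mulrC (le_trans (ler_norm _)) //.
  by rewrite (le_trans (ler_blin_norm _ _)) // ler_wpM2l // AK.
rewrite sumr_const card_ord -[leLHS]mulr_natr mulrAC -mulrA ler_piMr ?(ltW e0) //.
by rewrite ler_pdivrMr // mul1r ler_nat.
Qed.

Lemma cact_blin_subproof (E : cxModType R X) (phi : cfun X R^o) :
  cact phi \in @blin_pred R E E.
Proof.
by rewrite inE; split; [exact: cact_linear|exists `|phi| => u; exact: cact_norm].
Qed.

Lemma type_C_dual (E : cxModType R X) : type_C E -> type_M (dual E).
Proof.
move=> CE n lam phi phi0.
have cE i : cact (phi i) lam = blin_comp (Blin (cact_blin_subproof E (phi i))) lam.
  exact: blinP.
under eq_bigr do rewrite cE; apply: sum_dual_norm_le => u u1.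
rewrite (le_trans (CE _ _ _ phi0)) // ler_piMr //.
exact: bigmax_le.
Qed.

Lemma cfun_mul_sum_norm_le (V : normedModType R) (n : nat) (u : 'I_n -> cfun X V)
    (phi : 'I_n -> cfun X R^o) (M : R) :
  (forall i x, 0 <= phi i x) -> 0 <= M -> (forall i, `|u i| <= M) ->
  `|\sum_i cfun_mul (phi i) (u i)| <= `|\sum_i phi i| * M.
Proof.
move=> phi0 M0 uM; apply: cfun_norm_le => x.
rewrite cfun_sumE (le_trans (ler_norm_sum _ _ _)) //.
apply: (@le_trans _ _ ((\sum_(i < n) phi i x) * M)).
  rewrite mulr_suml; apply: ler_sum => i _.
  rewrite normrZ ger0_norm // ler_wpM2l //.
  exact: le_trans (ler_cfun_norm _ _) (uM i).
by rewrite ler_wpM2r // -cfun_sumE (le_trans (ler_norm _)) // ler_cfun_norm.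
Qed.

Lemma cfun_type_C (V : completeNormedModType R) : type_C (cfun X V).
Proof.
move=> n u phi phi0; apply: cfun_mul_sum_norm_le => //; first exact: bigmax_ge_id.
by move=> i; exact: (le_bigmax _ (fun i => `|u i|)).
Qed.

Lemma cfun_mul_blin_subproof (V : normedModType R) (phi : cfun X R^o) :
  cfun_mul phi \in @blin_pred R (cfun X V) (cfun X V).
Proof.
rewrite inE; split=> [a u v|]; last by exists `|phi| => u; exact: cfun_mul_norm.
apply: cfunP => x; rewrite -[RHS]/(a *: (phi x *: u x) + phi x *: v x).
by rewrite -[LHS]/(phi x *: (a *: u x + v x)) scalerDr !scalerA mulrC.
Qed.
Definition cfun_mul_blin (V : normedModType R) (phi : cfun X R^o) :
  blin (cfun X V) (cfun X V) := Blin (cfun_mul_blin_subproof V phi).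

Lemma intop_ext_cact (W : completeNormedModType R) phi (T : intop X W) :
  intop_ext (cact phi T) = blin_comp (cfun_mul_blin (dual W) phi) (intop_ext T).
Proof.
apply: intop_extE => psi w; rewrite -[RHS]/(w (T (cfun_mul phi psi))).
rewrite -(intop_extP T) -[LHS]/(intop_ext T (cfun_mul phi (cfun_tensor psi w))).
by congr (intop_ext T _); apply: cfunP => x; rewrite /= scalerA.
Qed.

(** The integral norm is the norm of a functional on [cfun X (dual W)], where positive combinations
    satisfy the type C estimate; by [intop_ext_cact] the action of [C(X)] is carried over to that
    functional. *)
Lemma intop_type_M (W : completeNormedModType R) : type_M (intop X W).
Proof.
move=> n T phi phi0; rewrite intop_normE.
under eq_bigr do rewrite intop_normE intop_ext_cact.
apply: sum_dual_norm_le => u u1; rewrite -[leRHS]mulr1.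
exact: cfun_mul_sum_norm_le.
Qed.

End module_types.

(** * Almost invariant probabilities *)

Lemma lipschitz_continuous_comp (R : realType) (T : topologicalType)
    (E F : normedModType R) (f : T -> E) (g : E -> F) (M : R) :
  continuous f -> (forall x y, `|g (f x) - g (f y)| <= M * `|f x - f y|) ->
  continuous (fun x => g (f x)).
Proof.
move=> fc gM x; apply/cvgrPdist_le => e e0.
have c0 : 0 < `|M| + 1 by rewrite ltr_wpDl.
have /cvgrPdist_le /(_ _ (divr_gt0 e0 c0)) := fc x; apply: filterS => y xy.
rewrite (le_trans (gM x y)) // -[leRHS](divfK (lt0r_neq0 c0)) mulrC.
rewrite (@le_trans _ _ (`|f x - f y| * (`|M| + 1))) //.
  by rewrite ler_wpM2l // (le_trans (ler_norm M)) // lerDl.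
by rewrite ler_wpM2r // ltW.
Qed.

(** The limits below are taken along such ultrafilters: [I] consists of approximate solutions and
    [Q a] of those that meet the requirement [a]. *)
Lemma ultra_of_directed (A I : Type) (D : set A) (Q : A -> set I) :
  D !=set0 -> (forall a, D a -> Q a !=set0) ->
  (forall a b, D a -> D b -> exists2 c, D c & Q c `<=` Q a `&` Q b) ->
  exists U : set_system I, UltraFilter U /\ forall a, D a -> U (Q a).
Proof.
move=> D0 Q0 QI.
have FP : ProperFilter (filter_from D Q).
  by apply: filter_from_proper => //; exact: filter_from_filter.
have [U [UU FU]] := ultraFilterLemma FP.
by exists U; split=> // a Da; apply: FU; exists a.
Qed.

(** * Finitely supported and normalized probabilities *)

Section truncation.
Context {R : realType} {T : choiceType} (F : {fset T}).

Let ind (t : T) : R := (t \in F)%:R.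
Let ind_le1 t : `|ind t| <= 1.
Proof. by rewrite /ind; case: (_ \in _); rewrite ?normr1 ?normr0. Qed.

Lemma ell1_trunc_subproof :
  ell1_weight ind_le1 \in @blin_pred R (ell1 R T) (ell1 R T).
Proof.
rewrite inE; split=> [a u v|].
  by apply: ell1P => t /=; rewrite mulrDl -scalerAl.
by exists 1 => u; exact: ell1_weight_norm_le.
Qed.
Definition ell1_trunc : blin (ell1 R T) (ell1 R T) := Blin ell1_trunc_subproof.

Lemma ell1_truncE a t : ell1_trunc a t = if t \in F then a t else 0.
Proof. by rewrite /= /ind; case: ifP => _; rewrite ?mulr1 ?mulr0. Qed.

Lemma ell1_trunc_norm_le a : `|ell1_trunc a| <= `|a|.
Proof. by rewrite -[leRHS]mul1r; exact: ell1_weight_norm_le. Qed.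

End truncation.

Section ell1_probabilities.
Context {R : realType} {G : groupType}.
Implicit Types a b : ell1 R G.

Lemma probability_norm a : is_probability a -> `|a| = 1.
Proof. by move=> [a0 <-]; rewrite ell1_sum_ge0. Qed.

Lemma ell1_finite_approx a (e : R) : 0 < e ->
  exists F : {fset G}, `|a| - e <= \sum_(t <- F) `|a t|.
Proof.
move=> e0; apply: contrapT => nF.
suff : `|a| <= `|a| - e by rewrite lerBrDr gerDl leNgt e0.
rewrite {1}ell1_normE; apply: (ell1_bound _).2 => A.
by rewrite leNgt; apply/negP => /ltW ?; apply: nF; exists A.
Qed.

(* The mass lost by the truncation is put back at the identity. *)
Definition finite_support (F : {fset G}) a : ell1 R G :=
  ell1_trunc F a + (1 - ell1_sum (ell1_trunc F a)) *: ell1_delta 1%g.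

(** One [|a - b|] comes from the truncation and one from the mass put back; the estimate makes
    [finite_support F] preserve continuity in [x]. *)
Lemma finite_support_lipschitz F a b :
  `|finite_support F a - finite_support F b| <= 2 * `|a - b|.
Proof.
have -> : finite_support F a - finite_support F b = ell1_trunc F (a - b) -
    ell1_sum (ell1_trunc F (a - b)) *: ell1_delta 1%g.
  rewrite !linearB /= /finite_support opprD addrACA -scalerBl.
  by rewrite -scaleNr; congr (_ + _ *: _); lra.
rewrite (le_trans (ler_normB _ _)) // mulr_natl mulr2n lerD //.
  exact: ell1_trunc_norm_le.
rewrite normrZ -[leRHS]mulr1 ler_pM // ?ell1_delta_norm_le //.
by rewrite (le_trans (ell1_sum_norm _)) // ell1_trunc_norm_le.
Qed.

Lemma ell1_trunc_sum_le1 F a : is_probability a -> ell1_sum (ell1_trunc F a) <= 1.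
Proof.
move=> ap; rewrite -(probability_norm ap).
rewrite (le_trans (ler_norm _)) // (le_trans (ell1_sum_norm _)) //.
exact: ell1_trunc_norm_le.
Qed.

Lemma finite_support_probability F a :
  is_probability a -> is_probability (finite_support F a).
Proof.
move=> ap; have [a0 a1] := ap; split=> [h|].
  rewrite ell1D addr_ge0 //.
    by rewrite ell1_truncE; case: ifP.
  by rewrite ell1Z mulr_ge0 ?subr_ge0 ?ell1_trunc_sum_le1 // ler0n.
rewrite /finite_support linearD linearZ /= ell1_sum_delta.
by rewrite [_ *: _]mulr1 addrC subrK.
Qed.

(** The lost mass counts twice: where it is removed and where it is put back. *)
Lemma finite_support_dist F a : is_probability a ->
  `|finite_support F a - a| <= 2 * (1 - ell1_sum (ell1_trunc F a)).
Proof.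
move=> ap; have [a0 a1] := ap.
have -> : finite_support F a - a =
    (1 - ell1_sum (ell1_trunc F a)) *: ell1_delta 1%g - (a - ell1_trunc F a).
  by rewrite opprB addrAC [RHS]addrC.
rewrite (le_trans (ler_normB _ _)) // mulr_natl mulr2n lerD //.
  rewrite normrZ ger0_norm ?subr_ge0 ?ell1_trunc_sum_le1 //.
  by rewrite ler_piMr ?ell1_delta_norm_le // subr_ge0 ell1_trunc_sum_le1.
rewrite -ell1_sum_ge0 => [|t]; first by rewrite linearB /= a1.
by rewrite ell1B ell1_truncE; case: ifP; rewrite ?subrr ?subr0.
Qed.

Lemma finite_support_outside F a g :
  g \notin F -> g != 1%g -> finite_support F a g = 0.
Proof.
move=> gF g1; rewrite ell1D ell1Z ell1_truncE (negbTE gF) add0r.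
by rewrite /= /ell1_delta_fun (negbTE g1) scaler0.
Qed.

Lemma ell1_abs_gact g a : ell1_abs (gact g a) = gact g (ell1_abs a).
Proof. exact: ell1P. Qed.

(** Absolute values are taken before dividing by the norm, so signed elements also yield
    probabilities. *)
Definition ell1_normalize a : ell1 R G := `|a|^-1 *: ell1_abs a.

Lemma ell1_normalize_probability a : a != 0 -> is_probability (ell1_normalize a).
Proof.
move=> a0; split=> [h|].
  by rewrite ell1Z; apply: mulr_ge0; rewrite ?invr_ge0 ?normr_ge0.
rewrite linearZ /= ell1_abs_sum [_ *: _]mulVf //.
by rewrite normr_eq0.
Qed.

Lemma ell1_normalize_gact g a :
  ell1_normalize (gact g a) = gact g (ell1_normalize a).
Proof. by rewrite /ell1_normalize gact_norm ell1_abs_gact linearZ. Qed.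

(** The change of the absolute values and the change of the normalizing factor each contribute at
    most [|a - b| / r]. *)
Lemma ell1_normalize_dist a b (r : R) : 0 < r -> r <= `|a| -> r <= `|b| ->
  `|ell1_normalize a - ell1_normalize b| <= 2 / r * `|a - b|.
Proof.
move=> r0 ra rb.
have a0 : 0 < `|a| by exact: lt_le_trans ra.
have b0 : 0 < `|b| by exact: lt_le_trans rb.
have -> : ell1_normalize a - ell1_normalize b =
    `|a|^-1 *: (ell1_abs a - ell1_abs b) + (`|a|^-1 - `|b|^-1) *: ell1_abs b.
  by rewrite scalerBr scalerBl addrA subrK.
have -> : 2 / r * `|a - b| = r^-1 * `|a - b| + r^-1 * `|a - b| by lra.
have ia : `|a|^-1 <= r^-1 by rewrite lef_pV2 // posrE.
rewrite (le_trans (ler_normD _ _)) // lerD // normrZ.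
  rewrite normfV normr_id ler_pM ?invr_ge0 //.
  exact: ell1_abs_dist.
rewrite ell1_abs_norm.
have -> : `|a|^-1 - `|b|^-1 = (`|b| - `|a|) / (`|a| * `|b|).
  by field; rewrite !gt_eqF.
rewrite normrM normfV normrM !normr_id invfM mulrA mulfVK ?gt_eqF //.
by rewrite mulrC ler_pM ?invr_ge0 // -normrN opprB ler_dist_dist.
Qed.

End ell1_probabilities.

Section local_amenability.
Context (R : realType) {G : groupType} (X : compactGSpaceType G).
Implicit Types (S F : {fset G}) (e : R) (mu : cfun X (ell1 R G)).

Definition almost_invariant_probability S e mu : Prop :=
  (forall x, is_probability (mu x)) /\
  forall g, g \in S -> `|gact g mu - mu| <= e.

(** Topological amenability with the net replaced by a finite set of group elements and a tolerance;
    the equivalence is [amenable_locally] and [locally_amenable_net]. *)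
Definition locally_amenable : Prop := forall S e, 0 < e ->
  exists mu, almost_invariant_probability S e mu.

Lemma net_filter_proper (J : Type) (le : J -> J -> Prop) :
  directed le -> ProperFilter (net_filter le).
Proof.
move=> [[j0] lexx le_trans ledir].
apply: filter_from_proper; last by move=> j _; exists j; exact: lexx.
apply: filter_fromT_filter; first by exists j0.
move=> i j; have [k [ik jk]] := ledir i j; exists k => l /= kl.
by split; [exact: le_trans ik kl|exact: le_trans jk kl].
Qed.

Lemma amenable_locally : topologically_amenable R X -> locally_amenable.
Proof.
move=> [J [le [mu [/net_filter_proper FP mup muinv]]]] S e e0.
suff /filter_ex [j jS] : \forall j \near net_filter le,
    forall g, g \in (S : seq G) -> `|gact g (mu j) - mu j| <= e.
  by exists (mu j); split=> // x; exact: mup.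
elim: (enum_fset S) => [|g s IH]; first by apply: filterE.
have /cvgrPdist_le /(_ _ e0) ge := muinv g.
apply: filterS2 ge IH => j; rewrite sub0r normrN normr_id => gj sj h.
by rewrite inE => /predU1P[->|/sj].
Qed.

Lemma locally_amenable_net : locally_amenable -> topologically_amenable R X.
Proof.
move=> loc; pose J : Type := ({fset G} * nat)%type.
pose le (i j : J) := (i.1 `<=` j.1)%fset /\ (i.2 <= j.2)%N.
have n0 n : 0 < n.+1%:R^-1 :> R by rewrite invr_gt0.
have [mu muP] := choice (fun j : J => loc j.1 _ (n0 j.2)).
have ledir : directed le.
  split; first by exact: (inhabits (fset0, 0%N)).
  - by move=> i; split.
  - move=> i j k [ij1 ij2] [jk1 jk2]; split; first exact: fsubset_trans jk1.
    exact: leq_trans jk2.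
  - move=> i j; exists ((i.1 `|` j.1)%fset, maxn i.2 j.2); split; split => /=.
    + exact: fsubsetUl.
    + exact: leq_maxl.
    + exact: fsubsetUr.
    + exact: leq_maxr.
have FP := net_filter_proper ledir.
exists J, le, mu; split=> // [j x|g].
- by case: (muP j).
- apply/cvgrPdist_le => e e0.
  (* From this index on, the tolerance [k.+1%:R^-1] is at most [e]. *)
  pose n := Num.bound e^-1.
  exists ([fset g]%fset, n) => // -[S k] [/= gS nk].
  rewrite sub0r normrN normr_id; case: (muP (S, k)) => _ /(_ g) /=.
  rewrite -fsub1set => /(_ gS) /le_trans; apply.
  rewrite -[leRHS]invrK lef_pV2 ?posrE ?invr_gt0 //.
  have /ltW /le_trans : e^-1 < n%:R by apply: archi_boundP; rewrite invr_ge0 ltW.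
  by apply; rewrite ler_nat (leq_trans nk).
Qed.

Lemma almost_invariant_sub S1 S2 e1 e2 mu : (S1 `<=` S2)%fset -> e2 <= e1 ->
  almost_invariant_probability S2 e2 mu -> almost_invariant_probability S1 e1 mu.
Proof.
move=> S12 e21 [mup mui]; split=> // g gS; apply: le_trans e21.
by apply: mui; exact: (fsubsetP S12).
Qed.

(** A finite set carrying most of [mu i] also carries most of [mu y] for [y] near [i]; by
    compactness one finite set [F] serves all points, and [finite_support F] changes [mu] little. *)
Lemma locally_amenable_finite : locally_amenable -> forall S e, 0 < e ->
  exists mu F, almost_invariant_probability S e mu /\
    forall x g, g \notin F -> mu x g = 0.
Proof.
(* Truncation moves [mu] by at most [4 * d], which enters twice, and the almost invariance of [mu]
   adds one more [d]: nine in all. *)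
move=> loc S e e0; pose d := e / 9; have d0 : 0 < d by rewrite divr_gt0.
have [mu [mup mui]] := loc S d d0.
have [F0 F0P] := choice (fun x => ell1_finite_approx (mu x) d0).
have [D [psi [psi0 psi1 psiU]]] : exists (D : {fset X}) (psi : X -> cfun X R^o),
    [/\ forall i y, 0 <= psi i y, forall y, \sum_(i <- D) psi i y = 1 &
        forall i y, psi i y != 0 -> `|mu i - mu y| < d].
  apply: (partition_of_unity (U := fun i => [set y | `|mu i - mu y| < d])) => x.
    apply: (@open_comp _ _ (fun y => `|mu x - mu y|) [set r | r < d]).
      move=> y _; apply: cvg_norm; apply: cvgB; first exact: cvg_cst.
      exact: cfun_continuous.
    exact: open_lt.
  by rewrite /= subrr normr0.
pose F := (\bigcup_(i <- D) F0 i)%fset.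
(* The partition of unity serves only as a finite cover. Some [psi i y] is nonzero; passing from
   [mu y] to [mu i] costs [d], and [F0 i] misses at most [d] of the mass of [mu i]. *)
have near1 y : 1 - 2 * d <= ell1_sum (ell1_trunc F (mu y)).
  have [i iD iy] : exists2 i, i \in D & psi i y != 0.
    apply: contrapT => nD; have := psi1 y; rewrite big_seq big1.
      by move=> /eqP; rewrite eq_sym oner_eq0.
    by move=> i iD; apply: contrapT => /eqP iy; apply: nD; exists i.
  have F0F : (F0 i `<=` F)%fset by exact: bigfcup_sup.
  have si : 1 - d <= ell1_sum (ell1_trunc F (mu i)).
    rewrite ell1_sum_ge0 => [|t]; last first.
      by rewrite ell1_truncE; case: ifP => // _; case: (mup i).
    apply: le_trans (ler_ell1_sum (F0 i) (ell1_summable _)).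
    rewrite big_seq; under eq_bigr => t tF.
      by rewrite ell1_truncE (fsubsetP F0F _ tF); over.
    by rewrite -big_seq -(probability_norm (mup i)) F0P.
  have := ell1_sum_norm (ell1_trunc F (mu i - mu y)).
  move=> /le_trans /(_ (ell1_trunc_norm_le _ _)) /(le_trans (ler_norm _)).
  rewrite !linearB /= => /le_trans /(_ (ltW (psiU _ _ iy))).
  by lra.
have nuc : continuous (fun x => finite_support F (mu x)).
  apply: lipschitz_continuous_comp; first exact: cfun_continuous.
  by move=> x y; exact: finite_support_lipschitz.
(* The identity joins the support because the lost mass was put there. *)
exists (mk_cfun nuc), (1%g |` F)%fset; split; last first.
  move=> x g; rewrite !inE negb_or => /andP[g1 gF] /=.
  exact: finite_support_outside.
split=> [x|g gS] /=; first exact/finite_support_probability/mup.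
have nud : `|mk_cfun nuc - mu| <= 4 * d.
  apply: cfun_norm_le => x; rewrite cfunB /= (le_trans (finite_support_dist _ _)) //.
  by have := near1 x; lra.
set nu := mk_cfun nuc in nud *.
have -> : gact g nu - nu = gact g (nu - mu) + (gact g mu - mu) - (nu - mu).
  by rewrite linearB /= addrA subrK opprB addrA subrK.
have -> : e = 4 * d + d + 4 * d by rewrite /d; lra.
rewrite (le_trans (ler_normB _ _)) // lerD // (le_trans (ler_normD _ _)) //.
by rewrite lerD ?gact_norm // mui.
Qed.

End local_amenability.

(** * Invariant elements of the bidual and almost invariant probabilities *)

Section bidual_characterization.
Context (R : realType) {G : groupType} (X : compactGSpaceType G).

Lemma blin_move_subproof (E : banachGModType R G) (g : G) :
  (fun u : E => gact g u - u) \in @blin_pred R E E.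
Proof.
rewrite inE; split=> [a u v|]; first by rewrite linearP /= scalerBr addrACA opprD.
exists 2 => u; rewrite (le_trans (ler_normB _ _)) // gact_norm.
by rewrite mulr_natl mulr2n.
Qed.
Definition blin_move (E : banachGModType R G) (g : G) : blin E E :=
  Blin (@blin_move_subproof E g).

(** Invariance says that [m] weakly reaches 0 under [u |-> g u - u], and the sum condition that it
    weakly reaches [cfun_one R X] under [sigma]. An [eta] approximating these relations in norm is
    then normalized pointwise. *)
Lemma invariant_locally_amenable (m : dual (dual (cfun X (ell1 R G)))) :
  G_invariant m -> sums_to_one m -> locally_amenable R X.
Proof.
move=> minv msum S e e0.
(* The bound [2^-1] forces [|eta x| >= 2^-1]; the normalization is then Lipschitz with constant 4,
   whence [e / 4]. *)
pose d := Num.min (e / 4) 2^-1; have d0 : 0 < d.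
  by rewrite lt_min invr_gt0 ltr0n andbT divr_gt0.
have d2 : d <= 2^-1 by rewrite ge_min lexx orbT.
have d4 : d <= e / 4 by rewrite ge_min lexx.
have mL g : weakly_reaches m (blin_move (cfun X (ell1 R G)) g) 0.
  move=> nu; rewrite linear0.
  have -> : blin_comp (blin_move _ g) nu = gact g^-1%g nu - nu.
    by apply: blinP => u; rewrite blinB dual_gactE invgK /= linearB.
  have mg : m (gact g^-1%g nu) = m nu by rewrite -[in RHS](minv g).
  by rewrite linearB /= mg subrr.
have mK : weakly_reaches m (sigma X G) (cfun_one R X).
  by move=> nu; have := congr1 (fun f : dual (dual _) => f nu) msum.
have [eta [etaS eta1]] := weakly_reaches_approx_seq S d0 mL mK.
have eta_ge x : 2^-1 <= `|eta x|.
  rewrite (le_trans _ (ell1_sum_norm _)) // (le_trans _ (ler_norm _)) //.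
  have := ler_cfun_norm (cfun_one R X - sigma X G eta) x.
  rewrite cfunB sigmaE /= => /le_trans /(_ eta1) /(le_trans (ler_norm _)).
  by lra.
have eta0 x : eta x != 0.
  by rewrite -normr_gt0 (lt_le_trans _ (eta_ge x)) // invr_gt0.
have h0 : (0 : R) < 2^-1 by rewrite invr_gt0.
have muc : continuous (fun x => ell1_normalize (eta x)).
  apply: lipschitz_continuous_comp; first exact: cfun_continuous.
  by move=> x y; exact: ell1_normalize_dist (eta_ge x) (eta_ge y).
exists (mk_cfun muc); split=> [x|g gS].
  exact: ell1_normalize_probability.
apply: cfun_norm_le => x; rewrite cfunB cfun_gactE /= -ell1_normalize_gact.
rewrite (le_trans (ell1_normalize_dist h0 _ _)) ?gact_norm //.
have := ler_cfun_norm (gact g eta - eta) x; rewrite cfunB cfun_gactE => le1.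
have := etaS g gS; rewrite sub0r normrN /= => le2.
have := le_trans le1 le2; lra.
Qed.

Lemma locally_amenable_ultra (I : Type)
    (Q : {fset G} -> R -> set I) :
  (forall S e, 0 < e -> Q S e !=set0) ->
  (forall S1 S2 e1 e2, (S1 `<=` S2)%fset -> e2 <= e1 -> Q S2 e2 `<=` Q S1 e1) ->
  exists U : set_system I, UltraFilter U /\ forall S e, 0 < e -> U (Q S e).
Proof.
move=> Q0 Qmono.
have [||a b a0 b0|U [UU UQ]] := @ultra_of_directed _ _
    [set a : {fset G} * R | 0 < a.2] (fun a => Q a.1 a.2).
- by exists (fset0, 1) => /=.
- by move=> a a0; exact: Q0.
- exists ((a.1 `|` b.1)%fset, Num.min a.2 b.2) => /=; first by rewrite lt_min a0.
  move=> i ci; split; apply: Qmono ci.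
  + exact: fsubsetUl.
  + by rewrite ge_min lexx.
  + exact: fsubsetUr.
  + by rewrite ge_min lexx orbT.
- by exists U; split=> // S e e0; exact: (UQ (S, e)).
Qed.

(** [m] is a weak-* limit of almost invariant probabilities viewed in the bidual. *)
Lemma locally_amenable_invariant : locally_amenable R X ->
  exists m : dual (dual (cfun X (ell1 R G))),
    [/\ `|m| = 1, positive_bidual m, G_invariant m & sums_to_one m].
Proof.
move=> loc.
have [||U [UU UQ]] :=
  @locally_amenable_ultra _ (@almost_invariant_probability R G X).
- exact: loc.
- by move=> S1 S2 e1 e2 S12 e21 mu; exact: almost_invariant_sub.
have Up : U [set mu | forall x, is_probability (mu x)].
  by apply: filterS (UQ fset0 1 ltr01) => mu [].
have Ub : \forall mu \near U, `|to_bidual mu| <= 1.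
  apply: filterS Up => mu mup; apply: blin_norm_le => // lam.
  rewrite mul1r (le_trans (ler_blin_norm lam mu)) // ler_piMr //.
  by apply: cfun_norm_le => x; rewrite probability_norm.
have [m [mlim m1]] := ultra_dual_limit UU ler01 Ub.
have msum : sums_to_one m.
  apply: blinP => nu.
  apply: (cvg_eq_of_close _ (mlim (blin_comp (sigma X G) nu)) (cvg_cst _)).
  move=> e e0; apply: filterS Up => mu mup.
  have sE : sigma X G mu = cfun_one R X.
    by apply: cfunP => x; rewrite sigmaE; case: (mup x).
  by rewrite -[X in `|X - _|]/(nu (sigma X G mu)) sE subrr normr0 ltW.
exists m; split=> //.
(* For the lower bound, [m] takes the value 1 at the functional [mu |-> ell1_sum (mu x)], whose norm
   is at most one. *)
- apply/eqP; rewrite eq_le m1 /=.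
  have [x _] := @inhabitedT X.
  have evP : (fun phi : cfun X R^o => phi x) \in @blin_pred R (cfun X R^o) R^o.
    by rewrite inE; split=> //; exists 1 => phi; rewrite mul1r ler_cfun_norm.
  have := congr1 (fun f : dual (dual _) => f (Blin evP)) msum.
  rewrite /= => m_ev.
  rewrite -[leLHS]normr1 -[X in `|X|]m_ev (le_trans (ler_blin_norm m _)) //.
  rewrite ler_piMr //.
  apply: blin_norm_le => // mu; rewrite mul1r /=.
  exact: le_trans (ell1_sum_norm _) (ler_cfun_norm mu x).
- move=> lam lam0; have ml := mlim lam.
  rewrite -(cvg_lim (@Rhausdorff R) ml).
  apply: limr_ge; first by apply/cvg_ex; exists (m lam).
  by apply: filterS Up => mu mup /=; apply: lam0 => x h; case: (mup x).
- move=> g; apply: blinP => lam; rewrite dual_gactE.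
  apply: (cvg_eq_of_close _ (mlim _) (mlim lam)) => e e0.
  have c0 : 0 < `|lam| + 1 by rewrite ltr_wpDl.
  apply: filterS (UQ [fset g]%fset _ (divr_gt0 e0 c0)) => mu [_ /(_ g)].
  rewrite inE eqxx => /(_ isT) mug.
  have lamB : lam (gact g mu) - lam mu = lam (gact g mu - mu) by rewrite linearB.
  rewrite /= invgK lamB (le_trans (ler_blin_norm lam _)) //.
  rewrite -[leRHS](divfK (lt0r_neq0 c0)) mulrC ler_pM //.
  by rewrite lerDl.
Qed.

End bidual_characterization.

(** * Averaging and relative injectivity *)

Lemma gact_cactD (R : realType) (G : groupType) (X : compactGSpaceType G)
    (E : gxModType R X) (g : G) (phi : cfun X R^o) (u : E) :
  gact g (cact phi u) = cact (gact g phi) (gact g u).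
Proof. by rewrite -gact_cact gactK. Qed.

Section averaging.
Context {R : realType} {G : groupType} (X : compactGSpaceType G).
Context (E : gxModType R X) (B : banachGModType R G) (T : blin B (dual E)).
Implicit Types (mu : cfun X (ell1 R G)) (F K : {fset G}) (g h : G) (b : B).

Lemma ell1_eval_subproof (g : G) (mu : cfun X (ell1 R G)) :
  continuous (fun x => mu x g).
Proof.
apply: (lipschitz_continuous_comp (g := fun a : ell1 R G => a g : R^o) (M := 1)).
  exact: cfun_continuous.
by move=> x y; rewrite mul1r -ell1B; exact: ler_ell1_eval.
Qed.
Definition coef (mu : cfun X (ell1 R G)) (g : G) : cfun X R^o :=
  mk_cfun (@ell1_eval_subproof g mu).

(** The sum over [g] of [mu_g . (g T)], evaluated at [b]. [F] is meant to contain the support of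
    [mu]; by [average_incl], enlarging such an [F] changes nothing. *)
Definition average (mu : cfun X (ell1 R G)) (F : {fset G}) (b : B) : dual E :=
  \sum_(g <- F) cact (coef mu g) (gact g T b).

Definition supported (mu : cfun X (ell1 R G)) (F : {fset G}) : Prop :=
  forall x g, g \notin F -> mu x g = 0.

Lemma coef_outside mu F g : supported mu F -> g \notin F -> coef mu g = 0.
Proof. by move=> muF gF; apply: cfunP => x; rewrite /= muF. Qed.

Lemma ell1_sum_supported (a : ell1 R G) (F : {fset G}) :
  (forall g, g \notin F -> a g = 0) -> \sum_(g <- F) a g = ell1_sum a.
Proof.
move=> aF.
have aE : a = \sum_(g <- F) a g *: ell1_delta g.
  apply: ell1P => h; rewrite ell1_sumE.
  have [hF|hF] := boolP (h \in F); last first.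
    rewrite aF // big_seq big1 // => g gF; rewrite ell1Z /= /ell1_delta_fun.
    by rewrite (_ : (h == g) = false) ?scaler0 //; apply: contraNF hF => /eqP ->.
  rewrite (big_fsetD1 h) //= big_seq big1 => [|g].
    by rewrite addr0 -[RHS]/(a h * (h == h)%:R) eqxx mulr1.
  rewrite !inE => /andP[gh _]; rewrite -[LHS]/(a g * (h == g)%:R) eq_sym.
  by rewrite (negbTE gh) mulr0.
rewrite {2}aE linear_sum; apply: eq_bigr => g _.
by rewrite linearZ /= ell1_sum_delta [RHS]mulr1.
Qed.

Lemma average_linear mu F : linear (average mu F).
Proof.
move=> a u v; rewrite /average scaler_sumr -big_split; apply: eq_bigr => g _.
by rewrite (linearP (gact g T)) (linearP (cact (coef mu g))).
Qed.

(** The coefficients are nonnegative with sum one at each point, so type C bounds the average by the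
    common bound of the terms. *)
Lemma average_norm_le mu F (M : R) b : (forall x, is_probability (mu x)) ->
  supported mu F -> type_C (dual E) -> `|T| <= M -> `|average mu F b| <= M * `|b|.
Proof.
move=> mup muF CE TM; rewrite -[leRHS]mul1r; apply: type_C_seq => //.
- by move=> g x /=; case: (mup x).
- by move=> x; rewrite /= ell1_sum_supported; [case: (mup x) => _ ->|exact: muF].
- by rewrite mulr_ge0 // (le_trans _ TM).
- move=> g; rewrite (le_trans (ler_blin_norm _ _)) // ler_wpM2r //.
  by rewrite gact_norm.
Qed.

Lemma average_fixed mu F b v : (forall x, is_probability (mu x)) ->
  supported mu F -> (forall g, gact g T b = v) -> average mu F b = v.
Proof.
move=> mup muF bv; rewrite /average; under eq_bigr do rewrite bv.
rewrite -cact_suml -[RHS](cact1 v); congr (cact _ _); apply: cfunP => x.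
rewrite cfun_sumE /= ell1_sum_supported; first by case: (mup x).
exact: muF.
Qed.

Lemma average_incl mu F K b : supported mu F -> (F `<=` K)%fset ->
  average mu F b = average mu K b.
Proof.
move=> muF FK; apply: big_fset_incl => // g _ gF.
by rewrite (coef_outside muF gF) cact0l.
Qed.

(** Acting by [h] sends the term of index [g] to the term of index [h * g] for the translated
    [mu]. *)
Lemma gact_average mu F h b :
  gact h (average mu F b) =
  average (gact h mu) [fset h * g | g in F]%g%fset (gact h b).
Proof.
rewrite /average [RHS]big_imfset; last by move=> ? ? _ _; exact: mulgI.
rewrite linear_sum; apply: eq_bigr => g _.
transitivity (cact (gact h (coef mu g)) (gact h (gact g T b))).
  exact: (gact_cactD (E := dual E)).
congr (cact _ _).
  by apply: cfunP => x; rewrite /= mulKg.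
by rewrite !blin_gactE invgM !gactM gactK.
Qed.

(** By [gact_average] the difference is an average with the signed coefficients of [mu - gact h mu],
    to which [type_C_signed] applies on a common support. *)
Lemma average_near_equivariant mu F h b (e M : R) : supported mu F ->
  type_C (dual E) -> `|T| <= M -> `|gact h mu - mu| <= e ->
  `|average mu F (gact h b) - gact h (average mu F b)| <= 2 * e * (M * `|b|).
Proof.
move=> muF CE TM mue.
pose hF := [fset h * g | g in F]%g%fset.
have hmuF : supported (gact h mu) hF.
  move=> x g ghF; rewrite cfun_gactE ell1_gactE muF //.
  apply: contra ghF => gF; apply/imfsetP; exists (h^-1 * g)%g => //.
  by rewrite mulVKg.
rewrite gact_average (average_incl _ muF (fsubsetUl F hF)).
rewrite (average_incl _ hmuF (fsubsetUr F hF)) -sumrB.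
under eq_bigr do rewrite -cactBl.
apply: type_C_signed => //.
- move=> x; apply: le_trans mue; apply: le_trans (ler_cfun_norm _ x).
  rewrite cfunB -normrN opprB ell1_normE.
  have H := ler_ell1_sum (F `|` hF)%fset (ell1_summable (mu x - gact h mu x)).
  by apply: le_trans H; apply: ler_sum => k _; exact: lexx.
- by rewrite mulr_ge0 // (le_trans _ TM).
- move=> g; rewrite (le_trans (ler_blin_norm _ _)) //.
  by rewrite !gact_norm ler_wpM2r.
Qed.

End averaging.

Section amenable_injectivity.
Context {R : realType} {G : groupType} (X : compactGSpaceType G).

(** At each [b], the value of [beta] is a weak-* limit of averages of [T] over ever more invariant
    [mu], indexed together with a finite support. The last clause makes [beta] keep the values at
    which [T] is already equivariant. *)
Lemma equivariant_average (E : gxModType R X) (B : banachGModType R G)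
    (T : blin B (dual E)) : locally_amenable R X -> type_C (dual E) ->
  exists beta : blin B (dual E),
    [/\ `|beta| <= `|T|, forall h b, beta (gact h b) = gact h (beta b) &
        forall b v, (forall g, gact g T b = v) -> beta b = v].
Proof.
move=> loc CE.
pose Q (S : {fset G}) (e : R) := [set t : cfun X (ell1 R G) * {fset G} |
  almost_invariant_probability S e t.1 /\ supported t.1 t.2].
have [||U [UU UQ]] := @locally_amenable_ultra R G _ Q.
- move=> S e e0; have [mu [F [mui muF]]] := locally_amenable_finite loc S e0.
  by exists (mu, F).
- move=> S1 S2 e1 e2 S12 e21 t [ti tF]; split=> //.
  exact: almost_invariant_sub ti.
have UP : U [set t : cfun X (ell1 R G) * {fset G} |
    (forall x, is_probability (t.1 x)) /\ supported t.1 t.2].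
  by apply: filterS (UQ fset0 1 ltr01) => t [[]].
have avb b : \forall t \near U, `|average T t.1 t.2 b| <= `|T| * `|b|.
  by apply: filterS UP => t [tp tF]; exact: average_norm_le.
have avl b := ultra_dual_limit UU (mulr_ge0 (normr_ge0 T) (normr_ge0 b)) (avb b).
have [s sP] := choice avl.
have slin : linear s.
  move=> a u v; apply: blinP => w; rewrite blinD blinZ.
  have [c1 _] := sP (a *: u + v); have [c2 _] := sP u; have [c3 _] := sP v.
  apply: (cvg_unique _ (c1 w)) => //.
  rewrite [X in fmap X](_ : _ =
    (fun t => a *: average T t.1 t.2 u w + average T t.1 t.2 v w)).
    by apply: cvgD; [apply: cvgZr; exact: c2|exact: c3].
  by apply/funext => t; rewrite average_linear.
have sb : s \in @blin_pred R B (dual E).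
  by rewrite inE; split=> //; exists `|T| => b; case: (sP b).
exists (Blin sb); split=> [|h b|b v bv].
- by apply: blin_norm_le => // b; case: (sP b).
- apply: blinP => w; have [c1 _] := sP (gact h b); have [c2 _] := sP b.
  apply: (cvg_eq_of_close _ (c1 w) (c2 (gact h^-1%g w))) => e e0.
  (* With tolerance [e / c] the defect of equivariance, tested on [w], is at most [e]. *)
  pose c := 2 * (`|T| * `|b|) * `|w| + 1.
  have c0 : 0 < c by rewrite ltr_wpDl ?mulr_ge0.
  apply: filterS (UQ [fset h]%fset _ (divr_gt0 e0 c0)) => t [[_ /(_ h)]].
  rewrite inE eqxx => /(_ isT) th tF.
  have := average_near_equivariant b tF CE (lexx `|T|) th.
  set x := average _ _ _ _; set y := average _ _ _ _ => xy.
  have -> : x w - y (gact h^-1%g w) = (x - gact h y) w by [].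
  rewrite (le_trans (ler_blin_norm _ _)) //.
  have := ler_wpM2r (normr_ge0 w) xy; move=> /le_trans; apply.
  have -> : 2 * (e / c) * (`|T| * `|b|) * `|w| =
      (e / c) * (2 * (`|T| * `|b|) * `|w|).
    by ring.
  rewrite -[leRHS](divfK (lt0r_neq0 c0)) ler_wpM2l ?divr_ge0 ?ltW //.
  by rewrite /c ltrDl.
- apply: blinP => w; have [c1 _] := sP b.
  apply: (cvg_eq_of_close _ (c1 w) (cvg_cst (v w))) => e e0.
  apply: filterS UP => t [tp tF].
  by rewrite (average_fixed tp tF bv) subrr normr0 ltW.
Qed.

Section operator_norm_on_subspace.
Context (B E : normedModType R) (A : set B) (alpha : B -> E).
Hypothesis A0 : A 0.
Hypothesis Alin : forall (a : R) u v, A u -> A v -> A (a *: u + v).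
Hypothesis alin : forall (a : R) u v, A u -> A v ->
  alpha (a *: u + v) = a *: alpha u + alpha v.
Hypothesis abound : exists M, forall u, A u -> `|alpha u| <= M * `|u|.

Let a0 : alpha 0 = 0.
Proof.
have := alin 1 A0 A0; rewrite !scale1r addr0 => /esym /(canRL (addrK _)).
by rewrite subrr.
Qed.

Let hs : has_sup [set `|alpha u| | u in [set u | A u /\ `|u| <= 1]].
Proof.
split; first by exists `|alpha 0|, 0 => //; rewrite /= normr0.
have [M aM] := abound; exists `|M| => _ [u [Au u1] <-].
rewrite (le_trans (aM u Au)) // (le_trans (ler_wpM2r _ (ler_norm M))) //.
by rewrite ler_piMr.
Qed.

Lemma opnorm_ge0 : 0 <= opnorm A alpha.
Proof.
apply: sup_ubound; first by case: hs.
by exists 0; rewrite /= ?a0 normr0.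
Qed.

Lemma ler_opnorm u : A u -> `|alpha u| <= opnorm A alpha * `|u|.
Proof.
move=> Au; have [->|u0] := eqVneq u 0; first by rewrite a0 !normr0 mulr0.
have nu : 0 < `|u| by rewrite normr_gt0.
have ZE (c : R) : alpha (c *: u) = c *: alpha u.
  by have := alin c Au A0; rewrite !addr0 a0 addr0.
rewrite -ler_pdivrMr //.
have -> : `|alpha u| / `|u| = `|alpha (`|u|^-1 *: u)|.
  by rewrite ZE normrZ normfV normr_id mulrC.
apply: sup_ubound; first by case: hs.
exists (`|u|^-1 *: u) => //; split.
  by have := Alin `|u|^-1 Au A0; rewrite addr0.
by rewrite normrZ normfV normr_id mulVf // gt_eqF.
Qed.

Lemma opnorm_le_ext (beta : blin B E) :
  (forall u, A u -> beta u = alpha u) -> opnorm A alpha <= `|beta|.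
Proof.
move=> ba; apply: ge_sup; first by case: hs.
move=> _ [u [Au u1] <-]; rewrite -ba // (le_trans (ler_blin_norm _ _)) //.
by rewrite ler_piMr.
Qed.

End operator_norm_on_subspace.

Lemma amenable_relatively_injective (E : gxModType R X) :
  locally_amenable R X -> type_C (dual E) -> relatively_injective (dual E).
Proof.
move=> loc CE B A [_ A0 Alin Ag] [p [p1 pA pid]] alpha [alin abd ag].
have N0 := opnorm_ge0 A0 alin abd.
have TP : (fun b => alpha (p b)) \in @blin_pred R B (dual E).
  rewrite inE; split=> [a u v|].
    by rewrite (linearP p); exact: alin (pA u) (pA v).
  exists (opnorm A alpha) => b.
  rewrite (le_trans (ler_opnorm A0 Alin alin abd _)) //.
  by rewrite ler_wpM2l // (le_trans (ler_blin_norm _ _)) // p1 mul1r.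
have [beta [bT beq bfix]] := equivariant_average (Blin TP) loc CE.
(* On [A] the projection is the identity and [alpha] is equivariant, so every translate of the
   averaged operator takes the value [alpha u] at [u]. *)
have bA u : A u -> beta u = alpha u.
  move=> Au; apply: bfix => g; rewrite blin_gactE /= pid; last exact: Ag.
  by rewrite -ag ?gactVK //; exact: Ag.
exists beta; split=> //; apply/eqP; rewrite eq_le (opnorm_le_ext A0 abd bA) andbT.
apply: le_trans bT _; apply: blin_norm_le => // b /=.
rewrite (le_trans (ler_opnorm A0 Alin alin abd _)) //.
by rewrite ler_wpM2l // (le_trans (ler_blin_norm _ _)) // p1 mul1r.
Qed.

End amenable_injectivity.

(** * Vanishing of bounded cohomology *)

Lemma blin_id_subproof (R : realType) (E : normedModType R) :
  (fun u : E => u) \in @blin_pred R E E.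
Proof. by rewrite inE; split=> //; exists 1 => u; rewrite mul1r. Qed.
Definition blin_id (R : realType) (E : normedModType R) : blin E E :=
  Blin (@blin_id_subproof R E).

Lemma blin_sumE (R : realType) (E F : normedModType R) (I : Type) (s : seq I)
    (P : pred I) (u : I -> blin E F) v :
  (\sum_(i <- s | P i) u i) v = \sum_(i <- s | P i) u i v.
Proof. by elim/big_rec2: _ => // i x y _ <-. Qed.

Section fixed_points.
Context (R : realType) (E : normedModType R) (p : blin E E).

Lemma closed_blin_fixed : closed [set u | p u = u].
Proof.
pose q := p - blin_id E.
have qc : continuous q.
  apply: (@lipschitz_continuous_comp R E E E id q `|q|) => [x|x y].
    exact: cvg_id.
  by rewrite -linearB ler_blin_norm.
have -> : [set u | p u = u] = q @^-1` [set 0].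
  have qE u : q u = p u - u by [].
  apply/seteqP; split=> u pu.
    by change (q u = 0); rewrite qE pu subrr.
  by apply/eqP; rewrite -subr_eq0 -qE; apply/eqP.
move/continuous_closedP : qc => /(_ [set 0]); apply.
exact/accessible_closed_set1/hausdorff_accessible/norm_hausdorff.
Qed.

Lemma blin_fixedP (a : R) u v : p u = u -> p v = v -> p (a *: u + v) = a *: u + v.
Proof. by move=> pu pv; rewrite (linearP p) /= pu pv. Qed.

End fixed_points.

(** * Equivariant retractions from relative injectivity *)

Section retraction.
Context {R : realType} {G : groupType} (D B : banachGModType R G).
Context (K : blin D B) (ev : blin B D).
Hypothesis K_le : forall u, `|K u| <= `|u|.
Hypothesis ev_le : forall b, `|ev b| <= `|b|.
Hypothesis evK : forall u, ev (K u) = u.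
Hypothesis K_gact : forall g u, gact g (K u) = K (gact g u).

Let p := blin_comp ev K.

(** This set is the range of [K]; as the fixed points of [p] it is visibly closed. *)
Lemma retract_submodule : banach_submodule [set b | p b = b].
Proof.
split.
- exact: closed_blin_fixed.
- exact: (linear0 p).
- by move=> a u v; exact: blin_fixedP.
- move=> g b pb; change (K (ev (gact g b)) = gact g b).
  by rewrite -pb -[p b]/(K (ev b)) K_gact evK.
Qed.

(** [ev] need not be equivariant on [B], but on the range of [K] it is the inverse of [K], hence a
    morphism, and [beta] extends that restriction. The nonzero vector makes the norm of [p] equal to
    one and not zero. *)
Lemma relatively_injective_retraction : relatively_injective D ->
  (exists u : D, u != 0) ->
  exists beta : blin B D,
    (forall g b, beta (gact g b) = gact g (beta b)) /\ forall u, beta (K u) = u.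
Proof.
move=> ri [u0 u00].
have pK u : p (K u) = K u by rewrite -[LHS]/(K (ev (K u))) evK.
have [||beta [beq bA _]] := ri _ _ retract_submodule _ ev.
- exists p; split; [|by move=> b; exact: pK|by []].
  apply/eqP; rewrite eq_le; apply/andP; split.
    apply: blin_norm_le => // b; rewrite mul1r.
    exact: le_trans (K_le _) (ev_le b).
  have c0 : 0 < `|K u0|.
    rewrite normr_gt0; apply: contra_neq u00 => c0.
    by rewrite -(evK u0) c0 linear0.
  by rewrite -(ler_pM2r c0) mul1r -{1}pK ler_blin_norm.
- split=> [a u v _ _||g b pb]; first exact: (linearP ev).
    by exists 1 => b _; rewrite mul1r ev_le.
  by rewrite -pb -[p b]/(K (ev b)) K_gact !evK.
exists beta; split=> // u; rewrite bA ?evK //; exact: pK.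
Qed.

End retraction.

(* [blin (ell1 R G) (dual E)] serves as the module of bounded functions
   [G -> dual E]: [fun_op f] is the operator sending [delta_t] to [f t]. *)
Section bounded_functions.
Context {R : realType} {G : groupType} (E : banachGModType R G).

Section operator.
Context (f : G -> dual E) (M : R) (fM : forall t, `|f t| <= M).

Let fuM u t : `|f t u| <= M * `|u|.
Proof. by rewrite (le_trans (ler_blin_norm _ _)) // ler_wpM2r. Qed.

Let pairing (a : ell1 R G) (u : E) : R^o := ell1_sum (ell1_weight (fuM u) a).

Let pairing_le a u : `|pairing a u| <= M * `|a| * `|u|.
Proof.
rewrite (le_trans (ell1_sum_norm _)) // (le_trans (ell1_weight_norm_le _ _)) //.
by rewrite mulrAC.
Qed.

Lemma fun_op_inner_subproof a : pairing a \in @blin_pred R E R^o.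
Proof.
rewrite inE; split=> [k u v|]; last by exists (M * `|a|) => u; exact: pairing_le.
rewrite /pairing -ell1_sum_linear; congr ell1_sum; apply: ell1P => t.
rewrite ell1D ell1Z -[LHS]/(a t * f t (k *: u + v)).
by rewrite linearP mulrDr [k *: _]mulrCA.
Qed.

Lemma fun_op_subproof :
  (fun a => Blin (fun_op_inner_subproof a)) \in @blin_pred R (ell1 R G) (dual E).
Proof.
rewrite inE; split=> [k a b|].
  apply: blinP => u; rewrite blinD blinZ -[LHS]/(pairing _ _).
  rewrite -[RHS]/(k *: pairing a u + pairing b u) /pairing -ell1_sum_linear.
  congr ell1_sum; apply: ell1P => t; rewrite ell1D ell1Z.
  by rewrite -[LHS]/((k * a t + b t) * f t u) mulrDl -mulrA.
exists M => a; apply: blin_norm_le; last by move=> u; exact: pairing_le.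
by rewrite mulr_ge0 // (le_trans _ (fM 1%g)).
Qed.

Definition fun_op : blin (ell1 R G) (dual E) := Blin fun_op_subproof.

Lemma fun_op_norm_le : `|fun_op| <= M.
Proof.
have M0 : 0 <= M by rewrite (le_trans _ (fM 1%g)).
apply: blin_norm_le => // a; apply: blin_norm_le => [|u]; last exact: pairing_le.
by rewrite mulr_ge0.
Qed.

(** Lets [fun_op a u] be computed from any summable family with the right terms, whatever bound [fM]
    it was built with. *)
Lemma fun_opE (a : ell1 R G) (u : E) (b : ell1 R G) :
  (forall t, b t = a t * f t u) -> fun_op a u = ell1_sum b.
Proof. by move=> bE; congr ell1_sum; apply: ell1P => t; rewrite bE. Qed.

Lemma fun_op_weightP (a : ell1 R G) (u : E) :
  exists b : ell1 R G, (forall t, b t = a t * f t u) /\ fun_op a u = ell1_sum b.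
Proof. by exists (ell1_weight (fuM u) a). Qed.

End operator.

Lemma const_op_subproof (u : dual E) :
  (fun a : ell1 R G => ell1_sum a *: u) \in @blin_pred R (ell1 R G) (dual E).
Proof.
rewrite inE; split=> [k a b|]; first by rewrite linearP scalerDl scalerA.
by exists `|u| => a; rewrite normrZ mulrC ler_wpM2l // ell1_sum_norm.
Qed.
Definition const_op (u : dual E) : blin (ell1 R G) (dual E) :=
  Blin (const_op_subproof u).

Lemma eval1_subproof :
  (fun T : blin (ell1 R G) (dual E) => T (ell1_delta 1%g)) \in
    @blin_pred R (blin (ell1 R G) (dual E)) (dual E).
Proof.
rewrite inE; split; first by move=> k S T; rewrite blinD blinZ.
exists 1 => T; rewrite mul1r (le_trans (ler_blin_norm _ _)) // ler_piMr //.
exact: ell1_delta_norm_le.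
Qed.
Definition eval1 : blin (blin (ell1 R G) (dual E)) (dual E) := Blin eval1_subproof.

Lemma eval1_norm_le T : `|eval1 T| <= `|T|.
Proof.
by rewrite (le_trans (ler_blin_norm T _)) // ler_piMr // ell1_delta_norm_le.
Qed.

Lemma const_op_norm_le u : `|const_op u| <= `|u|.
Proof.
apply: blin_norm_le => // a /=.
by rewrite normrZ mulrC ler_wpM2l // ell1_sum_norm.
Qed.

Lemma const_op_linear : linear const_op.
Proof.
move=> k u v; apply: blinP => a; rewrite blinD blinZ /=.
by rewrite scalerDr !scalerA mulrC.
Qed.

Lemma const_op_blin_subproof :
  const_op \in @blin_pred R (dual E) (blin (ell1 R G) (dual E)).
Proof.
rewrite inE; split; first exact: const_op_linear.
by exists 1 => u; rewrite mul1r const_op_norm_le.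
Qed.
Definition const_op_blin : blin (dual E) (blin (ell1 R G) (dual E)) :=
  Blin const_op_blin_subproof.

Lemma gact_const_op g u : gact g (const_op u) = const_op (gact g u).
Proof.
by apply: blinP => a; rewrite blin_gactE /= ell1_sum_gact linearZ.
Qed.

Lemma eval1_const u : eval1 (const_op u) = u.
Proof. by rewrite /= ell1_sum_delta scale1r. Qed.

(** [beta] is an equivariant vector-valued mean on bounded functions: [const_op] embeds the
    constants and [eval1] evaluates at the identity. *)
Lemma relatively_injective_mean : relatively_injective (dual E) ->
  (exists u : dual E, u != 0) ->
  exists beta : blin (blin (ell1 R G) (dual E)) (dual E),
    (forall g T, beta (gact g T) = gact g (beta T)) /\
    forall u, beta (const_op u) = u.
Proof.
exact: (@relatively_injective_retraction R G (dual E) (blin (ell1 R G) (dual E))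
  const_op_blin eval1 const_op_norm_le eval1_norm_le eval1_const gact_const_op).
Qed.

End bounded_functions.

(** * Homogeneous cochains and the contracting homotopy *)

Section cochains.
Context {R : realType} {G : groupType}.

Definition ord_cons (n : nat) (x : G) (s : 'I_n -> G) : 'I_n.+1 -> G :=
  fun i => if unlift ord0 i is Some j then s j else x.

Lemma ord_cons_lift0 n x (s : 'I_n -> G) : (fun j => ord_cons x s (lift ord0 j)) = s.
Proof. by apply/funext => j; rewrite /ord_cons liftK. Qed.

Lemma ord_cons_lift n x (s : 'I_n.+1 -> G) (k : 'I_n.+1) :
  (fun j => ord_cons x s (lift (lift ord0 k) j)) =
  ord_cons x (fun j => s (lift k j)).
Proof.
apply/funext => j; case: (unliftP ord0 j) => [i ->|->].
  have -> : lift (lift ord0 k) (lift ord0 i) = lift ord0 (lift k i).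
    by apply: val_inj; rewrite /= /bump /= !add1n ltnS addnS.
  by rewrite /ord_cons !liftK.
have -> : lift (lift ord0 k) ord0 = ord0 :> 'I_n.+2 by exact: val_inj.
by rewrite /ord_cons !unlift_none.
Qed.

Lemma gact_ord_cons n g x (s : 'I_n -> G) :
  (fun i => g * ord_cons x s i)%g = ord_cons (g * x)%g (fun i => g * s i)%g.
Proof. by apply/funext => i; rewrite /ord_cons; case: unlift. Qed.

(** The cocycle identity at the tuple [x] followed by [s], solved for the term that omits [x]; the
    index shift flips the signs. *)
Lemma cocycle_cons (E : banachGModType R G) n (f : ('I_n.+1 -> G) -> E) x s :
  (forall s, differential f s = 0) ->
  f s = \sum_(i < n.+1) (-1) ^+ i *: f (ord_cons x (fun j => s (lift i j))).
Proof.
move=> df; have := df (ord_cons x s).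
rewrite /differential big_ord_recl expr0 scale1r ord_cons_lift0 => /eqP.
rewrite addr_eq0 => /eqP ->; rewrite -sumrN; apply: eq_bigr => i _.
by rewrite ord_cons_lift /= /bump add1n exprS mulN1r scaleNr opprK.
Qed.

End cochains.

Section vanishing.
Context {R : realType} {G : groupType}.

(** The primitive at [s] is the mean over [x] of [f] at [x] followed by [s]. By [cocycle_cons] its
    differential is the mean of the constant function [f s]. *)
Lemma relatively_injective_vanishing (E : banachGModType R G) n : (1 <= n)%N ->
  relatively_injective (dual E) -> Hb_vanishes (dual E) n.
Proof.
case: n => // n _ ri f [[[M fM] feq] df].
(* The zero module is treated apart, since the mean is obtained from a nonzero vector. *)
have [nz|z] := pselect (exists u : dual E, u != 0); last first.
  have z0 (u : dual E) : u = 0.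
    by apply: contrapT => /eqP u0; apply: z; exists u.
  exists (fun=> 0); last by apply/funext => s; rewrite [LHS]z0 [RHS]z0.
  split=> [|g s]; first by exists 0 => s; rewrite normr0.
  by rewrite [LHS]z0 [RHS]z0.
have [beta [beq bconst]] := relatively_injective_mean ri nz.
have fsM s x : `|f (ord_cons x s)| <= M by exact: fM.
pose T s := fun_op (fsM s).
exists (fun s => beta (T s)).
  split=> [|g s].
    exists (`|beta| * M) => s; rewrite (le_trans (ler_blin_norm _ _)) //.
    by rewrite ler_wpM2l // fun_op_norm_le.
  rewrite -beq; congr (beta _); apply: blinP => a; apply: blinP => u.
  have [b [bE ->]] := fun_op_weightP (fsM (fun i => g * s i)%g) a u.
  rewrite -[RHS]/(T s (gact g^-1%g a) (gact g^-1%g u)) -(ell1_sum_gact g^-1%g b).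
  apply/esym/fun_opE => t; rewrite ell1_gactE bE invgK.
  by rewrite -gact_ord_cons feq ell1_gactE invgK.
apply/funext => s; rewrite -[RHS]bconst /differential.
(* This is [cocycle_cons] read as an identity between bounded functions of [x]. *)
have -> : const_op (f s) = \sum_(i < n.+2) (-1) ^+ i *: T (fun j => s (lift i j)).
  apply: blinP => a; apply: blinP => u.
  rewrite !blin_sumE.
  have bP (i : 'I_n.+2) := fun_op_weightP (fsM (fun j => s (lift i j))) a u.
  have [b bE] := choice bP.
  rewrite -[LHS]/(ell1_sum a * f s u) mulrC -ell1_sum_scale.
  transitivity (ell1_sum (\sum_(i < n.+2) (-1) ^+ i *: b i)).
    congr ell1_sum; apply: ell1P => t.
    rewrite -[LHS]/(f s u * a t) (cocycle_cons t s df) blin_sumE ell1_sumE mulr_suml.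
    apply: eq_bigr => i _; rewrite ell1Z; case: (bE i) => -> _.
    by rewrite blinZ -mulrA [in LHS](mulrC (f _ u)).
  rewrite linear_sum; apply: eq_bigr => i _.
  by rewrite linearZ /=; case: (bE i) => _ <-.
by rewrite linear_sum; apply: eq_bigr => i _; rewrite linearZ.
Qed.

End vanishing.

(** * The kernel of the summation map *)

Section sum_zero.
Context {R : realType} {G : groupType}.

Definition sum0_pred : {pred ell1 R G} := mem [set a : ell1 R G | ell1_sum a = 0].

Record sum0 := Sum0 { sum0_val :> ell1 R G; sum0_valP : sum0_val \in sum0_pred }.

HB.instance Definition _ := [isSub for sum0_val].
HB.instance Definition _ := [Choice of sum0 by <:].

Lemma sum0_submod : submod_closed sum0_pred.
Proof.
split; first by rewrite inE /=; exact: (linear0 (@ell1_sum R G : ell1 R G -> R^o)).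
move=> k a b; rewrite !inE /= => a0 b0; rewrite ell1_sum_linear a0 b0.
by rewrite scaler0 addr0.
Qed.
HB.instance Definition _ :=
  GRing.isSubmodClosed.Build R (ell1 R G) sum0_pred sum0_submod.
HB.instance Definition _ := [SubChoice_isSubLmodule of sum0 by <:].

Lemma sum0_sum (a : sum0) : ell1_sum a = 0.
Proof. by have := sum0_valP a; rewrite inE. Qed.

Definition sum0_norm (a : sum0) : R := `|sum0_val a|.

Lemma sum0_normD a b : sum0_norm (a + b) <= sum0_norm a + sum0_norm b.
Proof. exact: ler_normD. Qed.

Lemma sum0_normZ k a : sum0_norm (k *: a) = `|k| * sum0_norm a.
Proof. exact: normrZ. Qed.

Lemma sum0_norm0_eq0 a : sum0_norm a = 0 -> a = 0.
Proof. by move=> a0; apply: val_inj; apply: normr0_eq0. Qed.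

HB.instance Definition _ := Lmodule_isNormed.Build R sum0
  sum0_normD sum0_normZ sum0_norm0_eq0.

Lemma sum0_complete (F : set_system sum0) : ProperFilter F -> cauchy F -> cvg F.
Proof.
move: F; apply: (@eval_complete R sum0 (ell1 R G) unit (fun a _ => sum0_val a)
  (fun=> 1)).
  by move=> a b _; rewrite mul1r.
move=> F h FF Fc /(_ tt); set l := h tt => Fl.
have near_l (e : R) (a : sum0) : 0 < e -> (\forall b \near F, `|a - b| < e) ->
    `|sum0_val a - l| <= e.
  by move=> e0 ae; apply: (limit_dist FF Fl); apply: filterS ae => b /ltW.
have l0 : l \in sum0_pred.
  rewrite inE /=; apply/eqP; rewrite -normr_le0; apply/ler_addgt0Pr => e e0.
  rewrite add0r; have [a ae] := Fc e e0.
  have := ell1_sum_norm (sum0_val a - l).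
  rewrite linearB /= sum0_sum sub0r normrN => /le_trans; apply.
  exact: near_l.
by exists (Sum0 l0) => e a e0 ae; exact: near_l.
Qed.
HB.instance Definition _ := Uniform_isComplete.Build sum0 sum0_complete.

Lemma sum0_gact_subproof (g : G) (a : sum0) : gact g (sum0_val a) \in sum0_pred.
Proof. by rewrite inE /= ell1_sum_gact sum0_sum. Qed.
Definition sum0_gact (g : G) (a : sum0) : sum0 := Sum0 (sum0_gact_subproof g a).

Let sum0_gact_linear g : linear (sum0_gact g).
Proof. by move=> k a b; apply: val_inj; exact: gact_linear. Qed.
Let sum0_gact1 a : sum0_gact 1%g a = a.
Proof. by apply: val_inj; exact: gact1. Qed.
Let sum0_gactM g h a : sum0_gact (g * h)%g a = sum0_gact g (sum0_gact h a).
Proof. by apply: val_inj; exact: gactM. Qed.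
Let sum0_gact_norm g a : `|sum0_gact g a| = `|a|.
Proof. exact: gact_norm. Qed.
HB.instance Definition _ := isBanachGModule.Build R G sum0
  sum0_gact_linear sum0_gact1 sum0_gactM sum0_gact_norm.

Lemma delta_diff_subproof (g h : G) : ell1_delta h - ell1_delta g \in sum0_pred.
Proof. by rewrite inE /= linearB /= !ell1_sum_delta subrr. Qed.
Definition delta_diff (g h : G) : sum0 := Sum0 (delta_diff_subproof g h).

Lemma delta_diff_norm_le g h : `|delta_diff g h| <= 2.
Proof.
change (`|ell1_delta h - ell1_delta g : ell1 R G| <= 1 + 1).
by rewrite (le_trans (ler_normB _ _)) // lerD // ell1_delta_norm_le.
Qed.

End sum_zero.
Arguments sum0 : clear implicits.

(** * Functionals on C(X, V) as integral operators *)

Lemma type_M_seq (R : realType) (X : compactHausdorffType) (E : cxModType R X)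
    (I : Type) (s : seq I) (phi : I -> cfun X R^o) (u : E) :
  type_M E -> (forall i x, 0 <= phi i x) ->
  \sum_(i <- s) `|cact (phi i) u| <= `|\sum_(i <- s) phi i| * `|u|.
Proof.
move=> ME phi0; rewrite big_tnth [X in `|X|]big_tnth.
by apply: ME => i x; exact: phi0.
Qed.

Section integral_operators_of_functionals.
Context {R : realType} (X : compactHausdorffType) (V : completeNormedModType R).
Implicit Types (Phi : dual (cfun X V)) (phi psi : cfun X R^o).

Lemma functional_slice_subproof Phi phi :
  (fun v => Phi (cfun_tensor phi v)) \in @blin_pred R V R^o.
Proof.
rewrite inE; split=> [k u v|].
  rewrite -(linearP Phi); congr (Phi _); apply: cfunP => x.
  rewrite -[RHS]/(k *: (phi x *: u) + phi x *: v).
  by rewrite /= scalerDr !scalerA mulrC.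
exists (`|Phi| * `|phi|) => v; rewrite (le_trans (ler_blin_norm _ _)) //.
by rewrite -mulrA ler_wpM2l // cfun_tensor_norm_le.
Qed.

Lemma functional_op_subproof Phi :
  (fun phi => Blin (functional_slice_subproof Phi phi)) \in
    @blin_pred R (cfun X R^o) (dual V).
Proof.
rewrite inE; split=> [k p q|].
  apply: blinP => v; rewrite blinD blinZ /= -(linearP Phi); congr (Phi _).
  apply: cfunP => x; rewrite -[RHS]/(k *: (p x *: v) + q x *: v).
  by rewrite -[LHS]/((k * p x + q x) *: v) scalerDl scalerA.
exists `|Phi| => phi; apply: blin_norm_le => [|v]; first by rewrite mulr_ge0.
rewrite (le_trans (ler_blin_norm Phi _)) // -mulrA ler_wpM2l //.
exact: cfun_tensor_norm_le.
Qed.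

Definition functional_op Phi : blin (cfun X R^o) (dual V) :=
  Blin (functional_op_subproof Phi).

Lemma functional_opE Phi phi v : functional_op Phi phi v = Phi (cfun_tensor phi v).
Proof. by []. Qed.

(** An elementary tensor is a multiple of a constant function, so this norm is controlled by the
    module action; type M can then bound the Riemann sums. *)
Lemma functional_op_cact Phi phi : `|functional_op Phi phi| <= `|cact phi Phi|.
Proof.
apply: blin_norm_le => // v.
have -> : functional_op Phi phi v = cact phi Phi (cfun_const X v).
  by rewrite blin_cactE functional_opE; congr (Phi _); exact: cfunP.
by rewrite (le_trans (ler_blin_norm _ _)) // ler_wpM2l // cfun_const_norm_le.
Qed.

Lemma cfun_eval_subproof (W : normedModType R) (x : X) :
  (fun eta : cfun X W => eta x) \in @blin_pred R (cfun X W) W.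
Proof. by rewrite inE; split=> //; exists 1 => eta; rewrite mul1r ler_cfun_norm. Qed.
Definition cfun_eval (W : normedModType R) (x : X) : blin (cfun X W) W :=
  Blin (@cfun_eval_subproof W x).

(* The extension of [Phi] from [C(X, V)] to [C(X, V^** )] is a limit of the
   Riemann-type sums [eta |-> \sum_i (eta i) (T psi_i)], [T := functional_op Phi],
   along finer and finer partitions of unity; these sums are bounded by [`|Phi|]
   because the dual of the type C module [C(X, V)] is of type M. *)
Lemma functional_op_extension Phi :
  exists P : dual (cfun X (dual (dual V))),
    integral_extension (functional_op Phi) P /\ `|P| <= `|Phi|.
Proof.
pose T := functional_op Phi.
(* A cover assigns an open neighbourhood to each point, pointwise intersection refines, and [Q U]
   collects the partitions of unity subordinate to [U]. *)
pose cover := [set U : X -> set X | forall x, open (U x) /\ U x x].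
pose I := ({fset X} * (X -> cfun X R^o))%type.
pose Q (U : X -> set X) := [set t : I | [/\ forall i y, 0 <= t.2 i y,
  forall y, \sum_(i <- t.1) t.2 i y = 1 & forall i y, t.2 i y != 0 -> U i y]].
have [||U V' cU cV|F [FU FQ]] := @ultra_of_directed _ _ cover Q.
- by exists (fun=> setT) => x; split=> //; exact: openT.
- move=> U cU; have Uo x : open (U x) by case: (cU x).
  have Ux x : U x x by case: (cU x).
  have [D [psi psiP]] := @partition_of_unity R X U Uo Ux.
  by exists (D, psi).
- exists (fun x => U x `&` V' x).
    move=> x; have [Uo Ux] := cU x; have [Vo Vx] := cV x.
    by split=> //; exact: openI.
  by move=> t [t0 t1 tU]; split; split=> // i y /tU [].
pose S (t : I) : dual (cfun X (dual (dual V))) :=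
  \sum_(i <- t.1) blin_comp (cfun_eval (dual (dual V)) i) (to_bidual (T (t.2 i))).
have SE t eta : S t eta = \sum_(i <- t.1) (eta i) (T (t.2 i)).
  by rewrite blin_sumE.
have cT : cover (fun=> setT) by move=> x; split=> //; exact: openT.
have Sb : \forall t \near F, `|S t| <= `|Phi|.
  apply: filterS (FQ _ cT) => t [t0 t1 _].
  apply: blin_norm_le => // eta; rewrite SE (le_trans (ler_norm_sum _ _ _)) //.
  apply: (@le_trans _ _ ((\sum_(i <- t.1) `|cact (t.2 i) Phi|) * `|eta|)).
    rewrite mulr_suml; apply: ler_sum => i _; rewrite mulrC.
    rewrite (le_trans (ler_blin_norm _ _)) // ler_pM //.
      exact: ler_cfun_norm.
    exact: functional_op_cact.
  rewrite ler_wpM2r //.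
  rewrite (le_trans (type_M_seq _ _ (type_C_dual (@cfun_type_C _ X V)) t0)) //.
  rewrite ler_piMl //; apply: cfun_norm_le => x.
  by rewrite cfun_sumE t1 normr1.
have [P [Plim PM]] := ultra_dual_limit FU (normr_ge0 Phi) Sb.
exists P; split=> // phi w.
apply: (cvg_eq_of_close _ (Plim _) (cvg_cst (w (T phi)))) => e e0.
pose c := `|w| * `|T| + 1; have c0 : 0 < c by rewrite ltr_wpDl ?mulr_ge0.
have ec0 : 0 < e / c by rewrite divr_gt0.
(* On partitions this fine, the sum of the [phi i *: t.2 i] is uniformly within [e / c] of [phi]. *)
have cphi : cover (fun i => [set y | `|phi i - phi y| < e / c]).
  move=> x; split; last by rewrite /= subrr normr0.
  apply: (@open_comp _ _ (fun y => `|phi x - phi y|) [set r | r < e / c]).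
    move=> y _; apply: cvg_norm; apply: cvgB; first exact: cvg_cst.
    exact: cfun_continuous.
  exact: open_lt.
apply: filterS (FQ _ cphi) => t [t0 t1 tphi].
have -> : S t (cfun_tensor phi w) - w (T phi) =
    w (T (\sum_(i <- t.1) phi i *: t.2 i - phi)).
  rewrite SE (linearB T) (linearB w) (linear_sum T) (linear_sum w).
  congr (_ - _); apply: eq_bigr => i _.
  have TZ : T (phi i *: t.2 i) = phi i *: T (t.2 i) by rewrite linearZ.
  have wZ : w (phi i *: T (t.2 i)) = phi i *: w (T (t.2 i)) by rewrite linearZ.
  by rewrite -[RHS]/(w (T (phi i *: t.2 i))) TZ wZ.
rewrite (le_trans (ler_blin_norm _ _)) //.
apply: (@le_trans _ _ (`|w| * (`|T| * (e / c)))).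
  rewrite ler_wpM2l // (le_trans (ler_blin_norm _ _)) // ler_wpM2l //.
  apply: cfun_norm_le => y; rewrite cfunB cfun_sumE.
  have -> : \sum_(i <- t.1) (phi i *: t.2 i) y - phi y =
      \sum_(i <- t.1) (phi i - phi y) * t.2 i y.
    rewrite -{1}[phi y]mulr1 -(t1 y) mulr_sumr -sumrB.
    by apply: eq_bigr => i _; rewrite mulrBl.
  rewrite (le_trans (ler_norm_sum _ _ _)) //.
  rewrite -[leRHS]mulr1 -(t1 y) mulr_sumr; apply: ler_sum => i _.
  rewrite normrM (ger0_norm (t0 i y)).
  have [->|ty] := eqVneq (t.2 i y) 0; first by rewrite !mulr0.
  by rewrite ler_wpM2r // ltW // tphi.
rewrite mulrA mulrC -[leRHS](divfK (lt0r_neq0 c0)) ler_wpM2l ?(ltW ec0) //.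
by rewrite lerDl.
Qed.

Lemma functional_intop_subproof Phi : functional_op Phi \in @intop_pred R X (dual V).
Proof.
by rewrite inE; have [P [PE _]] := functional_op_extension Phi; exists P.
Qed.
Definition functional_intop Phi : intop X (dual V) :=
  IntOp (functional_intop_subproof Phi).

Lemma functional_intop_norm_le Phi : `|functional_intop Phi| <= `|Phi|.
Proof.
have [P [PE PM]] := functional_op_extension Phi.
by rewrite intop_normE (@intop_extE _ _ _ (functional_intop Phi) P).
Qed.

Lemma functional_intop_linear : linear functional_intop.
Proof. by move=> k Phi Psi; apply: val_inj; apply: blinP => phi; exact: blinP. Qed.

Lemma functional_intop_blin_subproof :
  functional_intop \in @blin_pred R (dual (cfun X V)) (intop X (dual V)).
Proof.
rewrite inE; split; first exact: functional_intop_linear.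
by exists 1 => Phi; rewrite mul1r functional_intop_norm_le.
Qed.
Definition functional_intop_blin : blin (dual (cfun X V)) (intop X (dual V)) :=
  Blin functional_intop_blin_subproof.

End integral_operators_of_functionals.

Lemma functional_intop_gact (R : realType) (G : groupType) (X : compactGSpaceType G)
    (V : banachGModType R G) (g : G) (Phi : dual (cfun X V)) :
  functional_intop (gact g Phi) = gact g (functional_intop Phi).
Proof.
apply: val_inj; apply: blinP => phi; apply: blinP => v.
rewrite -[LHS]/(Phi (gact g^-1%g (cfun_tensor phi v))).
rewrite -[RHS]/(Phi (cfun_tensor (gact g^-1%g phi) (gact g^-1%g v))).
by congr (Phi _); apply: cfunP => x; rewrite /= linearZ.
Qed.

(** * The universal cocycle *)

Section postcomposition.
Context {R : realType} (X : compactHausdorffType) (V W : normedModType R).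
Context (T : blin V W).

Lemma cfun_map_subproof (eta : cfun X V) : continuous (fun x => T (eta x)).
Proof.
apply: (lipschitz_continuous_comp (g := T) (M := `|T|)).
  exact: cfun_continuous.
by move=> x y; rewrite -linearB ler_blin_norm.
Qed.

Lemma cfun_map_blin_subproof :
  (fun eta => mk_cfun (@cfun_map_subproof eta)) \in
    @blin_pred R (cfun X V) (cfun X W).
Proof.
rewrite inE; split=> [k u v|]; first by apply: cfunP => x; exact: (linearP T).
exists `|T| => eta; apply: cfun_norm_le => x.
by rewrite (le_trans (ler_blin_norm T _)) // ler_wpM2l // ler_cfun_norm.
Qed.
Definition cfun_map : blin (cfun X V) (cfun X W) := Blin cfun_map_blin_subproof.

End postcomposition.

(* [V] is meant to be the kernel of the sum, [iota] its inclusion, and [dd g h] the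
   difference of Dirac masses [delta_h - delta_g]. *)
Definition difference_data (R : realType) (G : groupType) (V : banachGModType R G)
    (iota : blin V (ell1 R G)) (dd : G -> G -> V) : Prop :=
  [/\ injective iota, forall g v, iota (gact g v) = gact g (iota v),
      forall v, ell1_sum (iota v) = 0,
      forall g h, iota (dd g h) = ell1_delta h - ell1_delta g &
      forall g h, `|dd g h| <= 2].

Lemma difference_data_exists (R : realType) (G : groupType) :
  exists (V : banachGModType R G) (iota : blin V (ell1 R G)) (dd : G -> G -> V),
    difference_data iota dd.
Proof.
have iotaP : @sum0_val R G \in @blin_pred R (sum0 R G) (ell1 R G).
  by rewrite inE; split=> [k u v //|]; exists 1 => u; rewrite mul1r.
exists (sum0 R G), (Blin iotaP), delta_diff; split=> //=.
- exact: val_inj.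
- exact: sum0_sum.
- exact: delta_diff_norm_le.
Qed.

(* The adjoint of [J] composed with [kappa] embeds [V] into [C(X, V)^**] as constant
   functions. *)
Definition constant_pairing (R : realType) (G : groupType) (X : compactGSpaceType G)
    (V E : banachGModType R G) : Prop :=
  exists (J : blin (dual (cfun X V)) E) (kappa : V -> dual E),
    [/\ forall g Phi, J (gact g Phi) = gact g (J Phi),
        forall v, `|kappa v| <= `|v|,
        forall u v, kappa (u + v) = kappa u + kappa v,
        forall g v, kappa (gact g v) = gact g (kappa v) &
        forall v Phi, kappa v (J Phi) = Phi (cfun_const X v)].

Section universal_cocycle.
Context {R : realType} {G : groupType} (X : compactGSpaceType G).
Context (V : banachGModType R G) (iota : blin V (ell1 R G)) (dd : G -> G -> V).
Hypothesis V_data : difference_data iota dd.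
Local Notation L := (cfun X (ell1 R G)).
Local Notation cfun_incl := (cfun_map X iota).

Let gact_dd k g h : gact k (dd g h) = dd (k * g)%g (k * h)%g.
Proof.
have [inj ig _ idd _] := V_data; apply: inj.
by rewrite ig !idd linearB /= !gact_ell1_delta.
Qed.

Let dd_add g k h : dd g h = dd g k + dd k h.
Proof.
have [inj _ _ idd _] := V_data; apply: inj.
by rewrite linearD /= !idd [RHS]addrC addrA subrK.
Qed.

Lemma gact_cfun_incl g eta : cfun_incl (gact g eta) = gact g (cfun_incl eta).
Proof. by have [_ ig _ _ _] := V_data; apply: cfunP => x; exact: ig. Qed.

Lemma sigma_cfun_incl eta : sigma X G (cfun_incl eta) = 0.
Proof.
by have [_ _ i0 _ _] := V_data; apply: cfunP => x; rewrite sigmaE; exact: i0.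
Qed.

Lemma sigma_const_delta g : sigma X G (cfun_const X (ell1_delta g)) = cfun_one R X.
Proof. by apply: cfunP => x; rewrite sigmaE /= ell1_sum_delta. Qed.

(** A primitive of the cocycle [kappa (dd g h)] gives an equivariant [c] with
    [c g - c 1 = kappa (dd 1 g)]. Subtracting [c 1] from the constant function [delta_1] compensates
    for the failure of the latter to be invariant. *)
Lemma vanishing_invariant_element (E : banachGModType R G) :
  constant_pairing X V E -> Hb_vanishes (dual E) 1 ->
  exists m : dual (dual L), G_invariant m /\ sums_to_one m.
Proof.
move=> [J [kappa [Jg kC kD kg kJ]]] H1.
pose f (s : 'I_2 -> G) := kappa (dd (s ord0) (s ord_max)).
have fc : bounded_cocycle f.
  split; first split.
  - exists 2 => s; rewrite (le_trans (kC _)) //.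
    by have [_ _ _ _ ->] := V_data.
  - by move=> g s; rewrite /f -kg gact_dd.
  - move=> s; rewrite /differential !big_ord_recl big_ord0 addr0 /f.
    rewrite expr0 scale1r expr1 scaleN1r /= exprS expr1 mulN1r opprK scale1r.
    (* The faces of [s] are [(a, b)], [(a', c)] and [(a'', c')]; once equal entries are identified,
       the claim is the additivity of [dd]. *)
    set a := s _; set b := s _; set a' := s _; set c := s _.
    set a'' := s _; set c' := s _.
    have -> : a' = a'' by congr s; exact: val_inj.
    have -> : c = b by congr s; exact: val_inj.
    have -> : c' = a by congr s; exact: val_inj.
    rewrite (dd_add a'' a b) kD.
    by rewrite opprD [- _ - _ + _]addrAC addNr add0r subrr.
have [h [[M hM] hg] hf] := H1 _ fc.
pose c g := h (fun=> g).
have cg k g : c (k * g)%g = gact k (c g) by rewrite /c -hg.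
have cD g k : c k - c g = kappa (dd g k).
  have := congr1 (fun F => F (fun i : 'I_2 => if i == ord0 then g else k)) hf.
  rewrite /f /= => <-.
  rewrite /differential !big_ord_recl big_ord0 addr0 expr0 scale1r expr1 scaleN1r.
  by congr (h _ - h _); apply/funext => j; rewrite (ord1 j).
(* Through [J], functionals on [E] become elements of the bidual of [cfun X V], which the second
   adjoint of the inclusion carries to the bidual of [L]. *)
pose push (M' : dual E) : dual (dual L) :=
  adjoint (adjoint cfun_incl) (adjoint J M').
have push_g g M' : gact g (push M') = push (gact g M').
  apply: blinP => lam.
  rewrite -[LHS]/(M' (J (adjoint cfun_incl (gact g^-1%g lam)))).
  rewrite -[RHS]/(M' (gact g^-1%g (J (adjoint cfun_incl lam)))) -Jg.
  congr (M' (J _)); apply: blinP => eta.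
  rewrite -[LHS]/(lam (gact g^-1^-1%g (cfun_incl eta))).
  by rewrite -gact_cfun_incl.
(* The correction does not affect the sum, since the range of [iota] has sum zero. *)
pose m := to_bidual (cfun_const X (ell1_delta 1%g : ell1 R G)) - push (c 1%g).
exists m; split.
  move=> g.
  have gto : gact g (to_bidual (cfun_const X (ell1_delta 1%g : ell1 R G))) =
      to_bidual (cfun_const X (ell1_delta g)).
    apply: blinP => lam.
    rewrite -[LHS]/(lam (gact g^-1^-1%g (cfun_const X (ell1_delta 1%g : ell1 R G)))).
    congr (lam _); apply: cfunP => x.
    by rewrite -[LHS]/(gact g^-1^-1%g (ell1_delta 1%g)) invgK gact_ell1_delta mulg1.
  rewrite /m linearB /= gto push_g -cg mulg1.
  apply: blinP => lam; pose Psi := adjoint cfun_incl lam.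
  pose d k : L := cfun_const X (ell1_delta k).
  have cPsi : c g (J Psi) - c 1%g (J Psi) = lam (d g) - lam (d 1%g).
    transitivity (kappa (dd 1%g g) (J Psi)); first by rewrite -cD.
    rewrite kJ; transitivity (lam (d g - d 1%g)); last by rewrite linearB.
    rewrite -[LHS]/(lam (cfun_incl _)); congr (lam _); apply: cfunP => x.
    by have [_ _ _ idd _] := V_data; exact: idd.
  have swap (x y z t : R) : x - y = z - t -> z - x = t - y by move=> ?; lra.
  exact: swap cPsi.
apply: blinP => nu.
rewrite -[LHS]/(nu (sigma X G (cfun_const X (ell1_delta 1%g))) -
  c 1%g (J (adjoint cfun_incl (adjoint (sigma X G) nu)))).
rewrite sigma_const_delta.
have -> : adjoint cfun_incl (adjoint (sigma X G) nu) = 0.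
  apply: blinP => eta; rewrite -[LHS]/(nu (sigma X G (cfun_incl eta))).
  by rewrite sigma_cfun_incl linear0.
by rewrite linear0 linear0 subr0.
Qed.

End universal_cocycle.

Lemma intop_eval_subproof (R : realType) (X : compactHausdorffType)
    (W : normedModType R) (phi : cfun X R^o) :
  (fun T : intop X W => T phi) \in @blin_pred R (intop X W) W.
Proof.
rewrite inE; split; first by move=> k S T.
by exists `|phi| => T; rewrite mulrC; exact: ler_intop_norm0.
Qed.
Definition intop_eval (R : realType) (X : compactHausdorffType)
    (W : normedModType R) (phi : cfun X R^o) : blin (intop X W) W :=
  Blin (@intop_eval_subproof R X W phi).

(** [kappa v] evaluates an operator at the constant function one and the result at [v]; on
    [functional_intop Phi] this is [Phi] at the constant function [v]. *)
Lemma intop_constant_pairing (R : realType) (G : groupType) (X : compactGSpaceType G)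
    (V : banachGModType R G) :
  constant_pairing X V (intop X (dual V)).
Proof.
pose kappa (v : V) : dual (intop X (dual V)) :=
  blin_comp (intop_eval (dual V) (cfun_one R X)) (to_bidual v).
have kE v T : kappa v T = T (cfun_one R X) v by [].
have kle v : `|kappa v| <= `|v|.
  apply: blin_norm_le => // T.
  rewrite kE mulrC (le_trans (ler_blin_norm _ _)) //.
  rewrite ler_wpM2r // (le_trans (ler_intop_norm0 T _)) //.
  apply: ler_piMr; first exact: (normr_ge0 T).
  by apply: cfun_norm_le => x; rewrite normr1.
have kD u v : kappa (u + v) = kappa u + kappa v.
  apply: blinP => T; rewrite blinD !kE.
  exact: (linearD (T (cfun_one R X))).
have kg g v : kappa (gact g v) = gact g (kappa v).
  apply: blinP => T.
  rewrite -[RHS]/(T (gact g^-1^-1%g (cfun_one R X)) (gact g^-1^-1%g v)) invgK kE.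
  by congr (T _ _); exact: cfunP.
have kJ v Phi : kappa v (functional_intop Phi) = Phi (cfun_const X v).
  rewrite kE -[LHS]/(Phi (cfun_tensor (cfun_one R X) v)).
  by congr (Phi _); apply: cfunP => x; rewrite /= scale1r.
exists (functional_intop_blin X V), kappa; split.
- exact: functional_intop_gact.
- exact: kle.
- exact: kD.
- exact: kg.
- exact: kJ.
Qed.

Lemma bidual_constant_pairing (R : realType) (G : groupType) (X : compactGSpaceType G)
    (V : banachGModType R G) :
  constant_pairing X V (dual (cfun X V)).
Proof.
exists (blin_id (dual (cfun X V))), (fun v => to_bidual (cfun_const X v)).
split=> //.
- move=> v; apply: blin_norm_le => // Phi.
  rewrite mulrC (le_trans (ler_blin_norm Phi _)) // ler_wpM2l //.
  exact: cfun_const_norm_le.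
- move=> u v; apply: blinP => Phi; rewrite blinD -[LHS]/(Phi (cfun_const X (u + v))).
  by rewrite -[RHS](linearD Phi); congr (Phi _); exact: cfunP.
- move=> g v; apply: blinP => Phi.
  rewrite -[RHS]/(Phi (gact g^-1^-1%g (cfun_const X v))).
  rewrite -[LHS]/(Phi (cfun_const X (gact g v))) invgK.
  by congr (Phi _); exact: cfunP.
Qed.

(** * From vanishing in degree one to invariant elements, and the equivalences *)

Lemma bidual_vanishing_invariant (R : realType) (G : groupType)
    (X : compactGSpaceType G) :
  (forall V : banachGModType R G, Hb_vanishes (dual (dual (cfun X V))) 1) ->
  exists m : dual (dual (cfun X (ell1 R G))), G_invariant m /\ sums_to_one m.
Proof.
have [V [iota [dd Vd]]] := difference_data_exists R G.
have := vanishing_invariant_element Vd (bidual_constant_pairing X V).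
by move=> + H; apply; exact: H.
Qed.

Lemma intop_vanishing_invariant (R : realType) (G : groupType)
    (X : compactGSpaceType G) :
  (forall W : banachGModType R G, Hb_vanishes (dual (intop X W)) 1) ->
  exists m : dual (dual (cfun X (ell1 R G))), G_invariant m /\ sums_to_one m.
Proof.
have [V [iota [dd Vd]]] := difference_data_exists R G.
have := vanishing_invariant_element Vd (intop_constant_pairing X V).
by move=> + H; apply; exact: H.
Qed.

Theorem mainTheorem1 (R : realType) (G : groupType) (X : compactGSpaceType G) :
  [<-> (* 1 *)
       topologically_amenable R X;
       (* 2 *)
       forall (V : banachGModType R G) (n : nat), (1 <= n)%N ->
         Hb_vanishes (dual (dual (cfun X V))) n;
       (* 3 *)
       forall (W : banachGModType R G) (n : nat), (1 <= n)%N ->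
         Hb_vanishes (dual (intop X W)) n;
       (* 4 *)
       forall E : gxModType R X, type_M E -> forall n : nat, (1 <= n)%N ->
         Hb_vanishes (dual E) n;
       (* 5 *)
       (forall V : banachGModType R G, Hb_vanishes (dual (dual (cfun X V))) 1) \/
       (forall W : banachGModType R G, Hb_vanishes (dual (intop X W)) 1) \/
       (forall E : gxModType R X, type_M E -> Hb_vanishes (dual E) 1);
       (* 5, each condition individually *)
       forall V : banachGModType R G, Hb_vanishes (dual (dual (cfun X V))) 1;
       forall W : banachGModType R G, Hb_vanishes (dual (intop X W)) 1;
       forall E : gxModType R X, type_M E -> Hb_vanishes (dual E) 1;
       (* 6 *)
       forall V : banachGModType R G,
         relatively_injective (dual (dual (cfun X V)));
       (* 7 *)
       forall W : banachGModType R G, relatively_injective (dual (intop X W));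
       (* 8 *)
       forall E : gxModType R X, type_C (dual E) ->
         relatively_injective (dual E);
       (* 9 *)
       exists m : dual (dual (cfun X (ell1 R G))),
         G_invariant m /\ sums_to_one m;
       (* 10 *)
       exists m : dual (dual (cfun X (ell1 R G))),
         [/\ `|m| = 1, positive_bidual m, G_invariant m & sums_to_one m] ].
Proof.
have inv_amen : (exists m : dual (dual (cfun X (ell1 R G))),
    G_invariant m /\ sums_to_one m) -> topologically_amenable R X.
  by move=> [m [mi ms]]; apply/locally_amenable_net/invariant_locally_amenable/ms.
have ri_C : topologically_amenable R X -> forall E : gxModType R X,
    type_C (dual E) -> relatively_injective (dual E).
  by move=> /amenable_locally loc E; exact: amenable_relatively_injective.
have ri_M (am : topologically_amenable R X) (E : gxModType R X) :
    type_M E -> relatively_injective (dual E).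
  by move=> ME; apply: (ri_C am); exact: type_M_dual.
have van_M (am : topologically_amenable R X) (E : gxModType R X) n :
    type_M E -> (1 <= n)%N -> Hb_vanishes (dual E) n.
  by move=> ME n1; apply: relatively_injective_vanishing => //; exact: ri_M.
have cM (V : banachGModType R G) : type_M (dual (cfun X V)).
  exact/type_C_dual/cfun_type_C.
have iM (W : banachGModType R G) : type_M (intop X W) by exact: intop_type_M.
have van2 : (forall V : banachGModType R G,
      Hb_vanishes (dual (dual (cfun X V))) 1) ->
    topologically_amenable R X.
  by move=> H; exact/inv_amen/bidual_vanishing_invariant.
have van3 : (forall W : banachGModType R G, Hb_vanishes (dual (intop X W)) 1) ->
    topologically_amenable R X.
  by move=> H; exact/inv_amen/intop_vanishing_invariant.
(* The dual of [cfun X V] is itself a module of type M, so its dual, the bidual of [cfun X V], is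
   covered by the hypothesis. *)
have van4 : (forall E : gxModType R X, type_M E -> Hb_vanishes (dual E) 1) ->
    topologically_amenable R X.
  by move=> H; apply: van2 => V; apply: (H (dual (cfun X V))); exact: cM.
(* The links from a vanishing, injectivity or invariance condition derive amenability or an
   invariant element; [ri_C], [ri_M], [van_M] and [locally_amenable_invariant] go from amenability
   to the other items. *)
tfae.
- by move=> am V n; apply: (van_M am (dual (cfun X V))); exact: cM.
- move=> H; have am : topologically_amenable R X by apply: van2 => V; exact: H.
  by move=> W n; apply: (van_M am (intop X W)); exact: iM.
- move=> H; have am : topologically_amenable R X by apply: van3 => V; exact: H.
  by move=> E ME n; exact: van_M.
- by move=> H; right; right => E ME; exact: H.
- move=> H; have am : topologically_amenable R X.
    by case: H => [/van2|[/van3|/van4]].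
  by move=> V; apply: (van_M am (dual (cfun X V))) => //; exact: cM.
- by move=> /van2 am W; apply: (van_M am (intop X W)) => //; exact: iM.
- by move=> /van3 am E ME; exact: van_M.
- by move=> /van4 am V; apply: (ri_M am (dual (cfun X V))); exact: cM.
- move=> H; have am : topologically_amenable R X.
    by apply: van2 => V; exact: relatively_injective_vanishing.
  by move=> W; apply: (ri_M am (intop X W)); exact: iM.
- move=> H; apply: ri_C; apply: van3 => W.
  exact: relatively_injective_vanishing.
(* The bidual of [cfun X V] has type C, being the dual of a type M module. *)
- move=> H; apply: bidual_vanishing_invariant => V.
  apply: relatively_injective_vanishing => //.
  by apply: (H (dual (cfun X V))); apply: type_M_dual; exact: cM.
- by move=> /inv_amen /amenable_locally; exact: locally_amenable_invariant.
- by move=> [m [_ _ mi ms]]; apply: inv_amen; exists m.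
Qed.
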